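(* Let $C\subset\mathbb{P}^2$ be a rational curve given by a proper parameterization $(f_0:f_1:f_2)$ with $f_u\in K[s,t]_n$, $n\ge3$. Let $\mathcal{C}_2\subset\mathbb{P}^2$ be the conic $\{4x_0x_2-x_1^2=0\}$ and let $X_2\subset\mathbb{P}^2$ be the $0$-dimensional scheme associated to the parameterization (defined in the context). Then: (1) $C$ is cuspidal if and only if $\operatorname{Supp}(X_2)\subset\mathcal{C}_2$; (2) $C$ has only ordinary singularities if and only if the scheme $X_2$ is reduced and $X_2\cap\mathcal{C}_2=\emptyset$. Moreover, in case (1), i.e. when $C$ is cuspidal, the number of singular points of $C$ is exactly the cardinality of $\operatorname{Supp}(X_2)$.
   Context: $K$ is an algebraically closed field of characteristic $0$, $\mathbb{P}^m=\mathbb{P}^m_K$. $C\subset\mathbb{P}^2$ is the image of $\mathbf f=(f_0:f_1:f_2):\mathbb{P}^1\to\mathbb{P}^2$, $f_u=\sum_{j=0}^n a_{uj}s^{n-j}t^j$. Proper means: $\mathbf f$ is generically $1:1$ onto $C$ and $f_0,f_1,f_2$ have no common zeroes. $M_2$ is the $(n+2)\times(n+1)$ matrix (columns numbered $0,\dots,n$) whose first $n-1$ rows are indexed by $i=0,\dots,n-2$, the $i$-th having entries $x_0,x_1,x_2$ in columns $i,i+1,i+2$ and $0$ elsewhere, and whose last three rows are $(a_{u0},\dots,a_{un})$, $u=0,1,2$. $X_2\subset\mathbb{P}^2$ (coordinates $x_0,x_1,x_2$) is the scheme defined by the $(n+1)$-minors (maximal minors) of $M_2$; it is $0$-dimensional.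 $C_n=\nu_n(\mathbb{P}^1)\subset\mathbb{P}^n$ with $\nu_n(s:t)=(s^n:s^{n-1}t:\dots:t^n)$, and $\pi:\mathbb{P}^n\dashrightarrow\mathbb{P}^2$ is the projection $\pi(z_0:\dots:z_n)=(\sum_j a_{0j}z_j:\sum_j a_{1j}z_j:\sum_j a_{2j}z_j)$, so $\pi\circ\nu_n=\mathbf f$. $C$ is cuspidal if all its singular points are cusps, i.e. unibranch singular points (the resolution of the singularity has only one point over $P$). $C$ has only ordinary singularities if every singular point $P\in C$, of multiplicity $m$ say, is the image under $\pi|_{C_n}$ of $m$ distinct points $Q_1,\dots,Q_m\in C_n$ and the tangent lines $T_{Q_i}(C_n)$ satisfy $\pi(T_{Q_i}(C_n))\ne\pi(T_{Q_{i'}}(C_n))$ for $i\neq i'$. *)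

(* Defs.v *)
From HB Require Import structures.
From mathcomp Require Import all_boot all_order all_algebra.
From mathcomp Require Export mpoly.

Set Implicit Arguments.
Unset Strict Implicit.
Unset Printing Implicit Defensive.

Import GRing.Theory.
Local Open Scope ring_scope.

(* Points of P^m are the lines of K^(m+1), so that equality of points is
   Leibniz equality. *)
Record point (K : fieldType) (m : nat) :=
  Point { line :> {vspace 'rV[K]_m.+1}; _ : \dim line == 1%N }.

HB.instance Definition _ (K : fieldType) (m : nat) :=
  [isSub for @line K m].
HB.instance Definition _ (K : fieldType) (m : nat) :=
  [Equality of point K m by <:].

(* Homogeneous coordinates, determined up to a nonzero scalar; the values below
   do not depend on the choice made by vpick. *)
Definition coords (K : fieldType) (m : nat) (P : point K m) : 'rV[K]_m.+1 :=
  vpick P.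

Definition vanishes_at (K : fieldType) (m : nat) (g : {mpoly K[m.+1]})
    (P : point K m) : Prop :=
  forall v : 'rV[K]_m.+1, v \in line P -> v != 0 -> g.@[v 0] = 0.

Definition has_card (T : eqType) (A : T -> Prop) (N : nat) : Prop :=
  exists s : seq T, [/\ uniq s, size s = N & forall x, x \in s <-> A x].

Section Curve.
Variables (K : closedFieldType) (n : nat).
(* a u j is the coefficient of s^(n-j) t^j in the form f_u. *)
Variable a : 'M[K]_(3, n.+1).

Definition form_eval (u : 'I_3) (s t : K) : K :=
  \sum_(j < n.+1) a u j * s ^+ (n - j) * t ^+ j.

Definition forms_vec (v : 'rV[K]_2) : 'rV[K]_3 :=
  \row_u form_eval u (v 0 0) (v 0 1).

(* The image f(Q), as a subspace of K^3: a point of P^2 unless Q is a common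
   zero of the three forms, in which case it is 0. *)
Definition param (Q : point K 1) : {vspace 'rV[K]_3} :=
  <[forms_vec (coords Q)]>%VS.

Definition on_curve (P : point K 2) : Prop :=
  exists Q : point K 1, param Q = P.

Definition no_common_zero : Prop :=
  forall s t : K, (forall u, form_eval u s t = 0) -> s = 0 /\ t = 0.

(* Outside a finite set of points of C, the fibres are singletons. *)
Definition generically_injective : Prop :=
  exists E : seq (point K 2), forall P, on_curve P -> P \notin E ->
    exists! Q : point K 1, param Q = P.

Definition proper_param : Prop := no_common_zero /\ generically_injective.

(* The ideal I(C) of the plane curve C (with its reduced structure). *)
Definition curve_ideal (g : {mpoly K[3]}) : Prop :=
  forall P, on_curve P -> vanishes_at g P.

Definition singular (P : point K 2) : Prop :=
  on_curve P /\
  forall g, curve_ideal g -> forall i : 'I_3, vanishes_at g^`M(i) P.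

(* The multiplicity of C at P is the order of vanishing at P of an equation of
   C, i.e. of a generator of the principal ideal I(C); this is also the least
   order of vanishing of the elements of I(C).  In characteristic 0 it is read
   off the partial derivatives in homogeneous coordinates. *)
Definition multiplicity (P : point K 2) (m : nat) : Prop :=
  (forall g, curve_ideal g -> forall d : 'X_{1..3}, (mdeg d < m)%N ->
     vanishes_at g^`M[d] P) /\
  (exists g, exists d : 'X_{1..3},
     [/\ curve_ideal g, mdeg d = m & ~ vanishes_at g^`M[d] P]).

(* For a proper parameterization, f : P^1 -> C is the resolution of the
   singularities of C. *)
Definition cusp (P : point K 2) : Prop :=
  singular P /\ exists! Q : point K 1, param Q = P.

Definition cuspidal : Prop := forall P, singular P -> cusp P.

Definition veronese_vec (v : 'rV[K]_2) : 'rV[K]_n.+1 :=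
  \row_j (v 0 0 ^+ (n - j) * v 0 1 ^+ j).

Definition veronese (Q : point K 1) : {vspace 'rV[K]_n.+1} :=
  <[veronese_vec (coords Q)]>%VS.

(* The tangent line to C_n at nu_n(Q) is spanned by the two partial derivatives
   of s^(n-j) t^j. *)
Definition veronese_ds (v : 'rV[K]_2) : 'rV[K]_n.+1 :=
  \row_j ((n - j)%:R * v 0 0 ^+ (n - j).-1 * v 0 1 ^+ j).
Definition veronese_dt (v : 'rV[K]_2) : 'rV[K]_n.+1 :=
  \row_j (j%:R * v 0 0 ^+ (n - j) * v 0 1 ^+ j.-1).

Definition tangent_line (Q : point K 1) : {vspace 'rV[K]_n.+1} :=
  (<[veronese_ds (coords Q)]> + <[veronese_dt (coords Q)]>)%VS.

(* The projection from P^n to P^2, on linear subspaces; a point of its center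
   is sent to 0. *)
Definition projection (L : {vspace 'rV[K]_n.+1}) : {vspace 'rV[K]_3} :=
  (linfun (mulmxr a^T) @: L)%VS.

Lemma projection_veronese Q : projection (veronese Q) = param Q.
Proof.
rewrite /projection /veronese /param limg_line lfunE /=; congr (<[_]>%VS).
apply/rowP=> u; rewrite !mxE; apply: eq_bigr => j _.
by rewrite !mxE mulrC mulrA.
Qed.

Definition ordinary (P : point K 2) : Prop :=
  exists2 m : nat, multiplicity P m &
  exists Q : 'I_m -> point K 1,
  [/\ injective (fun i => veronese (Q i)),
      forall i, projection (veronese (Q i)) = P
    & forall i i', i != i' ->
        projection (tangent_line (Q i)) <> projection (tangent_line (Q i'))].

Definition only_ordinary_singularities : Prop :=
  forall P, singular P -> ordinary P.

Definition M2 : 'M[{mpoly K[3]}]_(n.+2, n.+1) :=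
  \matrix_(i, j)
    if (i < n.-1)%N then
      if (i <= j <= i.+2)%N then 'X_(inord (j - i)) else 0
    else (a (inord (i - n.-1)) j)%:MP.

Definition max_minor (k : 'I_n.+2) : {mpoly K[3]} := \det (row' k M2).

Definition supp_X2 (P : point K 2) : Prop :=
  forall k, vanishes_at (max_minor k) P.

(* The chart x_i <> 0 of P^2 is identified with the plane x_i = 1 of A^3; this
   is the ideal of K[x_0, x_1, x_2] that defines X_2 in this chart. *)
Definition chart_ideal (i : 'I_3) (g : {mpoly K[3]}) : Prop :=
  exists c : 'I_n.+2 -> {mpoly K[3]}, exists d : {mpoly K[3]},
    g = \sum_k c k * max_minor k + d * ('X_i - 1).

(* A scheme is reduced when the coordinate rings of the members of an affine
   open cover are reduced. *)
Definition X2_reduced : Prop :=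
  forall (i : 'I_3) (g : {mpoly K[3]}) (e : nat),
    chart_ideal i (g ^+ e) -> chart_ideal i g.

End Curve.

Definition conic (K : closedFieldType) : {mpoly K[3]} :=
  4%:R * 'X_(inord 0) * 'X_(inord 2) - 'X_(inord 1) ^+ 2.

Definition on_conic (K : closedFieldType) (P : point K 2) : Prop :=
  vanishes_at (conic K) P.

(* Main.v *)
(* A point of [X_2] is a nonzero [x] for which [M_2(x)] has a nonzero kernel
   vector [z].  Write the quadratic form [x_0 s^2 + x_1 s t + x_2 t^2] as a
   product of linear forms vanishing at [Q] and [Q'].  The first rows of [M_2(x)]
   say that [z] lies on the secant of [C_n] through [Q] and [Q'] (on the tangent
   at [Q] if [Q = Q'], that is, if [x] is on the conic), and the last three that
   [z] is in the center of [pi].  So [X_2] consists of the pairs [{Q, Q'}] with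
   [f(Q) = f(Q')] and, on the conic, of the points [Q] where the differential of
   [f] degenerates (critical points).

   That such points give singularities of [C], and that the multiplicity at [P] is
   the number of its preimages if none of them is critical, comes from an equation
   of [C].  Project from a general point [e] of a general line through [P], so that
   [f = (p_0 : p_1 : p_2)] with [p_0] monic of degree [n] in an affine parameter
   [t], and [p_0], [p_2] coprime with [deg p_2 < n].  Then [y = p_1/p_2] is a
   polynomial in [t] modulo [p_0 - x p_2] over [K[x]], and its characteristic
   polynomial [F(x,y)] is monic of degree [n] in [y].  It divides every element of
   the ideal of [C], because a general line through [e] meets [C] in [n] distinct
   points; it vanishes at [P = (0,0)] to order at least the degree of a common
   divisor of [p_0] and [p_1], because multiplication by [y] at [x = 0] has a
   kernel of that dimension; and [F(0,y)] has [n - m] distinct nonzero roots if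
   [P] has [m] preimages, none of them critical.

   For reducedness, let [z = al nu(Q) + be nu(Q')] span the kernel of [M_2(x)].  The
   minors vanish to second order at [x] in a direction [v] if and only if
   [M_2(v) z] is in the image of [M_2(x)], up to the constant rows; this says that
   a combination of [df(Q)] and [df(Q')], with coefficients proportional to the
   values at [Q] and [Q'] of the quadratic form of [v], lies on the point [f(Q)].
   Hence the tangent space of [X_2] at [x] is zero if and only if the two tangent
   lines differ.  Since [X_2] has finitely many points, its ideals in the charts
   contain a nonzero polynomial in each coordinate, and such an ideal is radical
   if and only if all its tangent spaces are zero. *)

Require Import Defs.
From mathcomp Require Import all_boot all_order all_algebra.
From mathcomp Require Import separable ring.
From Stdlib Require Classical_Prop.

Set Implicit Arguments.
Unset Strict Implicit.
Unset Printing Implicit Defensive.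

Import GRing.Theory.
Local Open Scope ring_scope.

(** * Univariate polynomials *)

Section Prelim.
Variable K : fieldType.

Lemma coefM_top (p q : {poly K}) m k :
  (size p <= m.+1)%N -> (size q <= k.+1)%N -> (p * q)`_(m + k) = p`_m * q`_k.
Proof.
move=> hp hq; rewrite coefM.
have hm : (m < (m + k).+1)%N by rewrite ltnS leq_addr.
rewrite (bigD1 (Ordinal hm)) //= addKn big1 ?addr0 // => i.
rewrite -val_eqE /= neq_ltn => /orP [lt_i|lt_i].
  rewrite (nth_default 0 (n := m + k - i) (leq_trans hq _)) ?mulr0 //.
  by rewrite ltn_subRL ltn_add2r.
by rewrite (nth_default 0 (n := i) (leq_trans hp lt_i)) mul0r.
Qed.

(** Left multiplication by the constant invertible matrix [invmx (col_ebase N0)] turns [N] at [0]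
    into [pid_mx r *m row_ebase N0], whose rows from [r] on vanish. Those [n - r] rows of the
    product are thus multiples of ['X], and [n - r] is at least [m]. *)
Lemma dvdXn_det n (N : 'M[{poly K}]_n) m :
  (\rank (map_mx (horner_eval 0) N) + m <= n)%N -> 'X^m %| \det N.
Proof.
set N0 := map_mx _ _ => le_rank; set r := \rank N0 in le_rank.
have [D [N1 defN]] : exists D : 'rV[{poly K}]_n, exists N1,
    [/\ \prod_i D 0 i = 'X^(n - r)%N
      & map_mx polyC (invmx (col_ebase N0)) *m N = diag_mx D *m N1].
  exists (\row_i (if (i < r)%N then 1 else 'X)).
  set N2 := _ *m N.
  exists (\matrix_(i, j) if (i < r)%N then N2 i j else N2 i j %/ 'X); split.
    under eq_bigr do rewrite mxE.
    rewrite -(big_mkord xpredT (fun i => if (i < r)%N then 1 else 'X : {poly K})).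
    rewrite (big_cat_nat (n := r)) ?rank_leq_row //= big_nat big1 => [|i /= ->//].
    rewrite mul1r big_nat (eq_bigr (fun=> 'X)) => [|i /andP[]]; last first.
      by rewrite leqNgt => /negPf ->.
    by rewrite -big_nat prodr_const_nat.
  apply/matrixP=> i j; rewrite mul_diag_mx !mxE.
  case: ifP => [|/negbT]; rewrite ?mul1r // -leqNgt => le_ri.
  rewrite mulrC divpK // -['X]subr0 dvdp_XsubCl rootE.
  have /matrixP/(_ i j) : map_mx (horner_eval 0) N2 = pid_mx r *m row_ebase N0.
    rewrite map_mxM -map_mx_comp -/N0 (map_mx_id (f := _ \o _)); last first.
      by move=> x /=; rewrite /horner_eval hornerC.
    by rewrite -{2}(mulmx_ebase N0) -mulmxA mulKmx ?col_ebase_unit.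
  rewrite !mxE /horner_eval => ->; rewrite big1 // => k _.
  by rewrite mxE [(i < r)%N]ltnNge le_ri andbF mul0r.
case: defN => defD /(congr1 determinant).
rewrite !det_mulmx det_map_mx det_diag defD => detN.
have : 'X^m %| (\det (invmx (col_ebase N0)))%:P * \det N.
  by rewrite detN dvdp_mulr // dvdp_exp2l // leq_subRL ?rank_leq_row // addnC.
by rewrite mul_polyC dvdpZr // det_inv invr_eq0 -unitfE -unitmxE col_ebase_unit.
Qed.

Lemma char_poly_horner (R : comNzRingType) n (M : 'M[R]_n) (a : R) :
  (char_poly M).[a] = \det (a%:M - M).
Proof.
rewrite -[LHS]/(horner_eval a _) /char_poly -det_map_mx; congr (\det _).
apply/matrixP=> i j; rewrite mxE /char_poly_mx !mxE /= /horner_eval hornerD hornerN hornerC.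
by rewrite hornerMn hornerX.
Qed.

Lemma char_poly_trmx (R : comNzRingType) n (M : 'M[R]_n) :
  char_poly M^T = char_poly M.
Proof.
rewrite /char_poly -det_tr; congr (\det _); apply/matrixP=> i j.
by rewrite mxE /char_poly_mx !mxE eq_sym.
Qed.

End Prelim.

Section ClosedPoly.
Variable K : closedFieldType.

Lemma exists_notin (s : seq K) : exists x, x \notin s.
Proof.
have nz : \prod_(z <- s) ('X - z%:P) != 0.
  by rewrite monic_neq0 // monic_prod_XsubC.
have [x] := closed_nonrootP _ nz.
by rewrite root_prod_XsubC; exists x.
Qed.

Lemma poly_eq0_cofinite (p : {poly K}) (s : seq K) :
  (forall x, x \notin s -> p.[x] = 0) -> p = 0.
Proof.
move=> h; apply/eqP; apply: contraT => nz.
have [rs def_p] := closed_field_poly_normal p.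
have [x] := exists_notin (s ++ rs); rewrite mem_cat negb_or => /andP [xs xrs].
have := h x xs => /eqP; rewrite -/(root p x) def_p rootZ ?lead_coef_eq0 //.
by rewrite root_prod_XsubC (negPf xrs).
Qed.

Lemma poly2_eq0_cofinite (G : {poly {poly K}}) (s : seq K) :
  (forall x, x \notin s -> map_poly (horner_eval x) G = 0) -> G = 0.
Proof.
move=> h; apply/polyP=> i; rewrite coef0; apply: (@poly_eq0_cofinite _ s) => x xs.
by have /polyP/(_ i) := h x xs; rewrite coef_map coef0.
Qed.

Lemma separable_roots (p : {poly K}) n : p \is monic -> size p = n.+1 ->
    (forall x, root p x -> p^`().[x] != 0) ->
  exists rs, [/\ uniq rs, size rs = n & p = \prod_(z <- rs) ('X - z%:P)].
Proof.
move=> mon_p sz_p sep; have [rs def_p] := closed_field_poly_normal p.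
exists rs; rewrite (monicP mon_p) scale1r in def_p.
split=> //; last by move: sz_p; rewrite def_p size_prod_XsubC => [[]].
rewrite -separable_prod_XsubC -def_p unlock.
exact: Pdiv.ClosedField.root_coprimep.
Qed.

Hypothesis charK : [pchar K] =i pred0.

Lemma natr_neq0 n : (n.+1%:R : K) != 0.
Proof. by rewrite (pcharf0P _).1. Qed.

(** With [k = deg q < n], the coefficient in degree [n + k - 1] is [n - k] times the leading
    coefficient of [q], nonzero in characteristic 0. *)
Lemma wronskian_neq0 (p q : {poly K}) n : (0 < n)%N ->
    p \is monic -> size p = n.+1 -> q != 0 -> (size q <= n)%N ->
  p^`() * q - p * q^`() != 0.
Proof.
move=> n_gt0 mon_p sz_p q0 sz_q.
case: n n_gt0 sz_p sz_q => // n _ sz_p; case sz_q: (size q) => [|k] lt_kn.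
  by rewrite -size_poly_eq0 sz_q in q0.
have lq : q`_k != 0 by rewrite -[k]/(k.+1.-1) -sz_q -lead_coefE lead_coef_eq0.
have lp : p`_n.+1 = 1 by rewrite -(monicP mon_p) lead_coefE sz_p.
apply/eqP=> /polyP/(_ (n + k)%N); rewrite coef0 coefB => /eqP; apply/negP.
have dp : (size p^`() <= n.+1)%N by rewrite -ltnS -sz_p lt_size_deriv ?monic_neq0.
rewrite coefM_top ?sz_q // coef_deriv lp.
have -> : (p * q^`())`_(n + k) = q`_k *+ k.
  (* The top coefficient of the derivative of [q] sits in degree [k - 1], so a constant [q], with
     zero derivative, is treated apart. *)
  case: k sz_q {lt_kn lq} => [|k] sz_q.
    by rewrite (size1_polyC (p := q)) ?sz_q // derivC mulr0 coef0 mulr0n.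
  rewrite -addSnnS coefM_top ?sz_p ?lp ?coef_deriv ?mul1r //.
  by rewrite -ltnS -sz_q lt_size_deriv.
rewrite mulr_natl -mulrnBr; last by rewrite ltnW.
by rewrite -mulr_natr mulf_neq0 // subSn // natr_neq0.
Qed.

End ClosedPoly.

(** * The equation of a plane curve, from the pencil of lines through a point *)

Section Pencil.
Variables (K : closedFieldType) (charK : [pchar K] =i pred0) (n : nat).
Variables p0 p1 p2 : {poly K}.
Hypotheses (n_gt0 : (0 < n)%N) (mon_p0 : p0 \is monic) (sz_p0 : size p0 = n.+1).
Hypotheses (sz_p2 : (size p2 <= n)%N) (cop : coprimep p0 p2).

(** The roots of [p0 - l *: p2] are the parameters sent to the line [x = l] of the pencil; [E] lists
    the exceptional lines, and equality of the values of [p1 / p2] is written without division. *)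
Definition injective_outside (E : seq K) := forall l, l \notin E ->
  forall t t', root (p0 - l *: p2) t -> root (p0 - l *: p2) t' ->
  p1.[t] * p2.[t'] = p1.[t'] * p2.[t] -> t = t'.

(* In [{poly {poly K}}] the inner variable stands for [x = p0 / p2] and the outer
   one for [y = p1 / p2]. *)
Definition vanishes_on_graph (G : {poly {poly K}}) := forall t, p2.[t] != 0 ->
  G.[(p1.[t] / p2.[t])%:P].[p0.[t] / p2.[t]] = 0.

Lemma p2_neq0 : p2 != 0.
Proof. by apply/eqP=> p2_0; move: cop; rewrite p2_0 coprimep0 -size_poly_eq1 sz_p0;
  case: n n_gt0. Qed.

Lemma size_fibre l : size (p0 - l *: p2) = n.+1.
Proof.
rewrite size_polyDl sz_p0 // size_polyN ltnS.
by rewrite (leq_trans (size_scale_leq _ _)).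
Qed.

Lemma monic_fibre l : p0 - l *: p2 \is monic.
Proof.
rewrite monicE lead_coefDl ?(monicP mon_p0) // size_polyN sz_p0 ltnS.
by rewrite (leq_trans (size_scale_leq _ _)).
Qed.

Lemma p2_fibre_neq0 l t : root (p0 - l *: p2) t -> p2.[t] != 0.
Proof.
rewrite rootE !hornerE subr_eq0 => /eqP p0t; apply/eqP=> p2t.
have rt : root p0 t by rewrite rootE p0t p2t mulr0.
by have := coprimep_root cop rt; rewrite p2t eqxx.
Qed.

Lemma fibre_value l t : root (p0 - l *: p2) t -> p0.[t] / p2.[t] = l.
Proof.
move=> rt; have nz := p2_fibre_neq0 rt.
by move: rt; rewrite rootE !hornerE subr_eq0 => /eqP ->; rewrite mulfK.
Qed.

(** At a double root [t] the value and the derivative of [p0] are [l] times those of [p2], so [t] is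
    one of the finitely many roots of the Wronskian, and [l] is the value of [p0 / p2] there. *)
Lemma separable_fibre : exists s : seq K, forall l, l \notin s ->
  exists rs, [/\ uniq rs, size rs = n & p0 - l *: p2 = \prod_(z <- rs) ('X - z%:P)].
Proof.
have W0 := wronskian_neq0 charK n_gt0 mon_p0 sz_p0 p2_neq0 sz_p2.
have [rW def_W] := closed_field_poly_normal (p0^`() * p2 - p0 * p2^`()).
exists [seq p0.[t] / p2.[t] | t <- rW] => l l_rW.
apply: separable_roots (monic_fibre l) (size_fibre l) _ => t rt.
apply: contra l_rW; rewrite derivB derivZ !hornerE subr_eq0 => /eqP dp0.
apply/mapP; exists t; last by rewrite (fibre_value rt).
rewrite -root_prod_XsubC -(@rootZ _ _ (lead_coef (p0^`() * p2 - p0 * p2^`())))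
  ?lead_coef_eq0 //.
rewrite -def_W rootE !hornerE dp0.
by move: rt; rewrite rootE !hornerE subr_eq0 => /eqP ->; rewrite mulrAC subrr.
Qed.

Lemma generic_fibre E : injective_outside E ->
  exists s : seq K, forall l, l \notin s -> exists rs : seq K,
    [/\ size rs = n, all (root (p0 - l *: p2)) rs
      & uniq [seq p1.[t] / p2.[t] | t <- rs]].
Proof.
move=> inj; have [s sP] := separable_fibre.
exists (s ++ E) => l; rewrite mem_cat negb_or => /andP [ls lE].
have [rs [urs szrs def_p]] := sP l ls; exists rs.
have rootrs : all (root (p0 - l *: p2)) rs.
  by apply/allP=> t; rewrite def_p root_prod_XsubC.
split=> //; rewrite map_inj_in_uniq // => t t' /(allP rootrs) rt /(allP rootrs) rt'.
move=> /eqP; rewrite eqr_div ?(p2_fibre_neq0 rt) ?(p2_fibre_neq0 rt') // => /eqP.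
exact: inj lE t t' rt rt'.
Qed.

(** The generic fibre [p0 - x p2]. Here the outer variable is [t], not [y]; the inner one is still
    [x]. *)
Let A : {poly {poly K}} := map_poly polyC p0 - 'X *: map_poly polyC p2.

Let A_monic : A \is monic.
Proof.
rewrite monicE lead_coefDl ?lead_coef_map ?(monicP mon_p0) //.
rewrite size_polyN size_map_polyC sz_p0 ltnS.
by rewrite (leq_trans (size_scale_leq _ _)) ?size_map_polyC.
Qed.

Let size_A : size A = n.+1.
Proof.
rewrite size_polyDl size_map_polyC sz_p0 // size_polyN ltnS.
by rewrite (leq_trans (size_scale_leq _ _)) ?size_map_polyC.
Qed.

Let map_A l : map_poly (horner_eval l) A = p0 - l *: p2.
Proof.
rewrite rmorphB /= map_polyZ /= -!map_poly_comp /= {2}/horner_eval hornerX.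
by rewrite !map_poly_id //= => x _; rewrite /horner_eval hornerC.
Qed.

Lemma bezout_monic : exists uv : {poly K} * {poly K}, uv.1 * p0 + uv.2 * p2 = 1.
Proof. by have /Bezout_eq1_coprimepP [uv h] := cop; exists uv. Qed.

(** For [B] monic of degree [n], multiplication by [phi] modulo [B] in the basis of the powers of
    ['X], row [i] being the image of ['X^i]. *)
Definition mulmod_mx (R : comNzRingType) (B phi : {poly R}) : 'M[R]_n :=
  \matrix_(i, j) (Pdiv.CommonRing.rmodp (phi * 'X^i) B)`_j.

(* The polynomial in the last clause is [F(al t, be t)]. *)
Lemma curve_equation : exists F : {poly {poly K}},
  [/\ F \is monic, size F = n.+1, vanishes_on_graph F
    & forall (h : {poly K}) m (al be : K), h %| p0 -> h %| p1 -> size h = m.+1 ->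
      'X^m %| (map_poly (comp_poly (al *: 'X)) F).[be *: 'X]].
Proof.
have [[u0 v0] /= uv] := bezout_monic.
(* Modulo [A] one has [p0 = x p2], so Bezout's relation makes [x u0 + v0] an inverse of [p2], and
   [phi] represents [p1 / p2]. *)
pose phi := map_poly polyC p1 * ('X *: map_poly polyC u0 + map_poly polyC v0).
pose N := mulmod_mx A phi.
pose r i := Pdiv.CommonRing.rmodp (phi * 'X^i) A.
have sz_r i : (size (r i) <= n)%N.
  by rewrite -ltnS -size_A Pdiv.CommonRing.ltn_rmodp monic_neq0.
have rE i : phi * 'X^i = Pdiv.CommonRing.rdivp (phi * 'X^i) A * A + r i.
  exact: Pdiv.RingMonic.rdivp_eq.
have map_phi l : map_poly (horner_eval l) phi = p1 * (l *: u0 + v0).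
  rewrite rmorphM rmorphD /= map_polyZ /= -!map_poly_comp /= {2}/horner_eval hornerX.
  by rewrite !map_poly_id //= => x _; rewrite /horner_eval hornerC.
clearbody phi; exists (char_poly N); split; rewrite ?char_poly_monic ?size_char_poly //.
- move=> t p2t; set l := p0.[t] / p2.[t]; set y := p1.[t] / p2.[t].
  rewrite -[LHS]/(horner_eval l _) -horner_map /= [horner_eval l y%:P]hornerC map_char_poly.
  apply/eqP; rewrite -/(root _ _).
  suff : root (char_poly (map_mx (horner_eval l) N)^T) y.
    by rewrite char_poly_trmx.
  rewrite -eigenvalue_root_char; apply/eigenvalueP.
  have At : (map_poly (horner_eval l) A).[t] = 0.
    by rewrite map_A !hornerE /l divfK // subrr.
  (* Evaluation at the root [t] of the fibre turns multiplication by [phi] into multiplication by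
     [y]: the powers of [t] form an eigenvector of the transpose, nonzero since its first entry is
     1. *)
  exists (\row_j t ^+ j); last first.
    apply/eqP=> /rowP/(_ (Ordinal n_gt0)); rewrite !mxE expr0 => /eqP.
    by rewrite oner_eq0.
  apply/rowP=> i; rewrite !mxE.
  transitivity ((map_poly (horner_eval l) (r i)).[t]).
    rewrite (@horner_coef_wide _ n); last first.
      by rewrite (leq_trans (size_poly _ _)).
    by apply: eq_bigr => j _; rewrite !mxE coef_map mulrC.
  have /(congr1 (fun q => (map_poly (horner_eval l) q).[t])) := rE i.
  rewrite rmorphD !rmorphM /= hornerD !hornerM At mulr0 add0r => <-.
  rewrite map_polyXn hornerXn map_phi !hornerE; congr (_ * _).
  rewrite /y; congr (_ * _); apply: (mulIf p2t); rewrite mulVf //.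
  have /(congr1 (horner^~ t)) := uv; rewrite !hornerE => <-.
  by rewrite mulrDl -mulrA [u0.[t] * _]mulrC mulrA /l divfK // [p0.[t] * _]mulrC.
- move=> h m al be /dvdpP [k0 def_p0] h_p1 sz_h.
  rewrite map_char_poly char_poly_horner; apply: dvdXn_det.
  have h0 : h != 0 by rewrite -size_poly_eq0 sz_h.
  have le_mn : (m <= n)%N.
    by rewrite -ltnS -sz_h -sz_p0 dvdp_leq ?monic_neq0 // def_p0 dvdp_mull.
  rewrite addnC -(leq_subRL _ le_mn).
  (* At [x = 0] both [A] and [phi] are multiples of [h], hence so are all remainders; the rows of
     the matrix then lie in the span of the [h * 'X^i] with [i < n - m]. *)
  pose H : 'M[K]_(n - m, n) := \matrix_(i, j) (h * 'X^i)`_j.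
  apply: leq_trans (rank_leq_row H); apply: mxrankS; apply/row_subP=> i.
  pose r0 := map_poly (horner_eval 0) (r i).
  have /dvdpP [q def_r0] : h %| r0.
    have /(congr1 (map_poly (horner_eval 0))) := rE i.
    rewrite rmorphD !rmorphM /= map_phi map_A !scale0r subr0 add0r -/r0.
    move/esym/(canRL (addKr _)) ->.
    apply: dvdp_add; last by rewrite -!mulrA dvdp_mulr.
    by rewrite dvdpNr def_p0 dvdp_mull // dvdp_mull.
  have sz_q : (size q <= n - m)%N.
    have [->|q0] := eqVneq q 0; first by rewrite size_poly0.
    have : (size r0 <= n)%N by rewrite (leq_trans (size_poly _ _)).
    by rewrite def_r0 size_mul // sz_h addnS /= leq_subRL // addnC.
  suff -> : row i (map_mx (horner_eval 0) ((be *: 'X)%:M - map_mx (comp_poly (al *: 'X)) N))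
          = (- \row_j q`_j) *m H by rewrite submxMl.
  apply/rowP=> j; rewrite !mxE /= /horner_eval hornerD hornerN hornerMn hornerZ hornerX.
  rewrite mulr0 mul0rn sub0r horner_comp hornerZ hornerX mulr0.
  have -> : ((r i)`_j).[0] = r0`_j by rewrite coef_map.
  rewrite def_r0 -{1}(take_poly_id sz_q) /take_poly poly_def mulr_suml coef_sum -sumrN.
  by apply: eq_bigr => k _; rewrite !mxE -scalerAl coefZ mulNr [h * _]mulrC.
Qed.

Lemma graph_fibre_eq0 G l t : vanishes_on_graph G -> root (p0 - l *: p2) t ->
  root (map_poly (horner_eval l) G) (p1.[t] / p2.[t]).
Proof.
move=> vG rt; have := vG t (p2_fibre_neq0 rt); rewrite (fibre_value rt) => e.
by rewrite rootE -[p1.[t] / _](hornerC _ l) -[_.[l]]/(horner_eval l _) horner_map [X in X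
  == _]e.
Qed.

(** The remainder of [G] by [F] has degree less than [n] in [y], but on a general line [x = l] it
    vanishes at [n] distinct values of [p1 / p2]. *)
Lemma curve_equation_dvd E F G : injective_outside E ->
    F \is monic -> size F = n.+1 -> vanishes_on_graph F -> vanishes_on_graph G ->
  exists H, G = H * F.
Proof.
move=> inj mon_F sz_F vF vG.
exists (Pdiv.CommonRing.rdivp G F).
rewrite {1}(Pdiv.RingMonic.rdivp_eq mon_F G) -[RHS]addr0; congr (_ + _).
have [s sP] := generic_fibre inj; apply: (poly2_eq0_cofinite (s := s)) => l ls.
have [rs [sz_rs rts uy]] := sP l ls.
apply: roots_geq_poly_eq0 uy _.
  apply/allP=> y /mapP [t /(allP rts) rt ->].
  have := graph_fibre_eq0 vG rt; rewrite {1}(Pdiv.RingMonic.rdivp_eq mon_F G).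
  rewrite rmorphD rmorphM /= !rootE hornerD hornerM.
  by rewrite (rootP (graph_fibre_eq0 vF rt)) mulr0 add0r.
rewrite size_map sz_rs (leq_trans (size_poly _ _)) // -ltnS -sz_F.
by rewrite Pdiv.CommonRing.ltn_rmodp monic_neq0.
Qed.

Lemma dvdXn_restriction E (G : {poly {poly K}}) (h : {poly K}) m (al be : K) :
    injective_outside E -> vanishes_on_graph G ->
    h %| p0 -> h %| p1 -> size h = m.+1 ->
  'X^m %| (map_poly (comp_poly (al *: 'X)) G).[be *: 'X].
Proof.
move=> inj vG hp0 hp1 sz_h; have [F [mon_F sz_F vF ord_F]] := curve_equation.
have [H ->] := curve_equation_dvd inj mon_F sz_F vF vG.
by rewrite rmorphM hornerM dvdp_mull //; apply: ord_F hp0 hp1 sz_h.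
Qed.

(** For the equation [F] of [curve_equation], [F(0, y)] is monic of degree [n] and has [size ts]
    distinct nonzero roots, which leaves at most [m] for the order at [y = 0]. *)
Lemma exists_restriction_ndvdXn m (ts : seq K) :
    all (root p0) ts -> uniq [seq p1.[t] / p2.[t] | t <- ts] ->
    all (fun t => p1.[t] != 0) ts -> (n <= size ts + m)%N ->
  exists2 F : {poly {poly K}}, vanishes_on_graph F
    & ~~ ('X^(m.+1) %| map_poly (horner_eval 0) F).
Proof.
move=> rts uy nz le_n; have [F [mon_F sz_F vF _]] := curve_equation.
exists F => //; set f := map_poly _ F.
have mon_f : f \is monic by apply: monic_map.
have sz_f : size f = n.+1 by rewrite size_map_poly_id0 ?(monicP mon_F) ?rmorph1 ?oner_eq0.
set ys := [seq p1.[t] / p2.[t] | t <- ts] in uy.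
have rt0 t : t \in ts -> root (p0 - 0 *: p2) t.
  by rewrite scale0r subr0 => /(allP rts).
have dvd_ys : \prod_(y <- ys) ('X - y%:P) %| f.
  apply: uniq_roots_dvdp; last by rewrite uniq_rootsE.
  by apply/allP=> y /mapP [t tts ->]; exact: (graph_fibre_eq0 vF (rt0 t tts)).
apply/negP=> dvdX.
have : \prod_(y <- ys) ('X - y%:P) * 'X^(m.+1) %| f.
  rewrite Gauss_dvdp ?dvd_ys // coprimep_expr // coprimepX root_prod_XsubC.
  apply/mapP=> [[t tts /esym/eqP]]; rewrite mulf_eq0 invr_eq0.
  by rewrite (negPf (allP nz t tts)) (negPf (p2_fibre_neq0 (rt0 t tts))).
move/dvdp_leq; rewrite monic_neq0 // => /(_ isT).
rewrite size_mul ?monic_neq0 ?monicXn ?monic_prod_XsubC // size_polyXn.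
rewrite size_prod_XsubC size_map sz_f addnS /= addSn ltnS leqNgt => /negP; apply.
by rewrite addnS ltnS.
Qed.

End Pencil.

(** * Taylor expansion of multivariate polynomials *)

Section Mpoly.
Variables (k : nat) (R : comNzRingType).

Lemma mpoly_alg_ind (P : {mpoly R[k]} -> Prop) :
  (forall c, P c%:MP) -> (forall i, P 'X_i) ->
  (forall p q, P p -> P q -> P (p + q)) ->
  (forall p q, P p -> P q -> P (p * q)) -> forall p, P p.
Proof.
move=> PC PX PD PM; apply: mpolyind => [|c m p _ _ Pp]; first by rewrite -[0]mpolyC0.
apply: PD => //; rewrite -mul_mpolyC; apply: (PM) => //.
rewrite mpolyXE_id; elim/big_ind: _ => // [|i _]; first by rewrite -mpolyC1.
by elim: (m i) => [|j IH]; rewrite ?expr0 ?exprS; [rewrite -mpolyC1|apply: PM].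
Qed.

(** Evaluations, shifts and restrictions to lines are all instances of [mmap]; comparing two of them
    reduces to constants and variables. *)
Lemma rmorph_mmap (S T : comNzRingType) (f : {rmorphism R -> S}) (phi : {rmorphism S -> T})
    (f' : {rmorphism R -> T}) (h : 'I_k -> S) (h' : 'I_k -> T) p :
  (forall c, phi (f c) = f' c) -> (forall i, phi (h i) = h' i) ->
  phi (mmap f h p) = mmap f' h' p.
Proof.
move=> ff hh; elim/mpoly_alg_ind: p => [c|i|p q IHp IHq|p q IHp IHq].
- by rewrite !mmapC ff.
- by rewrite !mmapX !mmap1U hh.
- by rewrite !rmorphD /= IHp IHq.
- by rewrite !rmorphM /= IHp IHq.
Qed.

(** Hadamard's lemma; the values of the [u i] at [c] are the first-order coefficients of [p], as
    [restrict_coef1] shows. *)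
Lemma mpoly_subr_meval (c : 'I_k -> R) p :
  exists u : 'I_k -> {mpoly R[k]}, p = (p.@[c])%:MP + \sum_i u i * ('X_i - (c i)%:MP).
Proof.
elim/mpoly_alg_ind: p => [a|i|p q [u up] [v vq]|p q [u up] [v vq]].
- by exists (fun=> 0); rewrite mevalC big1 ?addr0 // => i _; rewrite mul0r.
- exists (fun j => (j == i)%:R); rewrite mevalXU (bigD1 i) //= eqxx mul1r big1.
    by rewrite addr0 addrC subrK.
  by move=> j /negPf ->; rewrite mul0r.
- exists (fun i => u i + v i); rewrite mevalD mpolyCD {1}up {1}vq.
  under [in RHS]eq_bigr do rewrite mulrDl.
  by rewrite big_split /= addrACA.
- exists (fun i => u i * q + (p.@[c])%:MP * v i); rewrite mevalM mpolyCM {1}up mulrDl.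
  under [in RHS]eq_bigr do rewrite mulrDl mulrAC -[X in _ + X]mulrA.
  rewrite big_split /= -mulr_sumr -mulr_suml {1}vq mulrDr -!addrA; congr (_ + _).
  by rewrite addrC.
Qed.

Definition shift (c : 'I_k -> R) (p : {mpoly R[k]}) : {mpoly R[k]} :=
  mmap (@mpolyC k R) (fun i => (c i)%:MP + 'X_i) p.

Lemma shift_mderiv c p i : (shift c p)^`M(i) = shift c p^`M(i).
Proof.
rewrite /shift; elim/mpoly_alg_ind: p => [a|j|p q IHp IHq|p q IHp IHq].
- by rewrite !mmapC !mderivC mmap0.
- rewrite mmapX mmap1U mderivD mderivC add0r !mderivX mnm1E.
  case: eqP => [->|_]; last by rewrite !scale0r mmap0.
  rewrite !scale1r; have -> : (U_(i) - U_(i) = 0)%MM.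
    by apply/mnmP=> l; rewrite mnmBE subnn mnm0E.
  by rewrite mpolyX0 rmorph1.
- by rewrite !(rmorphD, mderivD) /= IHp IHq.
- by rewrite !(rmorphM, mderivM, rmorphD) /= IHp IHq.
Qed.

Lemma shift_mderivm c p m : (shift c p)^`M[m] = shift c p^`M[m].
Proof.
rewrite !mderivm_foldr; elim: (flatten _) => //= i s ->.
exact: shift_mderiv.
Qed.

(** Taylor's formula: [shift] commutes with derivatives, so the derivative may be taken at the
    origin, where it reads off one coefficient up to factorials. *)
Lemma mcoeff_shift c p m :
  p^`M[m].@[c] = (shift c p)@_m *+ (\prod_(i < k) (m i)`!).
Proof.
have -> : p^`M[m].@[c] = (shift c p^`M[m])@_0.
  rewrite /meval; symmetry; apply: rmorph_mmap => [a|i] /=;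
    first by rewrite mcoeffC eqxx mulr1.
  by rewrite mcoeffD mcoeffC mcoeffX eqxx mulr1 mnm1_eq0 addr0.
rewrite -shift_mderivm mcoeff_mderivm addm0. congr (_ *+ _).
by apply: eq_bigr => i _; rewrite ffactnn.
Qed.

Definition restrict (c v : 'I_k -> R) (p : {mpoly R[k]}) : {poly R} :=
  mmap (@polyC R) (fun i => (c i)%:P + v i *: 'X) p.

Lemma restrict_coef c v p j :
  (restrict c v p)`_j
  = (\sum_(m <- msupp (shift c p) | mdeg m == j) (shift c p)@_m *: 'X_[m]).@[v].
Proof.
have -> : restrict c v p = mmap (@polyC R) (fun i => v i *: 'X) (shift c p).
  symmetry; rewrite /shift; apply: rmorph_mmap => [a|i] /=; first by rewrite mmapC.
  by rewrite rmorphD /= mmapC mmapX mmap1U.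
rewrite [RHS]raddf_sum [RHS]big_mkcond /= /mmap coef_sum /=; apply: eq_bigr => m _.
rewrite mevalZ mevalX /mmap1 /=.
under eq_bigr do rewrite exprZn.
rewrite scaler_prod -[\prod_i 'X^_]expr_sum -mdegE coefCM coefZ coefXn eq_sym.
by case: eqP => _; rewrite ?mulr1 // !mulr0.
Qed.

End Mpoly.

Lemma dvdXnP (K : fieldType) m (q : {poly K}) :
  reflect (forall j, (j < m)%N -> q`_j = 0) ('X^m %| q).
Proof.
apply: (iffP idP) => [/dvdpP [r ->] j lt_jm|h]; first by rewrite coefMXn lt_jm.
rewrite -(poly_take_drop m q) (_ : take_poly m q = 0) ?add0r ?dvdp_mull //.
by apply/polyP=> j; rewrite coef_take_poly coef0; case: ifP => // /h.
Qed.

Lemma base_digit_inj B x y x' y' : (x < B)%N -> (x' < B)%N ->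
  (x + B * y = x' + B * y')%N -> x = x' /\ y = y'.
Proof.
move=> lt_x lt_x' E.
have E0 : x = x'.
  by have := congr1 (modn^~ B) E;
    rewrite /= ![(_ + B * _)%N]addnC ![(B * _)%N]mulnC !modnMDl !modn_small.
split=> //; move: E; rewrite E0 => /addnI/eqP.
by rewrite eqn_pmul2l ?(leq_ltn_trans _ lt_x) // => /eqP.
Qed.

(** * Order of vanishing at a point, tested along lines *)

Section Order.
Variable K : closedFieldType.

(* Kronecker substitution. *)
Lemma mpoly3_eq0 (q : {mpoly K[3]}) : (forall v, q.@[v] = 0) -> q = 0.
Proof.
move=> q0; pose B := msize q.
(* The exponents are the digits of [e m] in base [B], and [B] exceeds every exponent occurring in
   [q], so [e] is injective on the support. *)
pose e (m : 'X_{1..3}) := (\sum_(i < 3) B ^ i * m i)%N.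
pose Q := mmap (@polyC K) (fun i : 'I_3 => 'X^(B ^ i)) q.
have Q0 : Q = 0.
  apply: (@poly_eq0_cofinite _ _ [::]) => x _.
  rewrite -[LHS]/(horner_eval x Q) -(q0 (fun i => x ^+ (B ^ i))).
  by apply: rmorph_mmap => [a|i] /=; rewrite /horner_eval ?hornerC ?hornerXn.
have lt_B m i : m \in msupp q -> (m i < B)%N.
  move=> /msize_mdeg_lt; apply: leq_ltn_trans.
  by rewrite mdegE (bigD1 i) //= leq_addr.
have e_inj m m' : m \in msupp q -> m' \in msupp q -> e m = e m' -> m = m'.
  move=> hm hm'; rewrite /e !big_ord_recl !big_ord0 /= !addn0 !expn0 !mul1n !expn1.
  set i1 : 'I_3 := lift ord0 ord0; set i2 : 'I_3 := lift ord0 (lift ord0 ord0).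
  rewrite (_ : (B ^ i2 = B * B)%N) // -!mulnA -!mulnDr.
  case/base_digit_inj; rewrite ?lt_B // => E0.
  case/base_digit_inj; rewrite ?lt_B // => E1 E2.
  apply/mnmP=> [[[|[|[|i]]] hi]] //.
  - by rewrite (_ : Ordinal hi = ord0) //; apply: val_inj.
  - by rewrite (_ : Ordinal hi = i1) //; apply: val_inj.
  - by rewrite (_ : Ordinal hi = i2) //; apply: val_inj.
apply/mpolyP=> m; rewrite mcoeff0; have [hm|] := boolP (m \in msupp q); last first.
  by rewrite -mcoeff_eq0 => /eqP.
have := congr1 (fun p : {poly K} => p`_(e m)) Q0.
rewrite coef0 /Q /mmap coef_sum (bigD1_seq m) ?msupp_uniq //= big1_seq ?addr0.
  rewrite coefCM /mmap1 (eq_bigr (fun i : 'I_3 => 'X^(B ^ i * m i))) => [|i _];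
    last by rewrite exprM.
  by rewrite -expr_sum coefXn eqxx mulr1.
move=> m' /andP [ne_m' hm'].
rewrite coefCM /mmap1 (eq_bigr (fun i : 'I_3 => 'X^(B ^ i * m' i))) => [|i _];
  last by rewrite exprM.
rewrite -expr_sum coefXn; case: eqP => [/e_inj ee|_]; last by rewrite mulr0.
by rewrite ee ?eqxx in ne_m'.
Qed.

Hypothesis charK : [pchar K] =i pred0.

Lemma mderivm_eq0 (p : {mpoly K[3]}) c m :
  (p^`M[m].@[c] == 0) = ((shift c p)@_m == 0).
Proof.
rewrite mcoeff_shift -mulr_natr mulf_eq0 (pcharf0P _).1 // orbC.
rewrite eqn0Ngt prodn_gt0 // => i; exact: fact_gt0.
Qed.

(** The coefficients of [restrict c v p] are the homogeneous Taylor parts of [p] at [c], evaluated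
    at [v]. A part that vanishes for all [v] is zero, by [mpoly3_eq0]. *)
Lemma order_geP (p : {mpoly K[3]}) c m :
  (forall v, 'X^m %| restrict c v p) <->
  (forall d : 'X_{1..3}, (mdeg d < m)%N -> p^`M[d].@[c] = 0).
Proof.
split=> h => [d lt_d|v].
  apply/eqP; rewrite mderivm_eq0.
  have [hd|] := boolP (d \in msupp (shift c p)); last by rewrite mcoeff_eq0.
  pose q := \sum_(m <- msupp (shift c p) | mdeg m == mdeg d) (shift c p)@_m *: 'X_[m].
  have q0 : q = 0.
    apply: mpoly3_eq0 => v; rewrite -restrict_coef.
    exact: (dvdXnP _ _ (h v)).
  have := congr1 (mcoeff d) q0.
  rewrite mcoeff0 /q raddf_sum big_mkcond /= (bigD1_seq d) ?msupp_uniq //= eqxx.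
  rewrite mcoeffZ mcoeffX eqxx mulr1 big1 ?addr0 => [->//|m' ne].
  by case: ifP => // _; rewrite mcoeffZ mcoeffX (negPf ne) mulr0.
apply/dvdXnP=> j lt_j; rewrite restrict_coef raddf_sum /= big1 // => d /eqP dj.
have := h d; rewrite dj => /(_ lt_j) /eqP; rewrite mevalZ mderivm_eq0 => /eqP ->.
by rewrite mul0r.
Qed.

End Order.

(** * Points and the parameterization *)

Section Points.
Variable K : fieldType.

Lemma coords_neq0 m (P : point K m) : coords P != 0.
Proof.
case: P => L dL; rewrite /coords vpick0 /=; apply/eqP=> L0.
by rewrite L0 dimv0 in dL.
Qed.

Lemma line_mem m (P : point K m) v : v \in line P -> v != 0 -> line P = <[v]>%VS.
Proof.
case: P => L /= dL vL v0; apply/esym/eqP.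
by rewrite eqEdim -memvE vL (eqP dL) dim_vline v0.
Qed.

Lemma line_coords m (P : point K m) : line P = <[coords P]>%VS.
Proof. by apply: line_mem (coords_neq0 P); rewrite /coords memv_pick. Qed.

Lemma mem_lineE m (P : point K m) v : (v \in line P) = (v \in <[coords P]>%VS).
Proof. by rewrite line_coords. Qed.

Lemma vpoint_subproof m (v : 'rV[K]_m.+1) : v != 0 -> \dim <[v]> == 1%N.
Proof. by rewrite dim_vline => ->. Qed.

Definition vpoint m (v : 'rV[K]_m.+1) (v0 : v != 0) : point K m :=
  Point (vpoint_subproof v0).

Lemma point_inj m (P Q : point K m) : line P = line Q -> P = Q.
Proof. exact: val_inj. Qed.

Lemma vline_eq m (v w : 'rV[K]_m) : v \in <[w]>%VS -> v != 0 -> <[v]>%VS = <[w]>%VS.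
Proof.
by move=> vw v0; apply/eqP; rewrite eqEdim -memvE vw !dim_vline v0 leq_b1.
Qed.

Lemma memvZ_eq m c (v : 'rV[K]_m) (U : {vspace 'rV[K]_m}) : c != 0 ->
  (c *: v \in U) = (v \in U).
Proof. by move=> c0; rewrite rpredZeq (negPf c0). Qed.

Definition det2 (v w : 'rV[K]_2) := v 0 0 * w 0 1 - v 0 1 * w 0 0.

Lemma ord2P (i : 'I_2) : i = 0 \/ i = 1.
Proof. by case: i => [[|[|i]] hi] //; [left|right]; apply: val_inj. Qed.

Lemma rowP2 (v w : 'rV[K]_2) : v 0 0 = w 0 0 -> v 0 1 = w 0 1 -> v = w.
Proof. by move=> h0 h1; apply/rowP=> i; case: (ord2P i) => ->. Qed.

Lemma row2_neq0 (v : 'rV[K]_2) : v != 0 -> v 0 0 != 0 \/ v 0 1 != 0.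
Proof.
move=> nz; have [v0|] := eqVneq (v 0 0) 0; last by left.
have [v1|] := eqVneq (v 0 1) 0; last by right.
by case/eqP: nz; apply: rowP2; rewrite mxE.
Qed.

Lemma det2_eq0P (v w : 'rV[K]_2) : w != 0 -> reflect (v \in <[w]>%VS) (det2 v w == 0).
Proof.
move=> nz; apply: (iffP eqP) => [d0|/vlineP [k ->]]; last by rewrite /det2 !mxE; ring.
have {d0} d0 : v 0 0 * w 0 1 = v 0 1 * w 0 0 by apply/eqP;
  rewrite -subr_eq0 -[_ - _]/(det2 v w) d0.
apply/vlineP; case: (row2_neq0 nz) => h.
  by exists (v 0 0 / w 0 0); apply: rowP2; rewrite mxE ?divfK // mulrAC d0 mulfK.
by exists (v 0 1 / w 0 1); apply: rowP2; rewrite mxE ?divfK // mulrAC -d0 mulfK.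
Qed.

Lemma det2_basis (w0 w1 w : 'rV[K]_2) : det2 w0 w1 != 0 ->
  w = (det2 w w1 / det2 w0 w1) *: w0 + (det2 w0 w / det2 w0 w1) *: w1.
Proof.
rewrite /det2 => nz; apply: rowP2; rewrite !mxE; field; exact: nz.
Qed.

Lemma det2_complete (w : 'rV[K]_2) : w != 0 -> exists w0, det2 w0 w != 0.
Proof.
move/row2_neq0=> [h|h].
  exists (\row_i (i == 1)%:R); by rewrite /det2 !mxE /= mul0r mul1r sub0r oppr_eq0.
exists (\row_i (i == 0)%:R); by rewrite /det2 !mxE /= mul0r mul1r subr0.
Qed.

Lemma det2_neq0l (v w : 'rV[K]_2) : det2 v w != 0 -> v != 0.
Proof. by apply: contraNneq => ->; rewrite /det2 !mxE !mul0r subr0. Qed.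

Lemma det2C (v w : 'rV[K]_2) : det2 v w = - det2 w v.
Proof. by rewrite /det2; ring. Qed.

Lemma det2_neq0r (v w : 'rV[K]_2) : det2 v w != 0 -> w != 0.
Proof. by rewrite det2C oppr_eq0; apply: det2_neq0l. Qed.

Lemma det2_affine (w0 w1 : 'rV[K]_2) t : det2 (w0 + t *: w1) w1 = det2 w0 w1.
Proof. by rewrite /det2 !mxE; ring. Qed.

Lemma affine_chart (w0 w1 w : 'rV[K]_2) : det2 w0 w1 != 0 -> det2 w w1 != 0 ->
  exists t c, c != 0 /\ w = c *: (w0 + t *: w1).
Proof.
move=> n0 nw; exists (det2 w0 w / det2 w w1), (det2 w w1 / det2 w0 w1); split.
  by rewrite mulf_neq0 // invr_eq0.
rewrite {1}(det2_basis w n0) scalerDr scalerA; congr (_ + _ *: _).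
by field; rewrite n0 nw.
Qed.

End Points.

Section Forms.
Variables (K : closedFieldType) (n : nat) (a : 'M[K]_(3, n.+1)).
Implicit Types w d : 'rV[K]_2.

Definition veronese_diff w d : 'rV[K]_n.+1 :=
  d 0 0 *: veronese_ds n w + d 0 1 *: veronese_dt n w.

Definition forms_diff w d : 'rV[K]_3 := veronese_diff w d *m a^T.

Lemma veronese_diffE w d j : veronese_diff w d 0 j =
  d 0 0 * ((n - j)%:R * w 0 0 ^+ (n - j).-1 * w 0 1 ^+ j)
  + d 0 1 * (j%:R * w 0 0 ^+ (n - j) * w 0 1 ^+ j.-1).
Proof. by rewrite !mxE. Qed.

Lemma forms_vecE w : forms_vec a w = veronese_vec n w *m a^T.
Proof. by apply/rowP=> u; rewrite !mxE; apply: eq_bigr => j _; rewrite !mxE; ring. Qed.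

Lemma veronese_vecZ c w : veronese_vec n (c *: w) = c ^+ n *: veronese_vec n w.
Proof.
apply/rowP=> j; rewrite !mxE !exprMn mulrACA -exprD subnK //.
by rewrite -ltnS ltn_ord.
Qed.

Lemma forms_vecZ c w : forms_vec a (c *: w) = c ^+ n *: forms_vec a w.
Proof. by rewrite !forms_vecE veronese_vecZ scalemxAl. Qed.

(** Euler's identity for the monomials of degree [n]. *)
Lemma veronese_diff_self w : veronese_diff w w = n%:R *: veronese_vec n w.
Proof.
apply/rowP=> j; rewrite !mxE.
have le_jn : (j <= n)%N by rewrite -ltnS ltn_ord.
have -> : n%:R = (n - j)%:R + j%:R :> K by rewrite -natrD subnK.
rewrite mulrDl; congr (_ + _).
  case: (n - j)%N => [|i]; first by rewrite !mul0r mulr0.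
  by rewrite /= exprS; ring.
case: (j : nat) => [|i]; first by rewrite !mul0r mulr0.
by rewrite /= exprS; ring.
Qed.

Lemma forms_diff_self w : forms_diff w w = n%:R *: forms_vec a w.
Proof. by rewrite /forms_diff veronese_diff_self forms_vecE scalemxAl. Qed.

Lemma forms_diffDr w d e : forms_diff w (d + e) = forms_diff w d + forms_diff w e.
Proof. by rewrite /forms_diff -mulmxDl; congr (_ *m _); apply/rowP=> j; rewrite !mxE;
  ring. Qed.

Lemma forms_diffZr w c d : forms_diff w (c *: d) = c *: forms_diff w d.
Proof. by rewrite /forms_diff scalemxAl; congr (_ *m _); apply/rowP=> j; rewrite !mxE;
  ring. Qed.

Lemma forms_diffZl c w d : forms_diff (c *: w) d = c ^+ n.-1 *: forms_diff w d.
Proof.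
rewrite /forms_diff scalemxAl; congr (_ *m _); apply/rowP=> j.
rewrite [RHS]mxE !veronese_diffE !mxE mulrDr.
have le_jn : (j <= n)%N by rewrite -ltnS ltn_ord.
congr (_ + _).
  case e: (n - j)%N => [|i]; first by rewrite !mul0r !mulr0.
  have -> : n.-1 = (i + j)%N by rewrite -[(i + j)%N]/((i.+1 + j).-1)%N -e subnK.
  by rewrite /= !exprMn exprD; ring.
case e: (j : nat) => [|i]; first by rewrite !mul0r !mulr0.
rewrite e in le_jn; have -> : n.-1 = ((n - i.+1) + i)%N by rewrite -[in LHS](subnK le_jn)
  addnS.
by rewrite /= !exprMn exprD; ring.
Qed.

Section Line.
Variables w0 w1 : 'rV[K]_2.

(** The affine parameter [t] stands for the point [w0 + t w1] of the projective line, with [w1] as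
    the point at infinity. *)
Definition line_poly (i : 'I_2) : {poly K} := (w0 0 i)%:P + w1 0 i *: 'X.

Definition veronese_poly (j : nat) : {poly K} :=
  line_poly 0 ^+ (n - j) * line_poly 1 ^+ j.

Lemma horner_line_poly i t : (line_poly i).[t] = (w0 + t *: w1) 0 i.
Proof. by rewrite !hornerE !mxE mulrC. Qed.

Lemma horner_veronese_poly (j : 'I_n.+1) t :
  (veronese_poly j).[t] = veronese_vec n (w0 + t *: w1) 0 j.
Proof. by rewrite hornerM !horner_exp !horner_line_poly [RHS]mxE. Qed.

Lemma horner_deriv_veronese_poly (j : 'I_n.+1) t :
  (veronese_poly j)^`().[t] = veronese_diff (w0 + t *: w1) w1 0 j.
Proof.
have dl i : (line_poly i)^`() = (w1 0 i)%:P.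
  by rewrite derivD derivC add0r derivZ derivX alg_polyC.
rewrite /veronese_poly derivM !deriv_exp !dl hornerD !hornerM !hornerMn.
rewrite !hornerM !horner_exp !hornerC !horner_line_poly mulrnAl mulrnAr.
rewrite -[X in X + _]mulr_natr -[X in _ + X = _]mulr_natr.
rewrite veronese_diffE; move: (_ 0 0) (_ 0 1) => x y; ring.
Qed.

Lemma line_poly_top i k :
  (size (line_poly i ^+ k) <= k.+1)%N /\ (line_poly i ^+ k)`_k = w1 0 i ^+ k.
Proof.
have sz1 : (size (line_poly i) <= 2)%N.
  rewrite (leq_trans (size_polyD _ _)) // geq_max (leq_trans (size_polyC_leq1 _)) //.
  by rewrite (leq_trans (size_scale_leq _ _)) // size_polyX.
elim: k => [|k [IHs IHc]]; first by rewrite !expr0 size_poly1 coef1.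
split; last first.
  rewrite !exprS -[X in _`_X]add1n coefM_top // IHc; congr (_ * _).
  by rewrite coefD coefC coefZ coefX add0r mulr1.
rewrite exprS (leq_trans (size_polyMleq _ _)) //.
by rewrite -[k.+2]/(2 + k.+1).-1 -subn1 -[in leqRHS]subn1 leq_sub2r // leq_add.
Qed.

Lemma size_veronese_poly (j : 'I_n.+1) : (size (veronese_poly j) <= n.+1)%N.
Proof.
have [s0 _] := line_poly_top 0 (n - j); have [s1 _] := line_poly_top 1 j.
rewrite (leq_trans (size_polyMleq _ _)) // -ltnS.
have le_jn : (j <= n)%N by rewrite -ltnS ltn_ord.
apply: (@leq_trans (((n - j).+1 + j.+1).-1).+1); last by rewrite addSn addnS /= subnK.
by rewrite ltnS -!subn1 leq_sub2r // leq_add.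
Qed.

Lemma veronese_poly_top (j : 'I_n.+1) : (veronese_poly j)`_n = veronese_vec n w1 0 j.
Proof.
have [s0 c0] := line_poly_top 0 (n - j); have [s1 c1] := line_poly_top 1 j.
have le_jn : (j <= n)%N by rewrite -ltnS ltn_ord.
by rewrite -[in X in _`_X](subnK le_jn) coefM_top // c0 c1 mxE.
Qed.

Definition forms_poly (l : 'cV[K]_3) : {poly K} :=
  \sum_j (a^T *m l) j 0 *: veronese_poly j.

Lemma horner_forms_poly l t :
  (forms_poly l).[t] = (forms_vec a (w0 + t *: w1) *m l) 0 0.
Proof.
rewrite horner_sum forms_vecE -mulmxA [RHS]mxE; apply: eq_bigr => j _.
by rewrite hornerZ horner_veronese_poly mulrC.
Qed.

Lemma horner_deriv_forms_poly l t :
  (forms_poly l)^`().[t] = (forms_diff (w0 + t *: w1) w1 *m l) 0 0.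
Proof.
rewrite [(forms_poly l)^`()]raddf_sum horner_sum -mulmxA [RHS]mxE; apply: eq_bigr => j _.
by rewrite /= derivZ hornerZ horner_deriv_veronese_poly mulrC.
Qed.

Lemma size_forms_poly l : (size (forms_poly l) <= n.+1)%N.
Proof.
rewrite (leq_trans (size_sum _ _ _)) //; apply/bigmax_leqP=> j _.
by rewrite (leq_trans (size_scale_leq _ _)) // size_veronese_poly.
Qed.

(** The value at infinity decides which coordinates of the curve have degree exactly [n] in [t]. *)
Lemma forms_poly_top l : (forms_poly l)`_n = (forms_vec a w1 *m l) 0 0.
Proof.
rewrite coef_sum forms_vecE -mulmxA [RHS]mxE; apply: eq_bigr => j _.
by rewrite coefZ veronese_poly_top mulrC.
Qed.

End Line.
End Forms.

Notation o0 := (@Ordinal 3 0 isT).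
Notation o1 := (@Ordinal 3 1 isT).
Notation o2 := (@Ordinal 3 2 isT).

Lemma ord3P (i : 'I_3) : [\/ i = o0, i = o1 | i = o2].
Proof.
by case: i => [[|[|[|i]]] hi] //;
  [apply: Or31|apply: Or32|apply: Or33]; apply: val_inj.
Qed.

Lemma sum3E (V : nmodType) (F : 'I_3 -> V) : \sum_i F i = F o0 + F o1 + F o2.
Proof.
rewrite !big_ord_recl big_ord0 addr0 addrA.
by congr (F _ + F _ + F _); apply: val_inj.
Qed.

Section LinearForms.
Variable K : fieldType.

Definition lform (l : 'cV[K]_3) (v : 'rV[K]_3) : K := (v *m l) 0 0.

Lemma lformD l v w : lform l (v + w) = lform l v + lform l w.
Proof. by rewrite /lform mulmxDl mxE. Qed.

Lemma lformZ l c v : lform l (c *: v) = c * lform l v.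
Proof. by rewrite /lform -scalemxAl mxE. Qed.

Lemma lform_col m (M : 'M[K]_(3, m)) i v : lform (col i M) v = (v *m M) 0 i.
Proof. by rewrite /lform !mxE; apply: eq_bigr => j _; rewrite mxE. Qed.

Record dual_basis (u1 u2 u3 : 'rV[K]_3) (l1 l2 l3 : 'cV[K]_3) : Prop := DualBasis {
  dual_dec : forall v, v = lform l1 v *: u1 + lform l2 v *: u2 + lform l3 v *: u3;
  dual1 : forall x y z, lform l1 (x *: u1 + y *: u2 + z *: u3) = x;
  dual2 : forall x y z, lform l2 (x *: u1 + y *: u2 + z *: u3) = y;
  dual3 : forall x y z, lform l3 (x *: u1 + y *: u2 + z *: u3) = z }.

Lemma exists_dual_basis u1 u2 u3 :
    (forall x y z, x *: u1 + y *: u2 + z *: u3 = 0 -> [/\ x = 0, y = 0 & z = 0]) ->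
  exists l1 l2 l3, dual_basis u1 u2 u3 l1 l2 l3.
Proof.
move=> indep; pose u (i : 'I_3) := if val i == 0%N then u1 else if val i == 1%N then u2
  else u3.
pose B : 'M[K]_3 := \matrix_i u i.
have mulB (c : 'rV_3) : c *m B = c 0 o0 *: u1 + c 0 o1 *: u2 + c 0 o2 *: u3.
  by rewrite mulmx_sum_row sum3E !rowK.
have B_unit : B \in unitmx.
  rewrite -row_free_unit; apply: inj_row_free => c; rewrite mulB => /indep [c0 c1 c2].
  by apply/rowP=> i; rewrite mxE; case: (ord3P i) => ->.
exists (col o0 (invmx B)), (col o1 (invmx B)), (col o2 (invmx B)).
have lB i x y z : lform (col i (invmx B)) (x *: u1 + y *: u2 + z *: u3) =
    (if val i == 0%N then x else if val i == 1%N then y else z).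
  pose c : 'rV[K]_3 := \row_i (if val i == 0%N then x else if val i == 1%N then y else z).
  have -> : x *: u1 + y *: u2 + z *: u3 = c *m B by rewrite mulB !mxE.
  by rewrite lform_col mulmxK // mxE.
split=> [v|x y z|x y z|x y z]; rewrite ?lB //.
by rewrite !lform_col -mulB mulmxKV.
Qed.

(** The cokernel of [w] kills exactly the line of [w]; a column of it that is nonzero at [v] is
    rescaled. *)
Lemma exists_lform (v w : 'rV[K]_3) : v \notin <[w]>%VS ->
  exists l, lform l v = 1 /\ lform l w = 0.
Proof.
move=> vw; have : ~~ (v <= w)%MS.
  apply: contra vw => /sub_rVP [k ->]; exact: memvZ (memv_line _).
rewrite submxE => /rV0Pn [j nz]; exists (((v *m cokermx w) 0 j)^-1 *: col j (cokermx w)).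
have lE x : lform (((v *m cokermx w) 0 j)^-1 *: col j (cokermx w)) x =
    ((v *m cokermx w) 0 j)^-1 * (x *m cokermx w) 0 j.
  by rewrite /lform -scalemxAr [LHS]mxE; congr (_ * _); apply: lform_col.
by rewrite !lE mulVf // mulmx_coker [X in _ * X]mxE mulr0.
Qed.

End LinearForms.

(** * The parameterization on representative vectors *)

Section CurveVectors.
Variables (K : closedFieldType) (charK : [pchar K] =i pred0) (n : nat).
Hypothesis n_gt0 : (0 < n)%N.
Variable a : 'M[K]_(3, n.+1).
Hypothesis ha : proper_param a.
Implicit Types w d : 'rV[K]_2.

Local Notation f := (forms_vec a).

Lemma forms_vec_neq0 w : w != 0 -> f w != 0.
Proof.
apply: contra => /eqP fw0; case: ha => nocz _; apply/eqP.
have [w0 w1] : w 0 0 = 0 /\ w 0 1 = 0.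
  by apply: nocz => u; have /rowP/(_ u) := fw0; rewrite !mxE.
by apply: rowP2; rewrite mxE.
Qed.

Lemma forms_vec_line c w : c != 0 -> w != 0 -> <[f (c *: w)]>%VS = <[f w]>%VS.
Proof.
move=> c0 w0; apply: vline_eq; first by rewrite forms_vecZ memvZ ?memv_line.
by rewrite forms_vec_neq0 // scaler_eq0 negb_or c0.
Qed.

Lemma param_line (Q : point K 1) w : w \in line Q -> w != 0 ->
  param a Q = <[f w]>%VS.
Proof.
rewrite mem_lineE => /vlineP [c ->]; rewrite scaler_eq0 negb_or => /andP [c0 w0].
by rewrite forms_vec_line.
Qed.

Lemma param_eqP (Q : point K 1) (P : point K 2) v : v \in line P -> v != 0 ->
  (param a Q = P <-> f (coords Q) \in <[v]>%VS).
Proof.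
move=> vP v0; rewrite /param [P : {vspace _}](line_mem vP v0); split=> [<-|].
  exact: memv_line.
by move/vline_eq; apply; rewrite forms_vec_neq0 ?coords_neq0.
Qed.

Lemma curve_ideal_vec (g : {mpoly K[3]}) : curve_ideal a g <->
  forall w v, w != 0 -> v \in <[f w]>%VS -> v != 0 -> g.@[v 0] = 0.
Proof.
split=> [hg w v w0 vf v0|hg P [Q eQP] v vP v0].
  have fw0 := forms_vec_neq0 w0.
  apply: (hg (vpoint fw0)) => //; exists (vpoint w0).
  by rewrite (param_line (w := w)) ?memv_line.
apply: (hg _ _ (coords_neq0 Q)) v0.
by move: vP; rewrite -[line P]eQP.
Qed.

Lemma vpoint_eq w w' (w0 : w != 0) (w'0 : w' != 0) :
  vpoint w0 = vpoint w'0 <-> det2 w w' = 0.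
Proof.
split=> [/(congr1 (@line K 1)) /= e|/eqP].
  by apply/eqP/(det2_eq0P _ w'0); rewrite -e memv_line.
by move/(det2_eq0P _ w'0) => h; apply: point_inj; apply: vline_eq.
Qed.

Lemma generically_injective_vec : exists2 E : seq 'rV[K]_3,
  {in E, forall e, e != 0} &
  forall w w', w != 0 -> w' != 0 -> f w' \in <[f w]>%VS ->
    {in E, forall e, f w \notin <[e]>%VS} -> det2 w w' = 0.
Proof.
case: ha => _ [E EP]; exists [seq coords P | P <- E].
  by move=> _ /mapP [P _ ->]; apply: coords_neq0.
move=> w w' w0 w'0 fw' notE; have fw0 := forms_vec_neq0 w0.
have [||Q [_ uQ]] := EP (vpoint fw0).
- by exists (vpoint w0); rewrite (param_line (w := w)) ?memv_line.
- apply/negP=> inE; have /negP := notE _ (map_f (@coords K 2) inE); apply.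
  by rewrite -mem_lineE memv_line.
apply/(vpoint_eq w0 w'0); rewrite -(uQ (vpoint w0)); last first.
  by rewrite (param_line (w := w)) ?memv_line.
apply: uQ; rewrite (param_line (w := w')) ?memv_line //=.
by apply: vline_eq fw' _; apply: forms_vec_neq0.
Qed.

(* [f] is not an immersion at [w]. *)
Definition critical w := exists2 d, d != 0 & forms_diff a w d = 0.

Lemma natn_neq0 : n%:R != 0 :> K.
Proof. by rewrite (pcharf0P _).1 // -lt0n. Qed.

(** By Euler's identity the differential sends [w] to [n f(w)], which is nonzero. So a kernel vector
    has a nonzero component along [w1]; conversely, if [w1] is sent into the line of [f w],
    subtracting a multiple of [w] gives a kernel vector. *)
Lemma criticalP w w1 : det2 w w1 != 0 ->
  (critical w <-> forms_diff a w w1 \in <[f w]>%VS).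
Proof.
move=> dw; have w0 := det2_neq0l dw; split=> [[d d0]|/vlineP [k dfw]].
  rewrite (det2_basis d dw); set x := _ / _; set y := _ / _.
  rewrite forms_diffDr !forms_diffZr forms_diff_self => e.
  have y0 : y != 0.
    apply: contraNneq d0 => y0; rewrite (det2_basis d dw) -/x -/y y0 scale0r addr0.
    move: e; rewrite y0 scale0r addr0 => /eqP; rewrite !scaler_eq0.
    by rewrite (negPf natn_neq0) (negPf (forms_vec_neq0 w0)) !orbF => ->.
  apply/vlineP; exists (- (x * n%:R) / y).
  apply: (scalerI y0); rewrite [RHS]scalerA mulrC divfK // scaleNr -[in RHS]scalerA.
  by apply/eqP; rewrite -addr_eq0 addrC e.
exists (w1 - (k / n%:R) *: w); last first.
  rewrite -scaleNr forms_diffDr forms_diffZr forms_diff_self dfw scalerA mulNr.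
  by rewrite divfK ?natn_neq0 // scaleNr subrr.
apply: contraNneq dw => /eqP; rewrite subr_eq0 => /eqP ->.
by rewrite /det2 !mxE; apply/eqP; ring.
Qed.

End CurveVectors.

(** Write [p = q h] with [h] the product over [ts]. At [t] the derivative of [p] is [q(t) h'(t)],
    and [h'(t)] is nonzero because [h] is separable; so [t] is a root of [q]. *)
Lemma dvdp_double_root (K : fieldType) (p : {poly K}) (ts : seq K) t :
  all (root p) ts -> uniq ts -> t \in ts -> root p^`() t ->
  \prod_(z <- ts) ('X - z%:P) * ('X - t%:P) %| p.
Proof.
move=> rts uts tts; have /dvdpP [q ->] : \prod_(z <- ts) ('X - z%:P) %| p.
  by rewrite uniq_roots_dvdp // uniq_rootsE.
set h := \prod_(z <- ts) _; rewrite derivM rootE hornerD !hornerM.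
have ht : root h t by rewrite root_prod_XsubC.
rewrite (rootP ht) mulr0 add0r mulf_eq0 => /orP [qt|dh]; last first.
  have := separable_prod_XsubC ts; rewrite uts unlock => /coprimep_root /(_ ht).
  by rewrite (eqP dh) eqxx.
by rewrite mulrC dvdp_mul // dvdp_XsubCl.
Qed.

(** * The equation of the curve in an affine chart *)

Section Homogenize.
Variables (K : closedFieldType) (lx ly lz : 'cV[K]_3).

(** Horner's scheme in both variables, clearing denominators with powers of [lz]. The powers are
    positive, so that [g] vanishes on the whole line [lz = 0], in particular at the points of the
    curve lying on it. *)
Lemma exists_homogenization (F : {poly {poly K}}) :
  exists (g : {mpoly K[3]}) (N : nat),
    (forall v, lform lz v != 0 -> g.@[v 0] = lform lz v ^+ N *
       F.[(lform ly v / lform lz v)%:P].[lform lx v / lform lz v]) /\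
    (forall v, lform lz v = 0 -> g.@[v 0] = 0).
Proof.
pose lin (l : 'cV[K]_3) : {mpoly K[3]} := \sum_i (l i 0)%:MP * 'X_i.
have linE l (v : 'rV[K]_3) : (lin l).@[v 0] = lform l v.
  rewrite /lin raddf_sum /lform mxE; apply: eq_bigr => i _ /=.
  by rewrite mevalM mevalC mevalXU mulrC.
elim/poly_ind: F => [|F c [g [N [gE g0]]]].
  by exists 0, 0%N; split=> v _; rewrite meval0 // !horner0 mulr0.
have [h [M [hE h0]]] : exists (h : {mpoly K[3]}) (M : nat),
    (forall v, lform lz v != 0 -> h.@[v 0] = lform lz v ^+ M *
       c.[lform lx v / lform lz v]) /\ (forall v, lform lz v = 0 -> h.@[v 0] = 0).
  elim/poly_ind: c => [|c b [h [M [hE h0]]]].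
    by exists 0, 0%N; split=> v _; rewrite meval0 // horner0 mulr0.
  exists (h * lin lx + b%:MP * lin lz ^+ M.+1), M.+1; split=> v z0.
    rewrite mevalD !mevalM mevalC rmorphXn /= !linE hE // hornerMXaddC exprS.
    by field.
  by rewrite mevalD !mevalM rmorphXn /= !linE h0 // z0 exprS !mul0r mulr0 addr0.
exists (g * lin ly * lin lz ^+ M + h * lin lz ^+ N.+1), (N + M).+1; split=> v z0.
  rewrite mevalD !mevalM !rmorphXn /= !linE gE // hE //.
  rewrite hornerMXaddC hornerD hornerM hornerC !exprS exprD.
  by field.
by rewrite mevalD !mevalM !rmorphXn /= !linE g0 // h0 // !mul0r addr0.
Qed.

End Homogenize.

Section Chart.
Variables (K : closedFieldType) (charK : [pchar K] =i pred0) (n : nat).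
Hypothesis n_gt1 : (1 < n)%N.
Variable a : 'M[K]_(3, n.+1).
Hypothesis ha : proper_param a.
Local Notation f := (forms_vec a).

Let n_gt0 : (0 < n)%N. Proof. exact: ltnW. Qed.

Variables (w0 w1 : 'rV[K]_2) (u2 vP : 'rV[K]_3) (l1 l2 l3 : 'cV[K]_3).
Hypothesis Hw : det2 w0 w1 != 0.
Hypothesis Hd : dual_basis (f w1) u2 vP l1 l2 l3.

Let wt t := w0 + t *: w1.
(** The coordinates of [f (wt t)] in the basis [f w1], [u2], [vP]. As [w1] is at infinity, [a1] is
    monic of degree [n] and [a2], [a3] have smaller degree; the parameters over the point [P]
    spanned by [vP] are the common roots of [a1] and [a2]. *)
Let a1 := forms_poly a w0 w1 l1.
Let a2 := forms_poly a w0 w1 l2.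
Let a3 := forms_poly a w0 w1 l3.

Let wt_det t : det2 (wt t) w1 != 0.
Proof. by rewrite det2_affine. Qed.

Let wt_neq0 t : wt t != 0.
Proof. exact: det2_neq0l (wt_det t). Qed.

Let w1_neq0 : w1 != 0. Proof. exact: det2_neq0r Hw. Qed.

Let f_wt t : f (wt t) = a1.[t] *: f w1 + a2.[t] *: u2 + a3.[t] *: vP.
Proof. by rewrite !horner_forms_poly -!/(lform _ _) -(dual_dec Hd). Qed.

Let df_wt t : forms_diff a (wt t) w1 =
  a1^`().[t] *: f w1 + a2^`().[t] *: u2 + a3^`().[t] *: vP.
Proof. by rewrite !horner_deriv_forms_poly -!/(lform _ _) -(dual_dec Hd). Qed.

Let top_fw1 l : (forms_poly a w0 w1 l)`_n = lform l (f w1).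
Proof. exact: forms_poly_top. Qed.

Let fw1E : f w1 = 1 *: f w1 + 0 *: u2 + 0 *: vP.
Proof. by rewrite scale1r !scale0r !addr0. Qed.

Let vPE k : k *: vP = 0 *: f w1 + 0 *: u2 + k *: vP.
Proof. by rewrite !scale0r !add0r. Qed.

Let size_a1 : size a1 = n.+1.
Proof.
apply/eqP; rewrite eqn_leq size_forms_poly ltnNge; apply/negP=> /leq_sizeP/(_ n (leqnn n)).
by rewrite top_fw1 fw1E (dual1 Hd) => /eqP; rewrite oner_eq0.
Qed.

Let monic_a1 : a1 \is monic.
Proof. by rewrite monicE lead_coefE size_a1 top_fw1 fw1E (dual1 Hd). Qed.

Let size_small l : lform l (f w1) = 0 -> (size (forms_poly a w0 w1 l) <= n)%N.
Proof.
move=> l0; apply/leq_sizeP=> j; rewrite leq_eqVlt => /orP [/eqP <-|lt_nj].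
  by rewrite top_fw1.
by rewrite nth_default // (leq_trans (size_forms_poly _ _ _ _)).
Qed.

Let size_a2 : (size a2 <= n)%N.
Proof. by apply: size_small; rewrite fw1E (dual2 Hd). Qed.

Let size_a3 : (size a3 <= n)%N.
Proof. by apply: size_small; rewrite fw1E (dual3 Hd). Qed.

Let no_common_root t : a1.[t] = 0 -> a2.[t] = 0 -> a3.[t] != 0.
Proof.
move=> h1 h2; apply/eqP=> h3; have /eqP := forms_vec_neq0 ha (wt_neq0 t); apply.
by rewrite f_wt h1 h2 h3 !scale0r !addr0.
Qed.

Let over_vP t : (f (wt t) \in <[vP]>%VS) = (a1.[t] == 0) && (a2.[t] == 0).
Proof.
apply/vlineP/andP => [[k]|[/eqP h1 /eqP h2]]; last first.
  by exists a3.[t]; rewrite f_wt h1 h2 !scale0r !add0r.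
rewrite vPE => e; have := congr1 (lform l1) e; have := congr1 (lform l2) e.
by rewrite f_wt !(dual1 Hd) !(dual2 Hd) => -> ->.
Qed.

Let not_over_w1 : f w1 \notin <[vP]>%VS.
Proof.
apply/negP=> /vlineP [k]; rewrite vPE => /(congr1 (lform l1)).
by rewrite (dual1 Hd) fw1E (dual1 Hd) => /eqP; rewrite oner_eq0.
Qed.

Let det2_over w : w != 0 -> f w \in <[vP]>%VS -> det2 w w1 != 0.
Proof.
move=> wn0; apply: contraL => /(det2_eq0P _ w1_neq0) /vlineP [k ek].
have k0 : k != 0 by apply: contraNneq wn0 => k0; rewrite ek k0 scale0r.
by rewrite ek forms_vecZ memvZ_eq // expf_neq0.
Qed.

Hypothesis vP_on : exists2 w, w != 0 & f w \in <[vP]>%VS.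

Let a3_neq0 : a3 != 0.
Proof.
case: vP_on => w wn0 fw; have [t [c [c0 ew]]] := affine_chart Hw (det2_over wn0 fw).
move: fw; rewrite ew forms_vecZ memvZ_eq ?expf_neq0 // over_vP => /andP [/eqP h1 /eqP h2].
by apply: contraNneq (no_common_root h1 h2) => ->; rewrite horner0.
Qed.

(* [w1] is the point at infinity of the affine parameter [t], and the projection is
   from the point [e1 k], which is general on the line through [f w1] and [u2]. *)
Let pk (k : K) := a1 - k *: a2.
Let e1 k := u2 + k *: f w1.

Let size_pk k : size (pk k) = n.+1. Proof. exact: size_fibre size_a1 size_a2 k. Qed.
Let monic_pk k : pk k \is monic.
Proof. exact: monic_fibre monic_a1 size_a1 size_a2 k. Qed.

(** At a common root [t] of [pk k] and [a3], the value of [a2] is nonzero, since otherwise all three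
    coordinates would vanish; so [k] is the value of [a1 / a2] at a root of [a3]. *)
Let coprime_pk : exists s : seq K, forall k, k \notin s -> coprimep (pk k) a3.
Proof.
have [r def_a3] := closed_field_poly_normal a3.
exists [seq a1.[t] / a2.[t] | t <- r] => k kr.
rewrite coprimep_sym; apply: Pdiv.ClosedField.root_coprimep => t rt.
apply: contra kr; rewrite !hornerE subr_eq0 => /eqP h1.
have a2t : a2.[t] != 0.
  apply/eqP=> h2; have := no_common_root _ h2; rewrite h1 h2 mulr0 => /(_ erefl).
  by rewrite (rootP rt) eqxx.
apply/mapP; exists t; last by rewrite h1 mulfK.
by move: rt; rewrite def_a3 rootZ ?lead_coef_eq0 // root_prod_XsubC.
Qed.

Let f_wt_pk k t : f (wt t) = (pk k).[t] *: f w1 + a2.[t] *: e1 k + a3.[t] *: vP.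
Proof.
rewrite f_wt /pk /e1 hornerD hornerN hornerZ; move: (f w1) => u1.
by apply/rowP=> i; rewrite !mxE; ring.
Qed.

(** The excluded values of [x] are those of the finitely many points where generic injectivity may
    fail. On any other line of the pencil, equal values of [a2 / a3] mean equal image points. *)
Let inj_pk k : exists E : seq K, coprimep (pk k) a3 -> injective_outside (pk k) a2 a3 E.
Proof.
have [E En0 EP] := generically_injective_vec ha.
exists [seq (lform l1 e - k * lform l2 e) / lform l3 e | e <- E] => cop x xE t t' rt rt' h.
have p2t := p2_fibre_neq0 cop rt; have p2t' := p2_fibre_neq0 cop rt'.
have rE s : root (pk k - x *: a3) s -> (pk k).[s] = x * a3.[s].
  by rewrite rootE !hornerE subr_eq0 => /eqP.
have /eqP : det2 (wt t) (wt t') = 0.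
  apply: EP => //.
    apply/vlineP; exists (a3.[t'] / a3.[t]); rewrite !(f_wt_pk k) !rE //.
    have -> : a2.[t'] = a2.[t] * a3.[t'] / a3.[t] by rewrite h mulfK.
    move: (f w1) (e1 k) => u1 v1; apply/rowP=> i; rewrite !mxE; field; exact: p2t.
  move=> e eE; apply: contra xE => /vlineP [c fc]; apply/mapP; exists e => //.
  have := congr1 (lform l1) fc; have := congr1 (lform l2) fc.
  have := congr1 (lform l3) fc; rewrite f_wt !lformZ !(dual1 Hd, dual2 Hd, dual3 Hd).
  move=> h3 h2 h1.
  have [c0 le0] : c != 0 /\ lform l3 e != 0.
    by move: p2t; rewrite h3 mulf_eq0 negb_or => /andP.
  have := rE t rt; rewrite /pk hornerD hornerN hornerZ h1 h2 h3 => hx.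
  have {}hx : lform l1 e - k * lform l2 e = x * lform l3 e.
    by apply: (mulfI c0); rewrite mulrBr mulrCA hx mulrCA.
  by rewrite hx mulfK.
have -> : det2 (wt t) (wt t') = (t' - t) * det2 w0 w1.
  by rewrite /det2 !mxE; ring.
by rewrite mulf_eq0 (negPf Hw) orbF subr_eq0 => /eqP.
Qed.

(** The polynomial [g] on the affine plane [c + s x + t y], where [s] is the inner and [t] the outer
    variable. *)
Definition plane_poly (c x y : 'rV[K]_3) (g : {mpoly K[3]}) : {poly {poly K}} :=
  mmap (polyC \o polyC) (fun i => ((c 0 i)%:P + x 0 i *: 'X)%:P + (y 0 i)%:P *: 'X) g.

Lemma horner_plane_poly c x y g s t :
  (plane_poly c x y g).[t%:P].[s] = g.@[(c + s *: x + t *: y) 0].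
Proof.
rewrite -[LHS]/((horner_eval s \o horner_eval t%:P) _) /plane_poly.
apply: rmorph_mmap => [b|i] /=; rewrite /horner_eval; first by rewrite !hornerC.
by rewrite !hornerE !mxE; ring.
Qed.

Lemma restrict_plane_poly c x y g al be :
  (map_poly (comp_poly (al *: 'X)) (plane_poly c x y g)).[be *: 'X]
  = restrict (c 0) ((al *: x + be *: y) 0) g.
Proof.
rewrite -[LHS]/((horner_eval (be *: 'X) \o map_poly (comp_poly (al *: 'X))) _).
rewrite /plane_poly; apply: rmorph_mmap => [b|i] /=; rewrite /horner_eval.
  by rewrite !map_polyC /= comp_polyC hornerC.
rewrite rmorphD /= map_polyC map_polyZ /= map_polyX comp_polyC comp_polyD comp_polyC.
rewrite comp_polyZ comp_polyX !hornerE !mxE -addrA; congr (_ + _).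
rewrite mul_polyC !scalerA -scalerDl mulrC [_ * be]mulrC; congr (_ *: _).
Qed.

Let plane_vanishes k g : curve_ideal a g ->
  vanishes_on_graph (pk k) a2 a3 (plane_poly vP (f w1) (e1 k) g).
Proof.
move=> /(curve_ideal_vec ha) hg t a3t; rewrite horner_plane_poly.
have -> : vP + ((pk k).[t] / a3.[t]) *: f w1 + (a2.[t] / a3.[t]) *: e1 k
        = a3.[t]^-1 *: f (wt t).
  rewrite (f_wt_pk k); move: (f w1) (e1 k) => u1 v1.
  by apply/rowP=> i; rewrite !mxE; field.
apply: (hg (wt t)) => //; first by rewrite memvZ ?memv_line.
by rewrite scaler_eq0 negb_or invr_neq0 // (forms_vec_neq0 ha).
Qed.

Let tQ w := det2 w0 w / det2 w w1.

Let tQE w : det2 w w1 != 0 -> exists2 c, c != 0 & w = c *: wt (tQ w).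
Proof.
move=> nw; exists (det2 w w1 / det2 w0 w1); first by rewrite mulf_neq0 ?invr_eq0.
rewrite {1}(det2_basis w Hw) scalerDr scalerA; congr (_ + _ *: _).
by rewrite /tQ; field; rewrite Hw nw.
Qed.

Let over_tQ w : w != 0 -> f w \in <[vP]>%VS ->
  a1.[tQ w] = 0 /\ a2.[tQ w] = 0.
Proof.
move=> wn0 fw; have [c c0 ew] := tQE (det2_over wn0 fw).
move: fw; rewrite {1}ew forms_vecZ memvZ_eq ?expf_neq0 // over_vP.
by case/andP=> /eqP -> /eqP ->.
Qed.

(* [b] accounts for the extra order of vanishing due to a critical preimage. *)
Lemma restrict_order_ge g (ws : seq 'rV[K]_2) (b : bool) al be :
    curve_ideal a g ->
    {in ws, forall w, w != 0 /\ f w \in <[vP]>%VS} ->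
    pairwise (fun w w' => det2 w w' != 0) ws ->
    (b -> exists2 w, w \in ws & critical a w) ->
  'X^(size ws + b) %| restrict (vP 0) ((al *: f w1 + be *: u2) 0) g.
Proof.
move=> hg wsP wsU wsC.
have [s sP] := coprime_pk; have [k /sP cop] := exists_notin s.
have [E /(_ cop) injE] := inj_pk k.
pose ts := map tQ ws.
have uts : uniq ts.
  rewrite /ts uniq_pairwise pairwise_map.
  have all_ws : all (mem ws) ws by apply/allP.
  apply: sub_in_pairwise all_ws wsU => w w' /wsP [wn0 fw] /wsP [w'n0 fw'] /=.
  have [c c0 ew] := tQE (det2_over wn0 fw); have [c' c'0 ew'] := tQE (det2_over w'n0 fw').
  apply: contraNneq => et; rewrite ew ew' et /det2 !mxE; apply/eqP; ring.
have rts l : l = l1 \/ l = l2 -> all (root (forms_poly a w0 w1 l)) ts.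
  move=> hl; apply/allP=> _ /mapP [w wws ->]; have [wn0 fw] := wsP w wws.
  by have [h1 h2] := over_tQ wn0 fw; case: hl => ->; apply/rootP.
(* [h] is the common divisor of [a1] and [a2] fed to [dvdXn_restriction]: one linear factor for each
   preimage, and a second one at a critical preimage, where the derivatives of [a1] and [a2] vanish
   as well. *)
have [h [hp sz_h]] : exists h : {poly K},
    (h %| a1 /\ h %| a2) /\ size h = (size ws + b).+1.
  case: b wsC => [/(_ isT) [w wws crit]|_]; last first.
    exists (\prod_(z <- ts) ('X - z%:P)); split; last first.
      by rewrite size_prod_XsubC size_map addn0.
    by split; apply: uniq_roots_dvdp; rewrite ?uniq_rootsE // rts //; auto.
  exists (\prod_(z <- ts) ('X - z%:P) * ('X - (tQ w)%:P)); split; last first.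
    rewrite size_mul ?monic_neq0 ?monic_prod_XsubC ?monicXsubC //.
    by rewrite size_prod_XsubC size_XsubC size_map addnS /= addn1 addn1.
  have [wn0 fw] := wsP w wws; have dw := det2_over wn0 fw.
  have [c c0 ew] := tQE dw.
  have /vlineP [x dx] : forms_diff a (wt (tQ w)) w1 \in <[f (wt (tQ w))]>%VS.
    apply/(criticalP charK n_gt0 ha (wt_det _)).
    case: crit => d d0; rewrite [in forms_diff a w]ew forms_diffZl => /eqP.
    by rewrite scaler_eq0 expf_eq0 (negPf c0) andbF => /eqP dd; exists d.
  have [h1 h2] := over_tQ wn0 fw.
  have dl l : lform l (f (wt (tQ w))) = 0 -> root (forms_poly a w0 w1 l)^`() (tQ w).
    by move=> l0; rewrite rootE horner_deriv_forms_poly -/(lform _ _) dx lformZ l0 mulr0.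
  split; apply: dvdp_double_root; rewrite ?map_f ?rts //; auto; apply: dl.
    by rewrite f_wt (dual1 Hd).
  by rewrite f_wt (dual2 Hd).
have -> : al *: f w1 + be *: u2 = (al - k * be) *: f w1 + be *: e1 k.
  by rewrite /e1; move: (f w1) => u1; apply/rowP=> i; rewrite !mxE; ring.
rewrite -restrict_plane_poly.
apply: (dvdXn_restriction charK n_gt0 (monic_pk k) (size_pk k) size_a3 cop (h := h)) injE
  _ _ _ sz_h.
- exact: plane_vanishes.
- by case: hp => h1 h2; rewrite dvdp_sub // -mul_polyC dvdp_mull.
- by case: hp.
Qed.

(** Otherwise all [n] points of a general fibre would have [y = 0], although [n] is at least 2 and
    [y] is injective on the fibre. *)
Let a2_neq0 : a2 != 0.
Proof.
apply/eqP=> a20.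
have [s sP] := coprime_pk; have [k /sP cop] := exists_notin s.
have [E /(_ cop) injE] := inj_pk k.
have [s' s'P] := separable_fibre charK n_gt0 (monic_pk k) (size_pk k) size_a3 cop.
have [x] := exists_notin (s' ++ E); rewrite mem_cat negb_or => /andP [/s'P + xE].
case=> [[|t [|t' rs]] [urs sz_rs def_p]]; try by move: n_gt1; rewrite -sz_rs.
have rt u : u \in [:: t, t' & rs] -> root (pk k - x *: a3) u.
  by rewrite def_p root_prod_XsubC.
have tt' : t = t'.
  apply: injE xE _ _ _ _ _; rewrite ?a20 ?horner0 ?mul0r //; apply: rt;
    by rewrite !inE eqxx ?orbT.
by move: urs; rewrite /= tt' inE eqxx.
Qed.

(** For general [k], the line through [P] and [e1 k] meets the curve at [n] distinct parameters.
    Those over [P] are among the [ws], so the others give at least [n - size ws] distinct nonzero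
    roots of [F(0, y)]. *)
Lemma exists_restrict_ndvdXn (ws : seq 'rV[K]_2) :
    {in ws, forall w, w != 0 /\ f w \in <[vP]>%VS} ->
    (forall w, w != 0 -> f w \in <[vP]>%VS -> exists2 w', w' \in ws & det2 w w' = 0) ->
    {in ws, forall w, ~ critical a w} ->
  exists g v, curve_ideal a g /\ ~~ ('X^((size ws).+1) %| restrict (vP 0) ((v : 'rV_3) 0)
    g).
Proof.
move=> wsP wsC wsN.
have [s1 s1P] := coprime_pk.
have [E En0 EP] := generically_injective_vec ha.
pose W := a1^`() * a2 - a1 * a2^`().
have W0 : W != 0 := wronskian_neq0 charK n_gt0 monic_a1 size_a1 a2_neq0 size_a2.
have [rW def_W] := closed_field_poly_normal W.
pose ts := map tQ ws.
(* The four excluded sets ensure, in order: that [pk k] and [a3] are coprime; that no exceptional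
   point of the generic injectivity lies on the line away from [P]; that the line is not tangent to
   the curve away from [P]; that it is not tangent to a branch at [P]. *)
have [k] := exists_notin (s1 ++ [seq lform l1 e / lform l2 e | e <- E]
  ++ [seq a1.[t] / a2.[t] | t <- rW] ++ [seq a1^`().[t] / a2^`().[t] | t <- ts]).
rewrite !mem_cat !negb_or => /and4P [/s1P cop kE kW kts].
have over_ts t : a1.[t] = 0 -> a2.[t] = 0 -> t \in ts.
  move=> h1 h2; have ft : f (wt t) \in <[vP]>%VS by rewrite over_vP h1 h2 !eqxx.
  have [w wws dw] := wsC _ (wt_neq0 t) ft; apply/mapP; exists w => //.
  have [wn0 fw] := wsP w wws; have [c c0 ew] := tQE (det2_over wn0 fw).
  move: dw; rewrite [w]ew.
  have -> : det2 (wt t) (c *: wt (tQ w)) = c * (tQ w - t) * det2 w0 w1.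
    by rewrite /det2 !mxE; ring.
  move/eqP; rewrite !mulf_eq0 (negPf c0) (negPf Hw) orbF subr_eq0 /= => /eqP <-.
  by rewrite -ew.
have sep t : root (pk k) t -> (pk k)^`().[t] != 0.
  rewrite rootE /pk derivB derivZ !hornerE !subr_eq0 => /eqP h1; apply/negP=> /eqP dh1.
  have [h2|h2] := eqVneq a2.[t] 0; last first.
    case/mapP: kW; exists t; last by rewrite h1 mulfK.
    rewrite -root_prod_XsubC -(@rootZ _ _ (lead_coef W)) ?lead_coef_eq0 //.
    by rewrite -def_W rootE /W !hornerE dh1 h1 mulrAC subrr.
  have {}h1 : a1.[t] = 0 by rewrite h1 h2 mulr0.
  have [dh2|dh2] := eqVneq a2^`().[t] 0; last first.
    by case/mapP: kts; exists t; rewrite ?over_ts // dh1 mulfK.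
  have {}dh1 : a1^`().[t] = 0 by rewrite dh1 dh2 mulr0.
  have /mapP [w wws et] := over_ts t h1 h2; apply: (wsN w wws).
  have [wn0 fw] := wsP w wws; have [c c0 ew] := tQE (det2_over wn0 fw).
  (* With both derivatives zero, the differential along [w1] lies on the line of [vP], which is that
     of [f (wt t)]. *)
  have [d d0 dd] : critical a (wt t).
    apply/(criticalP charK n_gt0 ha (wt_det _)).
    rewrite df_wt dh1 dh2 f_wt h1 h2 !scale0r !add0r.
    by apply/vlineP; exists (a3^`().[t] / a3.[t]); rewrite scalerA divfK // no_common_root.
  by exists d => //; rewrite ew forms_diffZl -et dd scaler0.
have [rs [urs sz_rs def_p]] := separable_roots (monic_pk k) (size_pk k) sep.
have rrs t : t \in rs -> root (pk k) t by rewrite def_p root_prod_XsubC.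
pose us := [seq t <- rs | a2.[t] != 0].
have p3t t : root (pk k) t -> a3.[t] != 0 := coprimep_root cop (x := t).
have [|||| F vF ndvd] := exists_restriction_ndvdXn (p1 := a2) (ts := us) (m := size ws)
   n_gt0 (monic_pk k) (size_pk k) size_a3 cop.
- by apply/allP=> t; rewrite mem_filter => /andP [_ /rrs].
- rewrite map_inj_in_uniq ?filter_uniq // => t t'; rewrite !mem_filter.
  case/andP=> h2 /rrs rt /andP [h2' /rrs rt'].
  have h3 := p3t t rt; have h3' := p3t t' rt'.
  move=> /eqP; rewrite eqr_div // => /eqP h.
  have /eqP : det2 (wt t) (wt t') = 0.
    apply: EP => //.
      apply/vlineP; exists (a3.[t'] / a3.[t]); rewrite !(f_wt_pk k).
      rewrite (rootP rt) (rootP rt').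
      have -> : a2.[t'] = a2.[t] * a3.[t'] / a3.[t] by rewrite h mulfK.
      move: (f w1) (e1 k) => u1 v1; apply/rowP=> i; rewrite !mxE; field; exact: h3.
    move=> e eE; apply: contra kE => /vlineP [c fc]; apply/mapP; exists e => //.
    have := congr1 (lform l1) fc; have := congr1 (lform l2) fc.
    rewrite f_wt !lformZ !(dual1 Hd, dual2 Hd) => e2 e1'.
    have [c0 le0] : c != 0 /\ lform l2 e != 0.
      by move: h2; rewrite e2 mulf_eq0 negb_or => /andP.
    have := rootP rt; rewrite /pk hornerD hornerN hornerZ e1' e2 => /eqP.
    rewrite subr_eq0 mulrCA => /eqP /(mulfI c0) ->.
    by rewrite mulfK.
  have -> : det2 (wt t) (wt t') = (t' - t) * det2 w0 w1.
    by rewrite /det2 !mxE; ring.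
  by rewrite mulf_eq0 (negPf Hw) orbF subr_eq0 => /eqP.
- by apply/allP=> t; rewrite mem_filter => /andP [].
- rewrite -sz_rs -(count_predC (fun t => a2.[t] != 0) rs) size_filter leq_add2l.
  rewrite -size_filter -(size_map tQ ws); apply: uniq_leq_size; first exact: filter_uniq.
  move=> t; rewrite mem_filter /= negbK => /andP [/eqP h2 /rrs /rootP].
  by rewrite /pk hornerD hornerN hornerZ h2 mulr0 subr0 => h1; apply: over_ts.
have [g [N [gE g0]]] := exists_homogenization (l1 - k *: l2) l2 l3 F.
have lkE v : lform (l1 - k *: l2) v = lform l1 v - k * lform l2 v.
  by rewrite /lform mulmxBr -scalemxAr !mxE.
exists g, (e1 k); split.
  apply/(curve_ideal_vec ha) => w v wn0 vf v0.
  have [/g0 //|v3] := eqVneq (lform l3 v) 0; rewrite gE //.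
  case/vlineP: vf => c ev.
  have c0 : c != 0 by apply: contraNneq v0 => c0; rewrite ev c0 scale0r.
  have dw : det2 w w1 != 0.
    apply: contraNneq v3 => /eqP /(det2_eq0P _ w1_neq0) /vlineP [x ex].
    by rewrite ev ex forms_vecZ !lformZ fw1E (dual3 Hd) !mulr0.
  have [x x0 ew] := tQE dw; set t := tQ w in ew.
  have [y y0 ev'] : exists2 y, y != 0 & v = y *: f (wt t).
    by exists (c * x ^+ n); rewrite ?mulf_neq0 ?expf_neq0 // ev ew forms_vecZ scalerA.
  have v1E : lform l1 v = y * a1.[t] by rewrite ev' lformZ f_wt (dual1 Hd).
  have v2E : lform l2 v = y * a2.[t] by rewrite ev' lformZ f_wt (dual2 Hd).
  have v3E : lform l3 v = y * a3.[t] by rewrite ev' lformZ f_wt (dual3 Hd).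
  have a3t : a3.[t] != 0 by move: v3; rewrite v3E mulf_eq0 negb_or => /andP [].
  rewrite lkE v1E v2E v3E [k * _]mulrCA -mulrBr -!mulf_div divff // !mul1r.
  have := vF t a3t; rewrite /pk hornerD hornerN hornerZ => ->.
  by rewrite mulr0.
(* On the line [vP + t *: e1 k] the three coordinates are [0], [t] and [1], so [g] becomes
   [F(0, t)]. *)
suff -> : restrict (vP 0) (e1 k 0) g = map_poly (horner_eval 0) F by [].
apply/eqP; rewrite -subr_eq0; apply/eqP; apply: (@poly_eq0_cofinite _ _ [::]) => t _.
rewrite hornerD hornerN; apply/eqP; rewrite subr_eq0; apply/eqP.
have -> : (restrict (vP 0) (e1 k 0) g).[t] = g.@[(vP + t *: e1 k) 0].
  rewrite -[LHS]/(horner_eval t _); apply: rmorph_mmap => [b|i] /=; rewrite /horner_eval.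
    by rewrite hornerC.
  by rewrite !hornerE !mxE mulrC.
have eE : vP + t *: e1 k = (t * k) *: f w1 + t *: u2 + 1 *: vP.
  by rewrite /e1; move: (f w1) => u1; apply/rowP=> i; rewrite !mxE; ring.
rewrite gE eE ?lkE ?(dual1 Hd) ?(dual2 Hd) ?(dual3 Hd) ?oner_eq0 //.
rewrite expr1n mul1r !divr1 [t * k]mulrC subrr.
by rewrite -[t in RHS](hornerC _ 0) -[_.[0] in RHS]/(horner_eval 0 _) horner_map.
Qed.

Let tQ_wt w : det2 w w1 != 0 -> det2 w (wt (tQ w)) = 0.
Proof. by move/tQE=> [c _ ew]; rewrite {1}ew /det2 !mxE; ring. Qed.

Lemma fibre_finite : exists2 s : seq 'rV[K]_2, {in s, forall w, w != 0} &
  forall w, w != 0 -> f w \in <[vP]>%VS -> exists2 w', w' \in s & det2 w w' = 0.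
Proof.
have [r def_a1] := closed_field_poly_normal a1.
exists (map wt r) => [_ /mapP [t _ ->]|w wn0 fw]; first exact: wt_neq0.
have dw := det2_over wn0 fw; exists (wt (tQ w)); last exact: tQ_wt.
apply: map_f; rewrite -root_prod_XsubC -(@rootZ _ _ (lead_coef a1)).
  by rewrite -def_a1; apply/rootP; case: (over_tQ wn0 fw).
by rewrite lead_coef_eq0 monic_neq0.
Qed.

(** At a critical [wt t] the derivatives of [a1] and [a2] are proportional to their values, so [t]
    is a root of [W]; [w1] is added for the point at infinity. *)
Lemma critical_finite : exists2 s : seq 'rV[K]_2, {in s, forall w, w != 0} &
  forall w, w != 0 -> critical a w -> exists2 w', w' \in s & det2 w w' = 0.
Proof.
pose W := a1^`() * a2 - a1 * a2^`().
have W0 : W != 0 := wronskian_neq0 charK n_gt0 monic_a1 size_a1 a2_neq0 size_a2.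
have [r def_W] := closed_field_poly_normal W.
exists (w1 :: map wt r) => [w|w wn0 [d d0 dd]].
  by rewrite inE => /predU1P [->|/mapP [t _ ->]].
have [dw|dw] := eqVneq (det2 w w1) 0; first by exists w1; rewrite ?mem_head.
exists (wt (tQ w)); last exact: tQ_wt.
rewrite inE; apply/orP; right; apply: map_f.
rewrite -root_prod_XsubC -(@rootZ _ _ (lead_coef W)) ?lead_coef_eq0 // -def_W.
have [c c0 ew] := tQE dw; set t := tQ w in ew *.
have /vlineP [k dk] : forms_diff a (wt t) w1 \in <[f (wt t)]>%VS.
  apply/(criticalP charK n_gt0 ha (wt_det _)); exists d => //.
  move/eqP: dd; rewrite ew forms_diffZl scaler_eq0 expf_eq0 (negPf c0) andbF.
  by move/eqP.
have := congr1 (lform l1) dk; have := congr1 (lform l2) dk.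
rewrite !lformZ df_wt f_wt !(dual1 Hd) !(dual2 Hd) => h2 h1.
by apply/rootP; rewrite /W !hornerE h1 h2; ring.
Qed.

End Chart.

(** * Singular points and multiplicities *)

Section CurvePoints.
Variables (K : closedFieldType) (charK : [pchar K] =i pred0) (n : nat).
Hypothesis n_gt1 : (1 < n)%N.
Variable a : 'M[K]_(3, n.+1).
Hypothesis ha : proper_param a.
Local Notation f := (forms_vec a).

Let n_gt0 : (0 < n)%N. Proof. exact: ltnW. Qed.

(** Every line meets the curve: the form pulled back to the parameter either vanishes at infinity or
    has degree [n > 0] in [t], hence a root. *)
Lemma exists_form_zero l : exists2 w : 'rV[K]_2, w != 0 & lform l (f w) = 0.
Proof.
pose w0 : 'rV[K]_2 := \row_i (i == 0)%:R; pose w1 : 'rV[K]_2 := \row_i (i == 1)%:R.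
have dw : det2 w0 w1 != 0 by rewrite /det2 !mxE /= mul1r mulr0 subr0 oner_eq0.
pose p := forms_poly a w0 w1 l.
have [top0|top] := eqVneq p`_n 0.
  by exists w1; [exact: det2_neq0r dw | move: top0; rewrite forms_poly_top].
have /closed_rootP [t rt] : size p != 1%N.
  rewrite neq_ltn (leq_trans n_gt1) ?orbT // ltnW // ltnNge.
  by apply: contra top => /leq_sizeP ->.
exists (w0 + t *: w1); last by rewrite /lform -horner_forms_poly (rootP rt).
by apply: det2_neq0l (w1) _; rewrite det2_affine.
Qed.

(** Both [f w1] and [u2] are taken on the line [l = 0], which misses the point of [vP] and meets the
    curve by [exists_form_zero]. Every direction killed by [l] is then a combination of these two,
    the form required by [restrict_order_ge]. *)
Lemma exists_chart l vP : lform l vP = 1 -> exists w0 w1 u2 l1 l2 l3,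
  [/\ det2 w0 w1 != 0, dual_basis (f w1) u2 vP l1 l2 l3
    & forall v, lform l v = 0 -> v = lform l1 v *: f w1 + lform l2 v *: u2].
Proof.
move=> lP; have [w1 w1n0 lw1] := exists_form_zero l.
have [w0 dw] := det2_complete w1n0.
have u1n0 := forms_vec_neq0 ha w1n0; set u1 := f w1 in lw1 u1n0 *.
have [x xN] : exists x : 'rV[K]_3, ~~ (x <= col_mx u1 vP)%MS.
  have /row_subPn [i hi] : ~~ (1%:M <= col_mx u1 vP)%MS.
    apply/negP=> /mxrankS; rewrite mxrank1 => /leq_trans/(_ (rank_leq_row _)).
    by [].
  by exists (row i 1%:M).
pose u2 := x - lform l x *: vP.
have lu2 : lform l u2 = 0 by rewrite /u2 -scaleNr lformD lformZ lP mulr1 subrr.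
have [l1 [l2 [l3 hd]]] : exists l1 l2 l3, dual_basis u1 u2 vP l1 l2 l3.
  apply: exists_dual_basis => r s t e.
  have t0 : t = 0.
    have := congr1 (lform l) e;
      rewrite !lformD !lformZ lw1 lu2 lP !mulr0 !add0r mulr1 => ->.
    by rewrite /lform mul0mx mxE.
  have s0 : s = 0.
    apply/eqP; apply: contraR xN => s0; rewrite -[x](addrNK (lform l x *: vP)) -/u2.
    have -> : u2 = - (s^-1 * r) *: u1.
      apply: (scalerI s0); rewrite scalerA mulrN mulVKf // scaleNr.
      by apply/eqP; rewrite -addr_eq0 addrC; apply/eqP; rewrite -[RHS]e t0 scale0r addr0.
    have -> : - (s^-1 * r) *: u1 + lform l x *: vP =
              row_mx (- (s^-1 * r))%:M (lform l x)%:M *m col_mx u1 vP.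
      by rewrite mul_row_col !mul_scalar_mx.
    exact: submxMl.
  split=> //; move: e; rewrite s0 t0 !scale0r !addr0 => /eqP.
  by rewrite scaler_eq0 (negPf u1n0) orbF => /eqP.
exists w0, w1, u2, l1, l2, l3; split=> // v lv.
rewrite {1}(dual_dec hd v); have -> : lform l3 v = 0.
  have := congr1 (lform l) (dual_dec hd v).
  by rewrite !lformD !lformZ lw1 lu2 lP lv !mulr0 !add0r mulr1.
by rewrite scale0r addr0.
Qed.

Lemma restrict_ext k (R : comNzRingType) (c c' v v' : 'I_k -> R) g :
  c =1 c' -> v =1 v' -> restrict c v g = restrict c' v' g.
Proof.
by move=> hc hv; apply: (rmorph_mmap (phi := idfun)) => // i /=; rewrite hc hv.
Qed.

Lemma horner_restrict k (R : comNzRingType) (c v : 'I_k -> R) g t :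
  (restrict c v g).[t] = g.@[fun i => c i + t * v i].
Proof.
rewrite -[LHS]/(horner_eval t _); apply: rmorph_mmap => [b|i] /=; rewrite /horner_eval.
  by rewrite hornerC.
by rewrite !hornerE mulrC.
Qed.

Lemma exists_lform1 (v : 'rV[K]_3) : v != 0 -> exists l, lform l v = 1.
Proof.
move=> v0; have [|l [lv _]] := @exists_lform _ v 0; last by exists l.
by apply: contra v0 => /vlineP [k ->]; rewrite scaler0.
Qed.

(** [order_geP] reduces this to one direction [v] at a time. If [v] is a multiple of [vP], the
    restriction of [g] is identically zero; any other direction is killed by a form [l] with value 1
    at [vP], and [exists_chart] applies. *)
Lemma curve_order_ge (vP : 'rV[K]_3) (ws : seq 'rV[K]_2) (b : bool) g :
    vP != 0 -> curve_ideal a g -> (0 < size ws)%N ->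
    {in ws, forall w, w != 0 /\ f w \in <[vP]>%VS} ->
    pairwise (fun w w' => det2 w w' != 0) ws ->
    (b -> exists2 w, w \in ws & critical a w) ->
  forall d : 'X_{1..3}, (mdeg d < size ws + b)%N -> g^`M[d].@[vP 0] = 0.
Proof.
move=> vP0 hg ws0 wsP wsU wsC; apply/(order_geP charK) => v'.
have [w wn0 fw] : exists2 w, w != 0 & f w \in <[vP]>%VS.
  case: ws ws0 wsP {wsU wsC} => // w ws _ /(_ w (mem_head _ _)) [wn0 fw].
  by exists w.
pose v : 'rV[K]_3 := \row_i v' i.
have -> : restrict (vP 0) v' g = restrict (vP 0) (v 0) g.
  by apply: restrict_ext => // i; rewrite mxE.
have [/vlineP [k ek]|vN] := boolP (v \in <[vP]>%VS).
  suff -> : restrict (vP 0) (v 0) g = 0 by rewrite dvdp0.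
  (* The excluded parameter is the one where [vP + t v] vanishes; if [k = 0] it is [0], by the
     convention for the inverse, which does no harm. *)
  apply: (@poly_eq0_cofinite _ _ [:: - k^-1]) => t; rewrite inE => tk.
  rewrite horner_restrict.
  transitivity (g.@[((1 + t * k) *: vP) 0]).
    by apply: meval_eq => i; rewrite ek !mxE; ring.
  move/(curve_ideal_vec ha): hg; apply; first exact: wn0.
    case/vlineP: fw => c ec; apply: memvZ; apply/vlineP; exists c^-1.
    have c0 : c != 0.
      by apply: contraNneq (forms_vec_neq0 ha wn0) => c0; rewrite ec c0 scale0r.
    by rewrite ec scalerA mulVf // scale1r.
  rewrite scaler_eq0 (negPf vP0) orbF; apply: contra tk; rewrite addrC addr_eq0 => /eqP tk.
  have k0 : k != 0.
    by apply: contraNneq (oner_neq0 K) => k0; rewrite -oppr_eq0 -tk k0 mulr0.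
  by rewrite -(mulfK k0 t) tk mulN1r.
have [|l [lP lv]] := @exists_lform _ vP v.
  apply: contra vN => /vlineP [k ek]; apply/vlineP; exists k^-1.
  have k0 : k != 0 by apply: contraNneq vP0 => k0; rewrite ek k0 scale0r.
  by rewrite ek scalerA mulVf // scale1r.
have [w0 [w1 [u2 [l1 [l2 [l3 [dw hd hv]]]]]]] := exists_chart lP.
rewrite (hv v lv); apply: (restrict_order_ge charK n_gt1 ha dw hd) => //.
by exists w.
Qed.

Lemma exists_curve_order_le (vP : 'rV[K]_3) (ws : seq 'rV[K]_2) :
    vP != 0 -> (exists2 w, w != 0 & f w \in <[vP]>%VS) ->
    {in ws, forall w, w != 0 /\ f w \in <[vP]>%VS} ->
    (forall w, w != 0 -> f w \in <[vP]>%VS -> exists2 w', w' \in ws & det2 w w' = 0) ->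
    {in ws, forall w, ~ critical a w} ->
  exists g (d : 'X_{1..3}), [/\ curve_ideal a g, (mdeg d <= size ws)%N & g^`M[d].@[vP 0]
    != 0].
Proof.
move=> vP0 vPon wsP wsC wsN.
have [l lP] := exists_lform1 vP0.
have [w0 [w1 [u2 [l1 [l2 [l3 [dw hd hv]]]]]]] := exists_chart lP.
have [g [v [hg ndvd]]] := exists_restrict_ndvdXn charK n_gt1 ha dw hd vPon wsP wsC wsN.
have [[d [ld nz]]|no] := Classical_Prop.classic (exists d : 'X_{1..3}, (mdeg d <= size
  ws)%N /\ g^`M[d].@[vP 0] != 0).
  by exists g, d.
case/negP: ndvd; apply: (order_geP charK g (vP 0) (size ws).+1).2 => d ld; apply/eqP;
  apply: contraT => nz.
by case: no; exists d.
Qed.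

End CurvePoints.

Lemma point_eq_det2 (K : fieldType) (Q Q' : point K 1) :
  Q = Q' <-> det2 (coords Q) (coords Q') = 0.
Proof.
split=> [->|/eqP/(det2_eq0P _ (coords_neq0 Q')) h]; first by rewrite /det2; ring.
by apply: point_inj; rewrite !line_coords; apply: vline_eq (coords_neq0 Q).
Qed.

Section Singularities.
Variables (K : closedFieldType) (charK : [pchar K] =i pred0) (n : nat).
Hypothesis n_gt1 : (1 < n)%N.
Variable a : 'M[K]_(3, n.+1).
Hypothesis ha : proper_param a.
Local Notation f := (forms_vec a).

Let n_gt0 : (0 < n)%N. Proof. exact: ltnW. Qed.

Lemma vpoint_coords m (w : 'rV[K]_m.+1) (w0 : w != 0) :
  exists2 c, c != 0 & coords (vpoint w0) = c *: w.
Proof.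
have : coords (vpoint w0) \in <[w]>%VS by rewrite -[<[w]>%VS]/(line (vpoint w0))
  line_coords memv_line.
case/vlineP=> c ec; exists c => //.
by apply: contraNneq (coords_neq0 (vpoint w0)) => c0; rewrite ec c0 scale0r.
Qed.

Definition critical_point (Q : point K 1) := critical a (coords Q).

Lemma criticalZ c w : c != 0 -> critical a (c *: w) <-> critical a w.
Proof.
move=> c0; split=> [[d d0 dd]|[d d0 dd]]; exists d => //.
  move/eqP: dd; rewrite forms_diffZl scaler_eq0 expf_eq0 (negPf c0) andbF /=.
  by move/eqP.
by rewrite forms_diffZl dd scaler0.
Qed.

Lemma critical_vpoint w (w0 : w != 0) : critical_point (vpoint w0) <-> critical a w.
Proof.
rewrite /critical_point; have [c c0 ->] := vpoint_coords w0; exact: criticalZ.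
Qed.

Lemma param_overP (P : point K 2) Q : param a Q = P <-> f (coords Q) \in <[coords P]>%VS.
Proof. by apply: (param_eqP ha); rewrite ?coords_neq0 // line_coords memv_line. Qed.

Lemma points_of_vectors (ss : seq 'rV[K]_2) (A : point K 1 -> Prop) :
    {in ss, forall w, w != 0} ->
    (forall Q, A Q -> exists2 w, w \in ss & det2 (coords Q) w = 0) ->
  exists qs : seq (point K 1), forall Q, A Q -> Q \in qs.
Proof.
elim: ss A => [|w ss IH] A ss0 sA.
  by exists [::] => Q /sA [].
have [|Q|qs qsP] := IH (fun Q => A Q /\ det2 (coords Q) w != 0).
- by move=> w' w'ss; apply: ss0; rewrite inE w'ss orbT.
- case=> /sA [w']; rewrite inE => /predU1P [->|w'ss] dw; first by rewrite dw eqxx.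
  by exists w'.
have w0 : w != 0 by apply: ss0; rewrite mem_head.
exists (vpoint w0 :: qs) => Q AQ; rewrite inE.
have [dw|dw] := eqVneq (det2 (coords Q) w) 0; last by rewrite qsP ?orbT.
apply/orP; left; apply/eqP/point_inj; rewrite line_coords; apply: vline_eq (coords_neq0 Q).
by apply/(det2_eq0P _ w0); rewrite dw.
Qed.

Lemma fibre_enum (P : point K 2) : on_curve a P ->
  exists qs : seq (point K 1), uniq qs /\ forall Q, Q \in qs <-> param a Q = P.
Proof.
case=> Q0 /param_overP Q0P.
have [l lP] := exists_lform1 (coords_neq0 P).
have [w0 [w1 [u2 [l1 [l2 [l3 [dw hd _]]]]]]] := exists_chart n_gt1 ha lP.
have [ss ss0 ssP] := fibre_finite dw hd.
have [|qs qsP] := points_of_vectors (A := fun Q => param a Q = P) ss0.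
  by move=> Q /param_overP h; apply: ssP; rewrite ?coords_neq0.
exists (undup [seq Q <- qs | param a Q == P]); rewrite undup_uniq; split=> // Q.
rewrite mem_undup mem_filter; split=> [/andP [/eqP]//|h].
by rewrite h eqxx qsP.
Qed.

Lemma critical_enum : exists qs : seq (point K 1), forall Q, critical_point Q -> Q \in qs.
Proof.
pose w : 'rV[K]_2 := \row_i 1.
have w0 : w != 0 by apply/eqP=> /rowP/(_ 0); rewrite !mxE => /eqP; rewrite oner_eq0.
have fw0 := forms_vec_neq0 ha w0; have [l lP] := exists_lform1 fw0.
have [v0 [v1 [u2 [l1 [l2 [l3 [dw hd _]]]]]]] := exists_chart n_gt1 ha lP.
have [|ss ss0 ssP] := critical_finite charK n_gt1 ha dw hd.
  by exists w; rewrite ?memv_line.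
by apply: (points_of_vectors ss0) => Q; apply: ssP; rewrite coords_neq0.
Qed.

Lemma fibre_vectors (P : point K 2) (qs : seq (point K 1)) v :
    v \in line P -> v != 0 -> uniq qs -> {in qs, forall Q, param a Q = P} ->
  {in map (@coords K 1) qs, forall w, w != 0 /\ f w \in <[v]>%VS} /\
  pairwise (fun w w' => det2 w w' != 0) (map (@coords K 1) qs).
Proof.
move=> vP v0 uqs qsP; split=> [_ /mapP [Q /qsP hQ ->]|].
  by rewrite coords_neq0; split=> //; apply/(param_eqP ha Q vP v0).
rewrite pairwise_map; move: uqs; rewrite uniq_pairwise.
apply: sub_pairwise => Q Q' /=; apply: contraNneq => h; apply/eqP.
exact/point_eq_det2.
Qed.

Lemma order_ge_vanishes (P : point K 2) (qs : seq (point K 1)) (b : bool) g :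
    curve_ideal a g -> (0 < size qs)%N -> uniq qs ->
    {in qs, forall Q, param a Q = P} ->
    (b -> exists2 Q, Q \in qs & critical_point Q) ->
  forall d : 'X_{1..3}, (mdeg d < size qs + b)%N -> vanishes_at g^`M[d] P.
Proof.
move=> hg qs0 uqs qsP qsC d ld v vP v0.
have [wsP wsU] := fibre_vectors vP v0 uqs qsP.
apply: (curve_order_ge charK n_gt1 ha (ws := map (@coords K 1) qs) (b := b)) => //.
- by rewrite size_map.
- by move=> hb; have [Q Qqs cQ] := qsC hb; exists (coords Q); rewrite ?map_f.
- by rewrite size_map.
Qed.

Lemma exists_order_le (P : point K 2) (qs : seq (point K 1)) : on_curve a P ->
    (forall Q, Q \in qs <-> param a Q = P) -> {in qs, forall Q, ~ critical_point Q} ->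
  exists g (d : 'X_{1..3}),
    [/\ curve_ideal a g, (mdeg d <= size qs)%N & ~ vanishes_at g^`M[d] P].
Proof.
move=> [Q0 hQ0] qsP qsN.
have [|||||g [d [hg ld nz]]] := exists_curve_order_le charK n_gt1 ha
    (vP := coords P) (ws := map (@coords K 1) qs).
- exact: coords_neq0.
- by exists (coords Q0); [exact: coords_neq0 | apply/param_overP].
- move=> _ /mapP [Q Qqs ->]; rewrite coords_neq0; split=> //.
  by apply/param_overP/qsP.
- move=> w w0 fw; have [c c0 ec] := vpoint_coords w0.
  exists (coords (vpoint w0)); last by rewrite ec /det2 !mxE; ring.
  by apply/map_f/qsP/param_overP; rewrite ec forms_vecZ memvZ.
- by move=> _ /mapP [Q Qqs ->]; apply: qsN.
exists g, d; rewrite size_map in ld; split=> // h; move/negP: nz; apply; apply/eqP.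
by apply: h; rewrite ?coords_neq0 // line_coords memv_line.
Qed.

Lemma singular_of_order (P : point K 2) : on_curve a P ->
  (forall g, curve_ideal a g ->
     forall d : 'X_{1..3}, (mdeg d < 2)%N -> vanishes_at g^`M[d] P) ->
  singular a P.
Proof.
move=> onP h; split=> // g hg i; rewrite -mderivmU1m; apply: h => //.
by rewrite mdeg1.
Qed.

(** Two preimages give every element of the ideal of the curve order at least 2. *)
Lemma singular_of_two_preimages (P : point K 2) Q Q' :
  param a Q = P -> param a Q' = P -> Q <> Q' -> singular a P.
Proof.
move=> hQ hQ' ne; apply: singular_of_order; first by exists Q.
move=> g hg d ld; apply: (order_ge_vanishes (qs := [:: Q; Q']) (b := false)) => //.
- by rewrite /= inE andbT; apply/eqP.
- by move=> R; rewrite !inE => /orP [] /eqP ->.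
Qed.

(** A critical preimage counts twice in the order of vanishing. *)
Lemma singular_of_critical (P : point K 2) Q :
  param a Q = P -> critical_point Q -> singular a P.
Proof.
move=> hQ cQ; apply: singular_of_order; first by exists Q.
move=> g hg d ld; apply: (order_ge_vanishes (qs := [:: Q]) (b := true)) => //.
- by move=> R; rewrite !inE => /eqP ->.
- by move=> _; exists Q; rewrite ?mem_head.
Qed.

(** If the only preimage were not critical, [exists_order_le] would give an element of the ideal
    with a nonvanishing derivative of order at most 1. Order 0 is excluded because [P] is on the
    curve, order 1 because it is singular. *)
Lemma critical_of_singular (P : point K 2) Q :
  singular a P -> param a Q = P -> (forall Q', param a Q' = P -> Q = Q') ->
  critical_point Q.
Proof.
move=> [onP sP] hQ uQ; apply: Classical_Prop.NNPP => nc.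
have [||g [d [hg ld nz]]] := exists_order_le (qs := [:: Q]) onP.
- by move=> Q'; rewrite inE; split=> [/eqP ->//|/uQ ->].
- by move=> Q'; rewrite inE => /eqP ->.
apply: nz; move: ld; rewrite leq_eqVlt ltnS leqn0 => /orP [|]; last first.
  rewrite mdeg_eq0 => /eqP ->; rewrite mderivm0m => v vP v0.
  by apply: (hg P) => //; exists Q.
rewrite mdeg_eq1 => /existsP [i /eqP ->]; rewrite mderivmU1m; exact: sP.
Qed.

Lemma multiplicity_ge (P : point K 2) (qs : seq (point K 1)) (b : bool) m :
    (0 < size qs)%N -> uniq qs -> {in qs, forall Q, param a Q = P} ->
    (b -> exists2 Q, Q \in qs & critical_point Q) ->
  multiplicity a P m -> (size qs + b <= m)%N.
Proof.
move=> qs0 uqs qsP qsC [_ [g [d [hg dm nz]]]]; rewrite leqNgt; apply/negP=> lt_m.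
rewrite -dm in lt_m; apply: nz; exact: (order_ge_vanishes hg qs0 uqs qsP qsC lt_m).
Qed.

Lemma multiplicity_fibre (P : point K 2) (qs : seq (point K 1)) : on_curve a P ->
    uniq qs -> (forall Q, Q \in qs <-> param a Q = P) ->
    {in qs, forall Q, ~ critical_point Q} ->
  multiplicity a P (size qs).
Proof.
move=> onP uqs qsP qsN.
have qs0 : (0 < size qs)%N.
  by case: onP => Q /qsP; case: (qs).
have ge g : curve_ideal a g ->
    forall d : 'X_{1..3}, (mdeg d < size qs)%N -> vanishes_at g^`M[d] P.
  move=> hg d ld; apply: (order_ge_vanishes (qs := qs) (b := false)) => //.
    by move=> Q /qsP.
  by rewrite addn0.
split=> //; have [g [d [hg ld nz]]] := exists_order_le onP qsP qsN.
exists g, d; split=> //; apply/eqP; rewrite eqn_leq ld leqNgt; apply/negP=> lt_d.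
exact/nz/ge.
Qed.

End Singularities.

Lemma row'_mul (R : pzRingType) m n p (k : 'I_m) (A : 'M[R]_(m, n)) (B : 'M[R]_(n, p)) :
  row' k (A *m B) = row' k A *m B.
Proof. by apply/matrixP=> i j; rewrite !mxE; apply: eq_bigr => l _; rewrite !mxE. Qed.

Lemma cramer (R : comNzRingType) n (A : 'M[R]_n) (b : 'cV[R]_n) j :
  (\adj A *m b) j 0 = \det (\matrix_(i, l) if l == j then b i 0 else A i l).
Proof.
rewrite (expand_det_col _ j) mxE; apply: eq_bigr => i _.
rewrite !mxE eqxx mulrC; congr (_ * _); rewrite /cofactor; congr (_ * \det _).
by apply/matrixP=> x y; rewrite !mxE eq_sym (negPf (neq_lift _ _)).
Qed.

Lemma det_mul_coord (R : comNzRingType) n (A : 'M[R]_n) (z b : 'cV[R]_n) j :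
  A *m z = b -> \det A * z j 0 = (\adj A *m b) j 0.
Proof. by move=> <-; rewrite mulmxA mul_adj_mx mul_scalar_mx mxE. Qed.

(** * Maximal minors to first order *)

Section Minors.
Variables (K : fieldType) (m : nat).
Implicit Types (M D : 'M[K]_(m.+1, m)) (z : 'cV[K]_m).

Lemma col_neq0 z : z != 0 -> exists j, z j 0 != 0.
Proof.
move=> z0; apply/existsP; apply: contraNT z0 => /existsPn h; apply/eqP/colP=> j.
by rewrite mxE; apply/eqP; rewrite -[_ == _]negbK h.
Qed.

(** Some nonzero row [w] kills [M] from the left. If [w] is nonzero at [k], then row [k] is a
    combination of the others, and a kernel vector of [row' k M] is killed by the whole of [M]. *)
Lemma minors_eq0P M : (forall k, \det (row' k M) = 0) <-> exists2 z : 'cV[K]_m, z != 0 &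
  M *m z = 0.
Proof.
split=> [h|[z /col_neq0 [j zj] Mz] k]; last first.
  have Mkz : row' k M *m z = 0.
    by rewrite -row'_mul Mz; apply/matrixP=> x y; rewrite !mxE.
  apply/eqP; have /eqP := det_mul_coord j Mkz; rewrite mulmx0 [X in _ == X]mxE.
  by rewrite mulf_eq0 (negPf zj) orbF.
have [w w0 wM] : exists2 w : 'rV[K]_m.+1, w != 0 & w *m M = 0 :> 'rV_m.
  have : kermx M != 0.
    rewrite -mxrank_eq0 mxrank_ker -lt0n subn_gt0 ltnS; exact: rank_leq_col.
  case/rowV0Pn=> w /sub_kermxP wM w0; by exists w.
have [k wk] := rV0Pn _ w0.
have /eqP := h k; rewrite -det_tr => /det0P [y y0 yM]; exists y^T.
  by rewrite -(inj_eq trmx_inj) trmxK trmx0.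
have Mk i : i != k -> (M *m y^T) i 0 = 0.
  move=> ik; have [i' ->] : exists i', i = lift k i'.
    by case: (unliftP k i) ik => [i' ->|->]; [exists i'|rewrite eqxx].
  have /matrixP/(_ i' 0) : row' k M *m y^T = 0.
    by apply: trmx_inj; rewrite trmx_mul trmxK yM trmx0.
  by rewrite -row'_mul !mxE.
apply/colP=> i; rewrite [RHS]mxE; have [->|/Mk //] := eqVneq i k.
have /matrixP/(_ 0 0) : w *m (M *m y^T) = 0 by rewrite mulmxA wM mul0mx.
rewrite [LHS]mxE [RHS]mxE (bigD1 k) //= big1 ?addr0 => [|l /Mk ->]; last by rewrite mulr0.
by move/eqP; rewrite mulf_eq0 (negPf wk) => /eqP.
Qed.

Definition pencil M D : 'M[{poly K}]_(m.+1, m) := map_mx polyC M + 'X *: map_mx polyC D.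

(** The pencil kills [z + X z'] modulo ['X^2]. By Cramer's rule each minor times coordinate [j] of
    this vector is divisible by ['X^2], and that coordinate is nonzero at [0]. *)
Lemma first_order_minors M D z z' : z != 0 -> M *m z = 0 -> M *m z' + D *m z = 0 ->
  forall k, 'X^2 %| \det (row' k (pencil M D)).
Proof.
move=> /col_neq0 [j zj] Mz e k.
pose zeta := map_mx polyC z + 'X *: map_mx polyC z'.
have pz : pencil M D *m zeta = 'X^2 *: map_mx polyC (D *m z').
  rewrite /pencil /zeta mulmxDl !mulmxDr -!scalemxAl -!scalemxAr -!map_mxM Mz.
  rewrite scalerA map_mx0 add0r addrA -scalerDr -map_mxD e map_mx0 scaler0 add0r.
  by rewrite expr2.
have := @det_mul_coord _ _ (row' k (pencil M D)) zeta _ j erefl.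
rewrite -row'_mul pz => eq_det.
have : 'X^2 %| \det (row' k (pencil M D)) * zeta j 0.
  rewrite eq_det (_ : row' k ('X^2 *: _) = 'X^2 *: row' k (map_mx polyC (D *m z'))).
    by rewrite -scalemxAr mxE dvdp_mulr.
  by apply/matrixP=> x y; rewrite !mxE.
rewrite Gauss_dvdpl // coprimep_expl // coprimep_sym coprimepX.
by rewrite !mxE /root !hornerE.
Qed.

Lemma mul_replace_col M (b : 'cV[K]_m.+1) j (y : 'cV[K]_m) :
  (\matrix_(i, l) if l == j then b i 0 else M i l) *m y
  = M *m (\col_i if i == j then 0 else y i 0) + y j 0 *: b.
Proof.
apply/colP=> i; rewrite !mxE (bigD1 j) // [in RHS](bigD1 j) //= !mxE eqxx mulr0 add0r.
rewrite addrC mulrC; congr (_ + _).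
by apply: eq_bigr => x /negPf xj; rewrite !mxE xj.
Qed.

(** By Cramer's rule a minor of the pencil times [z j 0] is ['X] times the minor with column [j]
    replaced by [D *m z]. So the replaced minors vanish at [0], which gives a kernel vector [y] of
    [M']. If [y j 0] were zero, the rest of [y] would be in the kernel of [M], hence a multiple of
    [z] with zero coordinate [j], that is zero; so [y j 0] can be divided by. *)
Lemma first_order_solution M D z : z != 0 -> M *m z = 0 ->
    (forall y, M *m y = 0 -> exists t, y = t *: z) ->
    (forall k, 'X^2 %| \det (row' k (pencil M D))) ->
  exists z', M *m z' + D *m z = 0.
Proof.
move=> /col_neq0 [j zj] Mz kerM h.
pose M' : 'M[K]_(m.+1, m) := \matrix_(i, l) if l == j then (D *m z) i 0 else M i l.
have /minors_eq0P [y /col_neq0 [l yl] M'y] : forall k, \det (row' k M') = 0.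
  move=> k.
  have pz : pencil M D *m map_mx polyC z = 'X *: map_mx polyC (D *m z).
    by rewrite /pencil mulmxDl -scalemxAl -!map_mxM Mz map_mx0 add0r.
  have := @det_mul_coord _ _ (row' k (pencil M D)) (map_mx polyC z) _ j erefl.
  rewrite -row'_mul pz (_ : row' k ('X *: _) = 'X *: row' k (map_mx polyC (D *m z)));
    last first.
    by apply/matrixP=> x y; rewrite !mxE.
  rewrite -scalemxAr [RHS]mxE cramer => eq_det.
  have : 'X %| \det (\matrix_(i, l) if l == j then row' k (map_mx polyC (D *m z)) i 0
                                    else row' k (pencil M D) i l).
    rewrite -(@dvdp_mul2l _ 'X) ?polyX_eq0 // -expr2 -eq_det dvdp_mulr //.
  rewrite -['X]subr0 dvdp_XsubCl => /rootP.
  rewrite -[LHS]/(horner_eval 0 _) -det_map_mx; apply: etrans; congr (\det _).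
  apply/matrixP=> x y; rewrite !mxE /= /horner_eval.
  by case: ifP => _; rewrite ?hornerC // !hornerE.
pose y' := \col_i (if i == j then 0 else y i 0).
have My' : M *m y' + y j 0 *: (D *m z) = 0.
  by rewrite -mul_replace_col.
have yj : y j 0 != 0.
  apply/eqP=> yj; rewrite yj scale0r addr0 in My'.
  have [t ey'] := kerM y' My'.
  have t0 : t = 0.
    have /colP/(_ j) := ey'; rewrite !mxE eqxx => /esym/eqP.
    by rewrite mulf_eq0 (negPf zj) orbF => /eqP.
  have /colP/(_ l) := ey'; rewrite t0 scale0r !mxE; case: eqP => [lj|_ yl0].
    by move: yl; rewrite lj yj eqxx.
  by rewrite yl0 eqxx in yl.
exists ((y j 0)^-1 *: y'); apply: (scalerI yj).
by rewrite scalerDr -scalemxAr scalerA divff // scale1r My' scaler0.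
Qed.

End Minors.

(** * Points of X_2 *)

Section Quadratics.
Variable K : closedFieldType.
Implicit Types (c v : 'rV[K]_3) (s w d : 'rV[K]_2).

Definition quad c s := c 0 o0 * s 0 0 ^+ 2 + c 0 o1 * (s 0 0 * s 0 1) + c 0 o2 * s 0 1 ^+ 2.

Definition quad_diff c s d := 2%:R * c 0 o0 * s 0 0 * d 0 0
  + c 0 o1 * (s 0 0 * d 0 1 + d 0 0 * s 0 1) + 2%:R * c 0 o2 * s 0 1 * d 0 1.

(* The coefficients of the quadratic form vanishing at the points [w] and [w'] of
   [P^1]. *)
Definition pair_form w w' : 'rV[K]_3 := \row_i
  if val i == 0%N then w 0 1 * w' 0 1
  else if val i == 1%N then - (w 0 1 * w' 0 0 + w 0 0 * w' 0 1) else w 0 0 * w' 0 0.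

Lemma rowP3 c v : c 0 o0 = v 0 o0 -> c 0 o1 = v 0 o1 -> c 0 o2 = v 0 o2 -> c = v.
Proof. by move=> h0 h1 h2; apply/rowP=> i; case: (ord3P i) => ->. Qed.

Lemma quad_pair_form w w' s : quad (pair_form w w') s = det2 w s * det2 w' s.
Proof. by rewrite /quad /det2 !mxE /=; ring. Qed.

Lemma quad_diff_pair_form w w' s d :
  quad_diff (pair_form w w') s d = det2 w d * det2 w' s + det2 w s * det2 w' d.
Proof. by rewrite /quad_diff /det2 !mxE /=; ring. Qed.

Lemma quadD c v s : quad (c + v) s = quad c s + quad v s.
Proof. by rewrite /quad !mxE; ring. Qed.

Lemma quadZ k c s : quad (k *: c) s = k * quad c s.
Proof. by rewrite /quad !mxE; ring. Qed.

Lemma pair_formC w w' : pair_form w w' = pair_form w' w.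
Proof. by apply: rowP3; rewrite !mxE /=; ring. Qed.

Lemma pair_formZr k w w' : pair_form w (k *: w') = k *: pair_form w w'.
Proof. by apply: rowP3; rewrite !mxE /=; ring. Qed.

Lemma pair_formZl k w w' : pair_form (k *: w) w' = k *: pair_form w w'.
Proof. by rewrite pair_formC pair_formZr pair_formC. Qed.

Lemma quad_root_factor c w : w != 0 -> quad c w = 0 -> exists w', c = pair_form w w'.
Proof.
move=> /row2_neq0 [h|h] q0.
  exists (\row_i if i == 0 then c 0 o2 / w 0 0 else - (c 0 o1 + w 0 1 * (c 0 o2 / w 0 0))
    / w 0 0).
  apply: rowP3; rewrite !mxE /=; [|by field|by field].
  apply: (mulfI (expf_neq0 2 h)); apply/eqP; rewrite -subr_eq0; apply/eqP.
  by rewrite -[RHS]q0 /quad; field.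
exists (\row_i if i == 1 then c 0 o0 / w 0 1 else - (c 0 o1 + w 0 0 * (c 0 o0 / w 0 1)) /
  w 0 1).
apply: rowP3; rewrite !mxE /=; [by field|by field|].
apply: (mulfI (expf_neq0 2 h)); apply/eqP; rewrite -subr_eq0; apply/eqP.
by rewrite -[RHS]q0 /quad; field.
Qed.

Lemma exists_pair_form c : c != 0 -> exists w w', [/\ w != 0, w' != 0 & c = pair_form w w'].
Proof.
move=> c0; suff [w w0 qw] : exists2 w, w != 0 & quad c w = 0.
  have [w' ec] := quad_root_factor w0 qw; exists w, w'; split=> //.
  apply: contraNneq c0 => w'0; rewrite ec w'0; apply/eqP.
  by apply: rowP3; rewrite !mxE /= !mulr0 ?addr0 ?oppr0.
have [c2|c2] := eqVneq (c 0 o2) 0.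
  exists (\row_i (i == 1)%:R); last by rewrite /quad !mxE /= c2; ring.
  by apply/eqP=> /rowP/(_ 1); rewrite !mxE => /eqP; rewrite oner_eq0.
pose p := (c 0 o0)%:P + c 0 o1 *: 'X + c 0 o2 *: 'X^2.
have /closed_rootP [x /rootP px] : size p != 1%N.
  have p2 : p`_2 != 0.
    by rewrite /p !coefD coefC !coefZ coefX coefXn /= mulr0 !add0r mulr1.
  rewrite neq_ltn; apply/orP; right; rewrite ltnNge; apply: contra p2 => sz.
  by rewrite nth_default // (leq_trans sz).
exists (\row_i if i == 0 then 1 else x).
  by apply/eqP=> /rowP/(_ 0); rewrite !mxE => /eqP; rewrite oner_eq0.
by rewrite -px /quad /p !hornerE !mxE /=; ring.
Qed.

(** The form is nonzero at any [y] distinct from both points; if [x] avoids only [w] and [z] only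
    [w'], then [x + z] avoids both. *)
Lemma pair_form_neq0 w w' : w != 0 -> w' != 0 -> pair_form w w' != 0.
Proof.
move=> w0 w'0; have [x dx] := det2_complete w0.
have [dx'|dx'] := eqVneq (det2 x w') 0.
  apply/eqP=> e.
  have [y [dy dy']] : exists y, det2 y w != 0 /\ det2 y w' != 0.
    have [z dz] := det2_complete w'0.
    have [dzw|dzw] := eqVneq (det2 z w) 0; last by exists z.
    exists (x + z); have -> y : det2 (x + z) y = det2 x y + det2 z y by rewrite /det2
      !mxE; ring.
    have -> : det2 (x + z) w' = det2 x w' + det2 z w' by rewrite /det2 !mxE; ring.
    by rewrite dzw addr0 dx' add0r.
  have := quad_pair_form w w' y; rewrite e (det2C w) (det2C w') mulrNN.
  have -> : quad 0 y = 0 by rewrite /quad !mxE !mul0r !addr0.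
  by move/esym/eqP; rewrite mulf_eq0 (negPf dy) (negPf dy').
apply/eqP=> e; have := quad_pair_form w w' x; rewrite e (det2C w) (det2C w') mulrNN.
have -> : quad 0 x = 0 by rewrite /quad !mxE !mul0r !addr0.
by move/esym/eqP; rewrite mulf_eq0 (negPf dx) (negPf dx').
Qed.

Lemma quad_two_roots v w w' : det2 w w' != 0 -> quad v w = 0 -> quad v w' = 0 ->
  exists k, v = k *: pair_form w w'.
Proof.
move=> dw q q'; have [x ev] := quad_root_factor (det2_neq0l dw) q.
move: q'; rewrite ev quad_pair_form => /eqP; rewrite mulf_eq0 (negPf dw) /=.
move/(det2_eq0P _ (det2_neq0r dw))/vlineP => [k ->].
by exists k; rewrite pair_formZr.
Qed.

(** Lagrange interpolation by squares of linear forms: each vanishes at one point and has value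
    [det2 w w' ^+ 2] at the other. *)
Lemma quad_interpolate w w' x y : det2 w w' != 0 -> exists v, quad v w = x /\ quad v w' = y.
Proof.
move=> dw; exists ((x / det2 w w' ^+ 2) *: pair_form w' w' + (y / det2 w w' ^+ 2) *:
  pair_form w w).
have d0 u : det2 u u = 0 by rewrite /det2; ring.
split; rewrite quadD !quadZ !quad_pair_form !d0 ?(det2C w' w);
  by field.
Qed.

End Quadratics.

(** * The kernel of the upper rows of [M2] *)

Section Hankel.
Variables (K : closedFieldType) (charK : [pchar K] =i pred0) (n : nat).
Hypothesis n_gt1 : (1 < n)%N.
Implicit Types (c v : 'rV[K]_3) (s w d : 'rV[K]_2) (z : 'cV[K]_n.+1).

Definition hankel_row c z (i : nat) :=
  c 0 o0 * z (inord i) 0 + c 0 o1 * z (inord i.+1) 0 + c 0 o2 * z (inord i.+2) 0.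

(** The upper rows of [M2] at [c]. On columns they encode the linear recurrence with coefficients
    [c]; on rows, multiplication by the quadratic polynomial with coefficients [c]. *)
Definition hankel_mx c : 'M[K]_(n.-1, n.+1) :=
  \matrix_(i, j) if (i <= j <= i.+2)%N then c 0 (inord (j - i)) else 0.

Lemma hankel_sum c z (i : nat) : (i < n.-1)%N ->
  \sum_(j < n.+1) (if (i <= j <= i.+2)%N then c 0 (inord (j - i)) else 0) * z j 0 =
    hankel_row c z i.
Proof.
move=> lt_i; have lt2 : (i.+2 < n.+1)%N by rewrite !ltnS; case: (n) n_gt1 lt_i.
have lt1 : (i.+1 < n.+1)%N := ltnW lt2; have lt0 : (i < n.+1)%N := ltnW lt1.
pose j0 : 'I_n.+1 := inord i; pose j1 : 'I_n.+1 := inord i.+1;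
  pose j2 : 'I_n.+1 := inord i.+2.
have e0 : j0 = i :> nat by rewrite inordK.
have e1 : j1 = i.+1 :> nat by rewrite inordK.
have e2 : j2 = i.+2 :> nat by rewrite inordK.
have ne10 : j1 != j0 by rewrite -val_eqE /= e0 e1 eqn_leq ltnn.
have ne20 : j2 != j0 by rewrite -val_eqE /= e0 e2 eqn_leq ltnNge leqnSn.
have ne21 : j2 != j1 by rewrite -val_eqE /= e1 e2 eqn_leq ltnn.
rewrite (bigD1 j0) //= (bigD1 j1) //= (bigD1 j2) /=; last by rewrite ne20.
rewrite big1 ?addr0; last first.
  move=> j /andP [/andP [n0 n1'] n2']; case: ifP => [/andP [le1 le2]|];
    last by rewrite mul0r.
  case/negP: n2'; rewrite -val_eqE /= e2.
  move: n0 n1'; rewrite -!val_eqE /= e0 e1 => n0 n1'.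
  by rewrite eqn_leq le2 /= ltn_neqAle eq_sym n1' /= ltn_neqAle eq_sym n0.
rewrite /hankel_row addrA -/j0 -/j1 -/j2 e0 e1 e2 !leqnn !leqnSn ?(leqW (leqnSn i)).
rewrite subnn subSnn (_ : (i.+2 - i = 2)%N); last by rewrite -addn2 addKn.
have i0 : inord 0 = o0 by apply: val_inj; rewrite /= inordK.
have i1 : inord 1 = o1 by apply: val_inj; rewrite /= inordK.
have i2 : inord 2 = o2 by apply: val_inj; rewrite /= inordK.
by rewrite i0 i1 i2.
Qed.

Lemma hankel_mulE c z i : (hankel_mx c *m z) i 0 = hankel_row c z i.
Proof.
rewrite mxE -(hankel_sum _ _ (ltn_ord i)).
by apply: eq_bigr => j _; rewrite mxE.
Qed.

Let i_bounds i : (i < n.-1)%N -> (i.+2 <= n)%N.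
Proof. by case: (n) n_gt1. Qed.

Let sub1 i : (i.+2 <= n)%N -> (n - i.+1 = (n - i.+2).+1)%N.
Proof. by move=> h; rewrite -subSn. Qed.

Let sub2 i : (i.+2 <= n)%N -> (n - i = (n - i.+2).+2)%N.
Proof. by move=> h; rewrite -sub1 // -subSn // ltnW. Qed.

Lemma hankel_veronese c s i : (i < n.-1)%N ->
  hankel_row c (veronese_vec n s)^T i = quad c s * (s 0 0 ^+ (n - i.+2) * s 0 1 ^+ i).
Proof.
move=> /i_bounds le_i;
  rewrite /hankel_row !mxE !inordK ?ltnS ?(ltnW le_i) ?(leq_trans (leqnSn _) (ltnW le_i))
    //.
rewrite (sub2 le_i).
rewrite (sub1 le_i).
by rewrite /quad !exprS; ring.
Qed.

(** The identity of [hankel_veronese] is differentiated along [s + t d] at [t = 0]; the other term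
    of the product rule vanishes because [quad c s = 0]. *)
Lemma hankel_veronese_diff c s d i : (i < n.-1)%N -> quad c s = 0 ->
  hankel_row c (veronese_diff n s d)^T i = quad_diff c s d * (s 0 0 ^+ (n - i.+2) * s 0 1
    ^+ i).
Proof.
move=> /[dup] lt_i /i_bounds le_i qs.
pose P j := veronese_poly n s d j.
have dP (j : 'I_n.+1) : (veronese_diff n s d) 0 j = (P j)^`().[0].
  by rewrite horner_deriv_veronese_poly scale0r addr0.
pose Q : {poly K} := c 0 o0 *: line_poly s d 0 ^+ 2 + c 0 o1 *: (line_poly s d 0 *
  line_poly s d 1)
   + c 0 o2 *: line_poly s d 1 ^+ 2.
have PQ : c 0 o0 *: P i + c 0 o1 *: P i.+1 + c 0 o2 *: P i.+2
    = Q * (line_poly s d 0 ^+ (n - i.+2) * line_poly s d 1 ^+ i).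
  rewrite /P /veronese_poly /Q.
  rewrite (sub2 le_i).
  rewrite (sub1 le_i).
  by rewrite -!mul_polyC !exprS; ring.
have l0 k : (line_poly s d k).[0] = s 0 k by rewrite horner_line_poly scale0r addr0.
have dl k : (line_poly s d k)^`() = (d 0 k)%:P.
  by rewrite derivD derivC add0r derivZ derivX alg_polyC.
have := congr1 (fun p => p^`().[0]) PQ.
rewrite derivM hornerD !hornerM !horner_exp !l0 [Q.[0]](_ : _ = 0); last first.
  by rewrite -[RHS]qs /Q /quad !(hornerE, horner_exp, l0).
rewrite mul0r addr0 (_ : Q^`().[0] = quad_diff c s d); last first.
  rewrite /Q !derivD !derivZ derivM !deriv_exp !dl !(hornerE, horner_exp, hornerMn, l0) /=.
  by rewrite /quad_diff; ring.
move=> <-; rewrite !derivD !derivZ !hornerD !hornerZ /hankel_row.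
have lt2 : (i.+2 < n.+1)%N by rewrite ltnS.
have lt1 := ltnW lt2; have lt0 := ltnW lt1.
by rewrite ![_^T _ _]mxE !dP !inordK.
Qed.

(** A row [u] times this matrix lists the coefficients of the product of the polynomials of [u] and
    [c], and polynomials over a field have no zero divisors. *)
Lemma hankel_row_free c : c != 0 -> row_free (hankel_mx c).
Proof.
move=> c0; apply: inj_row_free => u uM.
pose q : {poly K} := \poly_(k < 3) c 0 (inord k).
have q0 : q != 0.
  apply: contraNneq c0 => q0; apply/eqP/rowP=> i; rewrite mxE.
  by have := congr1 (fun p : {poly K} => p`_i) q0;
    rewrite coef_poly ltn_ord inord_val coef0.
have uE : rVpoly u = \sum_i u 0 i *: 'X^i.
  rewrite {1}[u]row_sum_delta linear_sum; apply: eq_bigr => i _.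
  by rewrite linearZ /= rVpoly_delta.
have uq : rVpoly u * q = 0.
  apply/polyP=> j; rewrite coef0.
  have [lt_j|le_j] := ltnP j n.+1; last first.
    rewrite nth_default // (leq_trans (size_polyMleq _ _)) // (leq_trans _ le_j) //.
    have su : (size (rVpoly u) <= n.-1)%N by exact: size_poly.
    have sq : (size q <= 3)%N by exact: size_poly.
    have := leq_sub2r 1 (leq_add su sq); rewrite !subn1 => /leq_trans; apply.
    by case: (n) n_gt1 => // n' _; rewrite /= addn3.
  have /rowP/(_ (Ordinal lt_j)) := uM; rewrite !mxE => uMj; rewrite -[RHS]uMj.
  rewrite uE mulr_suml coef_sum; apply: eq_bigr => i _.
  rewrite mxE -scalerAl coefZ coefXnM coef_poly /=; congr (_ * _).
  case: (ltnP j i) => //= le_ij.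
  by rewrite ltnS leq_subLR addn2.
move/eqP: uq; rewrite mulf_eq0 (negPf q0) orbF => /eqP u0.
by rewrite -[u]rVpolyK u0 linear0.
Qed.

(** The rank is [n - 1] by [hankel_row_free], so the kernel has dimension 2. *)
Lemma hankel_kernel c z1 z2 : c != 0 -> hankel_mx c *m z1 = 0 -> hankel_mx c *m z2 = 0 ->
    (forall x y, x *: z1 + y *: z2 = 0 -> x = 0 /\ y = 0) ->
  forall z, hankel_mx c *m z = 0 -> exists x y, z = x *: z1 + y *: z2.
Proof.
move=> c0 h1 h2 indep z hz.
pose B := col_mx z1^T z2^T.
have kerT y : hankel_mx c *m y = 0 -> (y^T <= kermx (hankel_mx c)^T)%MS.
  by move=> hy; apply/sub_kermxP; rewrite -trmx_mul hy trmx0.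
have mulB (u : 'rV_(1 + 1)) : u *m B = (lsubmx u 0 0 *: z1 + rsubmx u 0 0 *: z2)^T.
  rewrite -{1}[u]hsubmxK mul_row_col linearD /= !linearZ /=.
  by rewrite {1}[lsubmx u]mx11_scalar {1}[rsubmx u]mx11_scalar !mul_scalar_mx.
have freeB : row_free B.
  apply: inj_row_free => u; rewrite mulB -[RHS]trmx0 => /trmx_inj/indep [x0 y0].
  by rewrite -[u]hsubmxK [lsubmx u]mx11_scalar [rsubmx u]mx11_scalar x0 y0 !raddf0 row_mx0.
have subB : (B <= kermx (hankel_mx c)^T)%MS by rewrite col_mx_sub !kerT.
have eqB : (B == kermx (hankel_mx c)^T)%MS.
  rewrite -(geq_leqif (mxrank_leqif_eq subB)) mxrank_ker mxrank_tr.
  rewrite (eqP (hankel_row_free c0)) (eqP freeB).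
  by case: (n) n_gt1 => // n' _; rewrite /= -addn2 addKn.
have : (z^T <= B)%MS by rewrite (eqmxP eqB) kerT.
case/submxP=> u; rewrite mulB => /trmx_inj ->.
by exists (lsubmx u 0 0), (rsubmx u 0 0).
Qed.

(** Eliminating [y] between consecutive coordinates leaves [x] times [det2 u u'] times a monomial of
    degree [n - 1] in [u]; one of the two pure powers among these monomials is nonzero. *)
Lemma veronese_indep w w' : det2 w w' != 0 ->
  forall x y, x *: (veronese_vec n w)^T + y *: (veronese_vec n w')^T = 0 -> x = 0 /\ y = 0.
Proof.
have gen u u' x y : det2 u u' != 0 ->
    x *: (veronese_vec n u)^T + y *: (veronese_vec n u')^T = 0 -> x = 0.
  move=> du /colP e.
  have E (j : nat) : (j < n)%N -> x * (u 0 0 ^+ (n.-1 - j) * u 0 1 ^+ j) = 0.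
    move=> lt_j.
    have h0 : x * (u 0 0 ^+ (n.-1 - j) * u 0 1 ^+ j) * u 0 0
            + y * (u' 0 0 ^+ (n.-1 - j) * u' 0 1 ^+ j) * u' 0 0 = 0.
      have := e (inord j); rewrite !mxE inordK ?(leq_trans lt_j) //.
      have -> : (n - j = (n.-1 - j).+1)%N.
        by rewrite -subSn; [rewrite prednK // ltnW|rewrite -ltnS prednK // ltnW].
      by move=> <-; rewrite !exprS; ring.
    have h1 : x * (u 0 0 ^+ (n.-1 - j) * u 0 1 ^+ j) * u 0 1
            + y * (u' 0 0 ^+ (n.-1 - j) * u' 0 1 ^+ j) * u' 0 1 = 0.
      have := e (inord j.+1); rewrite !mxE inordK ?ltnS //.
      have -> : (n - j.+1 = n.-1 - j)%N by rewrite -subn1 -subnDA add1n.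
      by move=> <-; rewrite !exprS; ring.
    apply: (mulIf du); rewrite mul0r /det2.
    move: h0 h1; set X := x * _; set Y := y * _ => h0 h1.
    have -> : X * (u 0 0 * u' 0 1 - u 0 1 * u' 0 0) =
       (X * u 0 0 + Y * u' 0 0) * u' 0 1 - (X * u 0 1 + Y * u' 0 1) * u' 0 0 by ring.
    by rewrite h0 h1 !mul0r subr0.
  case: (row2_neq0 (det2_neq0l du)) => h.
    have /eqP := E 0%N (ltnW n_gt1);
      rewrite expr0 mulr1 mulf_eq0 expf_eq0 (negPf h) andbF orbF.
    by move/eqP.
  have lt1 : (n.-1 < n)%N by rewrite prednK // ltnW.
  have /eqP := E n.-1 lt1; rewrite subnn expr0 mul1r mulf_eq0 expf_eq0 (negPf h) andbF orbF.
  by move/eqP.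
move=> dw x y e; split; first exact: gen dw e.
have dw' : det2 w' w != 0 by rewrite det2C oppr_eq0.
rewrite addrC in e; exact: gen dw' e.
Qed.

(** The Veronese map is an immersion: the first two or the last two coordinates suffice, since [n]
    is nonzero in [K]. *)
Lemma veronese_diff_indep w : w != 0 ->
  forall d, veronese_diff n w d = 0 -> d = 0.
Proof.
move=> w0 d /rowP e.
have nn0 : n%:R != 0 :> K by rewrite (pcharf0P _).1 // -lt0n ltnW.
have n1 : (n.-1).+1 = n by rewrite prednK // ltnW.
case: (row2_neq0 w0) => h.
  have d0 : d 0 0 = 0.
    have := e 0; rewrite veronese_diffE mxE /= subn0 mul0r !mul0r mulr0 addr0 expr0 mulr1.
    by move/eqP; rewrite !mulf_eq0 (negPf nn0) expf_eq0 (negPf h) andbF !orbF => /eqP.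
  have := e (inord 1); rewrite veronese_diffE mxE inordK ?ltnS ?(ltnW n_gt1) // d0 mul0r
    add0r expr0 mulr1 mul1r.
  move/eqP; rewrite mulf_eq0 expf_eq0 (negPf h) andbF orbF => /eqP d1.
  by apply: rowP2; rewrite mxE.
have d1 : d 0 1 = 0.
  have := e ord_max; rewrite veronese_diffE mxE /= subnn !mul0r mulr0 add0r expr0 mulr1.
  by move/eqP; rewrite !mulf_eq0 (negPf nn0) expf_eq0 (negPf h) andbF !orbF => /eqP.
have := e (inord n.-1); rewrite veronese_diffE mxE inordK ?ltnS ?leq_pred // d1 mul0r addr0.
rewrite -[X in (X - _)%N]n1 subSnn /= expr0 !mul1r.
move/eqP; rewrite mulf_eq0 expf_eq0 (negPf h) andbF orbF => /eqP d0.
by apply: rowP2; rewrite mxE.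
Qed.

End Hankel.

(** * The matrix [M2] at a point and its variation to first order *)

Section X2Points.
Variables (K : closedFieldType) (charK : [pchar K] =i pred0) (n : nat).
Hypothesis n_gt1 : (1 < n)%N.
Variable a : 'M[K]_(3, n.+1).
Hypothesis ha : proper_param a.
Local Notation f := (forms_vec a).
Local Notation df := (forms_diff a).
Implicit Types (c v x : 'rV[K]_3) (w d : 'rV[K]_2) (z : 'cV[K]_n.+1).

Let n_gt0 : (0 < n)%N. Proof. exact: ltnW. Qed.

Definition M2_at x : 'M[K]_(n.+2, n.+1) := map_mx (meval (x 0)) (M2 a).
(** The derivative of [M2] in the direction [v]: the upper rows are linear in the coordinates and
    the last three are constant. *)
Definition M2_dir v : 'M[K]_(n.+2, n.+1) :=
  \matrix_(i, j) if (i < n.-1)%N then M2_at v i j else 0.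

Lemma M2_atE x (i : 'I_n.+2) j : M2_at x i j =
  if (i < n.-1)%N then (if (i <= j <= i.+2)%N then x 0 (inord (j - i)) else 0)
  else a (inord (i - n.-1)) j.
Proof.
rewrite !mxE; case: ifP => _ /=; last by rewrite mevalC.
by case: ifP => _; rewrite ?mevalXU ?meval0.
Qed.

Lemma M2_at_mul x z (i : 'I_n.+2) : (M2_at x *m z) i 0 =
  if (i < n.-1)%N then hankel_row x z i else (a *m z) (inord (i - n.-1)) 0.
Proof.
rewrite mxE; case: ifP => lt_i.
  rewrite -(hankel_sum n_gt1 _ _ lt_i); apply: eq_bigr => j _.
  by rewrite M2_atE lt_i.
by rewrite mxE; apply: eq_bigr => j _; rewrite M2_atE lt_i.
Qed.

Lemma M2_dir_mul v z (i : 'I_n.+2) : (M2_dir v *m z) i 0 =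
  if (i < n.-1)%N then hankel_row v z i else 0.
Proof.
rewrite mxE; case: ifP => lt_i; last first.
  by rewrite big1 // => j _; rewrite mxE lt_i mul0r.
rewrite -(hankel_sum n_gt1 _ _ lt_i); apply: eq_bigr => j _.
by rewrite mxE lt_i M2_atE lt_i.
Qed.

Let top_idx (i : nat) : (i < n.-1)%N -> (i < n.+2)%N.
Proof. by move/leq_trans; apply; rewrite (leq_trans (leq_pred _)) // leqW. Qed.

Let bot_idx (u : 'I_3) : (n.-1 + u < n.+2)%N.
Proof.
have lt_u : (n.-1 + u < n.-1 + 3)%N by rewrite ltn_add2l.
by rewrite (leq_trans lt_u) // addn3 prednK.
Qed.

Lemma M2_at_kernel x v z z' : M2_at x *m z' + M2_dir v *m z = 0 <->
  (forall i, (i < n.-1)%N -> hankel_row x z' i + hankel_row v z i = 0) /\ a *m z' = 0.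
Proof.
split=> [/colP e|[h1 h2]].
  split=> [i lt_i|]; first by have := e (Ordinal (top_idx lt_i));
    rewrite mxE M2_at_mul M2_dir_mul /= lt_i mxE.
  apply/colP=> u; have := e (Ordinal (bot_idx u)).
  rewrite mxE M2_at_mul M2_dir_mul /= ltnNge leq_addr /= addKn inord_val addr0 => ->.
  by rewrite !mxE.
apply/colP=> i; rewrite mxE M2_at_mul M2_dir_mul [RHS]mxE.
by case: ifP => [/h1 //|_]; rewrite h2 mxE addr0.
Qed.

Lemma M2_at_kernel0 x z : M2_at x *m z = 0 <-> hankel_mx n x *m z = 0 /\ a *m z = 0.
Proof.
have -> : M2_at x *m z = M2_at x *m z + M2_dir 0 *m 0 by rewrite mulmx0 addr0.
have h0 i : hankel_row 0 (0 : 'cV[K]_n.+1) i = 0 by rewrite /hankel_row !mxE !mul0r !addr0.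
rewrite M2_at_kernel; split=> -[h1 h2]; split=> //.
  by apply/colP=> i; rewrite hankel_mulE // mxE -[RHS](h1 i (ltn_ord i)) h0 addr0.
move=> i lt_i; rewrite h0 addr0; have /colP/(_ (Ordinal lt_i)) := h1.
by rewrite hankel_mulE // mxE.
Qed.

Lemma meval_max_minor x k : (max_minor a k).@[x 0] = \det (row' k (M2_at x)).
Proof. by rewrite /max_minor -[LHS]/(meval (x 0) _) -det_map_mx map_row'. Qed.

Lemma restrict_max_minor c v k :
  restrict (c 0) (v 0) (max_minor a k) = \det (row' k (pencil (M2_at c) (M2_dir v))).
Proof.
rewrite /restrict /max_minor -det_map_mx map_row'; congr (\det (row' k _)).
apply/matrixP=> i j; rewrite [RHS]mxE [X in _ = X + _]mxE [X in _ = _ + X]mxE.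
rewrite [X in _ = _ + _ * X]mxE [M2_dir v i j]mxE !M2_atE !mxE.
case: ifP => _ /=; last by rewrite mmapC mulr0 addr0.
case: ifP => _; last by rewrite mmap0 !polyC0 mulr0 addr0.
by rewrite mmapX mmap1U mulrC -mul_polyC.
Qed.

Definition degenerate x := exists2 z : 'cV[K]_n.+1, z != 0 & M2_at x *m z = 0.

Lemma degenerateZ k x : k != 0 -> degenerate (k *: x) <-> degenerate x.
Proof.
move=> k0; have hZ z : hankel_mx n (k *: x) *m z = k *: (hankel_mx n x *m z).
  rewrite scalemxAl; congr (_ *m _); apply/matrixP=> i j; rewrite !mxE.
  by case: ifP => _; rewrite ?mulr0.
split=> -[z z0 /M2_at_kernel0 [h1 h2]]; exists z => //; apply/M2_at_kernel0; split=> //.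
  by apply: (scalerI k0); rewrite -hZ h1 scaler0.
by rewrite hZ h1 scaler0.
Qed.

Lemma supp_X2P (P : point K 2) : supp_X2 a P <-> degenerate (coords P).
Proof.
have cP := coords_neq0 P.
split=> [h|[z z0 Mz] k v].
  apply/minors_eq0P=> k; rewrite -meval_max_minor; apply: h => //.
  by rewrite line_coords memv_line.
rewrite line_coords => /vlineP [c ->]; rewrite scaler_eq0 negb_or => /andP [c0 _].
have /minors_eq0P : degenerate (c *: coords P) by apply/(degenerateZ _ c0); exists z.
by move/(_ k); rewrite -meval_max_minor.
Qed.

Lemma mul_veronese w : a *m (veronese_vec n w)^T = (f w)^T.
Proof. by rewrite forms_vecE trmx_mul trmxK. Qed.

Lemma mul_veronese_diff w d : a *m (veronese_diff n w d)^T = (df w d)^T.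
Proof. by rewrite /forms_diff trmx_mul trmxK. Qed.

Lemma hankel_mx_eq0 x z : (forall i, (i < n.-1)%N -> hankel_row x z i = 0) ->
  hankel_mx n x *m z = 0.
Proof. by move=> h; apply/colP=> i; rewrite hankel_mulE // h // mxE. Qed.

Lemma hankel_veronese_pair w w' :
  hankel_mx n (pair_form w w') *m (veronese_vec n w)^T = 0.
Proof.
apply: hankel_mx_eq0 => i lt_i; rewrite hankel_veronese // quad_pair_form.
have -> : det2 w w = 0 by rewrite /det2; ring.
by rewrite !mul0r.
Qed.

Lemma hankel_kernel_pair w w' z : det2 w w' != 0 ->
  hankel_mx n (pair_form w w') *m z = 0 ->
  exists x y : K, z = x *: (veronese_vec n w)^T + y *: (veronese_vec n w')^T.
Proof.
move=> dw; apply: hankel_kernel => //.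
- by apply: pair_form_neq0; [exact: det2_neq0l dw | exact: det2_neq0r dw].
- exact: hankel_veronese_pair.
- by rewrite pair_formC hankel_veronese_pair.
- exact: veronese_indep.
Qed.

Lemma hankel_veronese_diff_double w d :
  hankel_mx n (pair_form w w) *m (veronese_diff n w d)^T = 0.
Proof.
have d0 : det2 w w = 0 by rewrite /det2; ring.
apply: hankel_mx_eq0 => i lt_i;
  rewrite hankel_veronese_diff // ?quad_pair_form ?d0 ?mul0r //.
by rewrite quad_diff_pair_form d0 mulr0 mul0r addr0 mul0r.
Qed.

Lemma veronese_diffDr w d e : veronese_diff n w (d + e) = veronese_diff n w d +
  veronese_diff n w e.
Proof. by apply/rowP=> j; rewrite [RHS]mxE !veronese_diffE !mxE; ring. Qed.

Lemma veronese_diffZr w k d : veronese_diff n w (k *: d) = k *: veronese_diff n w d.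
Proof. by apply/rowP=> j; rewrite [RHS]mxE !veronese_diffE !mxE; ring. Qed.

Lemma hankel_kernel_double w z : w != 0 -> hankel_mx n (pair_form w w) *m z = 0 ->
  exists d, z = (veronese_diff n w d)^T.
Proof.
move=> w0; pose e0 : 'rV[K]_2 := \row_i (i == 0)%:R;
  pose e1 : 'rV[K]_2 := \row_i (i == 1)%:R.
move=> hz; have [x y e|x [y ->]] := hankel_kernel n_gt1 (pair_form_neq0 w0 w0)
   (hankel_veronese_diff_double w e0) (hankel_veronese_diff_double w e1) _ hz.
  have /(veronese_diff_indep charK n_gt1 w0) h : veronese_diff n w (x *: e0 + y *: e1) = 0.
    by apply: trmx_inj; rewrite veronese_diffDr !veronese_diffZr linearD !linearZ /= e
      trmx0.
  split; [have := congr1 (fun r : 'rV_2 => r 0 0) h|have := congr1 (fun r : 'rV_2 => r 0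
    1) h];
    by rewrite !mxE /= ?mulr0 ?mulr1 ?add0r ?addr0.
by exists (x *: e0 + y *: e1);
  rewrite veronese_diffDr !veronese_diffZr [RHS]linearD /= !linearZ.
Qed.

(** On the conic the kernel of the upper rows consists of the vectors tangent at [w], and the last
    three rows send such a vector to [df w d]. *)
Lemma degenerate_double w : w != 0 -> degenerate (pair_form w w) <-> critical a w.
Proof.
move=> w0; split=> [[z z0 /M2_at_kernel0 [hz az]]|[d d0 dd]].
  have [d ez] := hankel_kernel_double w0 hz; exists d; last first.
    by apply: trmx_inj; rewrite -mul_veronese_diff -ez az trmx0.
  apply: contraNneq z0 => d0; rewrite ez d0.
  by apply/eqP/colP=> i; rewrite !mxE !mul0r addr0.
exists (veronese_diff n w d)^T.
  apply: contra d0 => /eqP h; apply/eqP/(veronese_diff_indep charK n_gt1 w0).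
  by apply: trmx_inj; rewrite h trmx0.
apply/M2_at_kernel0; rewrite hankel_veronese_diff_double mul_veronese_diff dd.
by rewrite trmx0.
Qed.

(** When [f w' = l *: f w], this is the point of the secant through the images of [w] and [w'] that
    lies in the center of the projection. *)
Definition secant_vec (l : K) w w' : 'cV[K]_n.+1 :=
  l *: (veronese_vec n w)^T - (veronese_vec n w')^T.

Section Secant.
Variables (w w' : 'rV[K]_2) (l : K).
Hypothesis dw : det2 w w' != 0.
Hypothesis fw' : f w' = l *: f w.
Local Notation c := (pair_form w w').
Local Notation z0 := (secant_vec l w w').

Let w_neq0 : w != 0. Proof. exact: det2_neq0l dw. Qed.

Lemma secant_vec_neq0 : z0 != 0.
Proof.
apply/eqP=> e; have [|_ /eqP] := veronese_indep n_gt1 dw (x := l) (y := -1).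
  by rewrite scaleN1r.
by rewrite oppr_eq0 oner_eq0.
Qed.

Lemma M2_at_secant : M2_at c *m z0 = 0.
Proof.
apply/M2_at_kernel0; rewrite /secant_vec !mulmxBr -!scalemxAr !mul_veronese.
rewrite hankel_veronese_pair pair_formC hankel_veronese_pair scaler0 subr0; split=> //.
by rewrite fw' linearZ subrr.
Qed.

Lemma M2_at_secant_kernel y : M2_at c *m y = 0 -> exists t, y = t *: z0.
Proof.
move=> /M2_at_kernel0 [hy ay]; have [x1 [x2 ey]] := hankel_kernel_pair dw hy.
exists (- x2); move: ay; rewrite ey mulmxDr -!scalemxAr !mul_veronese fw' linearZ /=.
rewrite scalerA -scalerDl => /eqP; rewrite scaler_eq0 => /orP [/eqP h|]; last first.
  by rewrite -trmx0 (inj_eq trmx_inj) (negPf (forms_vec_neq0 ha w_neq0)).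
have -> : x1 = - (x2 * l) by apply/eqP; rewrite -addr_eq0 h.
by rewrite /secant_vec scalerBr scalerA mulNr !scaleNr opprK.
Qed.

(** [t] solves the equations of the upper rows; any other solution differs from it by a vector of
    the secant, which [a] sends into the line of [f w]. So the last three rows can be satisfied
    exactly when [a *m t] lies on this line. *)
Lemma secant_deformation v : (exists z', M2_at c *m z' + M2_dir v *m z0 = 0) <->
  (l * quad v w) *: df w w' - quad v w' *: df w' w \in <[f w]>%VS.
Proof.
set A := l * quad v w; set B := quad v w'.
have det_sq : det2 w w' ^+ 2 != 0 by rewrite expf_neq0.
have qd1 : quad_diff c w w' = - det2 w w' ^+ 2.
  by rewrite quad_diff_pair_form /det2; ring.
have qd2 : quad_diff c w' w = - det2 w w' ^+ 2.
  by rewrite quad_diff_pair_form /det2; ring.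
have qw : quad c w = 0 by rewrite quad_pair_form /det2; ring.
have qw' : quad c w' = 0 by rewrite quad_pair_form /det2; ring.
(* On the differential at [w] along [w'] the upper rows give [- det2 w w' ^+ 2] times the monomials
   of [w], and likewise at [w']; the coefficients are chosen to cancel the contribution of
   [M2_dir v *m z0]. *)
pose t : 'cV[K]_n.+1 := (A / det2 w w' ^+ 2) *: (veronese_diff n w w')^T
     - (B / det2 w w' ^+ 2) *: (veronese_diff n w' w)^T.
have rowD y1 y2 i : hankel_row c (y1 + y2) i = hankel_row c y1 i + hankel_row c y2 i.
  by rewrite /hankel_row !mxE; ring.
have rowZ x k y i : hankel_row x (k *: y) i = k * hankel_row x y i.
  by rewrite /hankel_row !mxE; ring.
have rowB x y1 y2 i : hankel_row x (y1 - y2) i = hankel_row x y1 i - hankel_row x y2 i.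
  by rewrite /hankel_row !mxE; ring.
have ht i : (i < n.-1)%N -> hankel_row c t i + hankel_row v z0 i = 0.
  move=> lt_i; rewrite /t /secant_vec !rowB !rowZ !hankel_veronese_diff //
    !hankel_veronese // qd1 qd2.
  by rewrite /A /B; field.
have at_ : a *m t = ((det2 w w' ^- 2) *: (A *: df w w' - B *: df w' w))^T.
  rewrite /t mulmxBr -!scalemxAr !mul_veronese_diff scalerBr !scalerA ![_ ^- 2 * _]mulrC.
  by rewrite linearB !linearZ.
have memE : (A *: df w w' - B *: df w' w \in <[f w]>%VS) =
    ((det2 w w' ^- 2) *: (A *: df w w' - B *: df w' w) \in <[f w]>%VS).
  by rewrite memvZ_eq // invr_neq0.
rewrite memE; split=> [[z' /M2_at_kernel [h1 h2]]|/vlineP [k ek]].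
  have : hankel_mx n c *m (z' - t) = 0.
    apply: hankel_mx_eq0 => i lt_i; rewrite rowB.
    by apply/eqP; rewrite subr_eq0 -(inj_eq (addIr (hankel_row v z0 i))) h1 // ht.
  case/(hankel_kernel_pair dw) => x [y ez].
  have : a *m (z' - t) = ((x + y * l) *: f w)^T.
    rewrite ez mulmxDr -!scalemxAr !mul_veronese fw'; move: (f w) => u.
    by apply/colP=> i; rewrite !mxE; ring.
  rewrite mulmxBr h2 sub0r at_ -linearN => /trmx_inj /(canRL (@opprK _)) ->.
  by rewrite memvN memvZ // memv_line.
exists (t - k *: (veronese_vec n w)^T); apply/M2_at_kernel; split=> [i lt_i|]; last first.
  by rewrite mulmxBr -scalemxAr mul_veronese at_ ek linearZ subrr.
by rewrite rowB rowZ hankel_veronese // qw mul0r mulr0 subr0 ht.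
Qed.

(** This describes the tangent directions of [X_2] at [c]; the kernel of [M2_at c] is the line of
    [z0], as [first_order_solution] requires. *)
Lemma order2_max_minors v :
  (forall k, 'X^2 %| restrict (c 0) (v 0) (max_minor a k)) <->
  (l * quad v w) *: df w w' - quad v w' *: df w' w \in <[f w]>%VS.
Proof.
rewrite -secant_deformation; split=> [h|[z' hz'] k].
  apply: first_order_solution secant_vec_neq0 M2_at_secant M2_at_secant_kernel _ => k.
  by rewrite -restrict_max_minor.
by rewrite restrict_max_minor; apply: first_order_minors secant_vec_neq0 M2_at_secant hz' k.
Qed.

Lemma degenerate_secant : degenerate c.
Proof. by exists z0; [exact: secant_vec_neq0 | exact: M2_at_secant]. Qed.

End Secant.

Lemma degenerate_pair w w' : det2 w w' != 0 ->
  degenerate (pair_form w w') <-> f w' \in <[f w]>%VS.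
Proof.
move=> dw; split=> [[z z0 /M2_at_kernel0 [hz az]]|/vlineP [l fw']]; last first.
  exact: degenerate_secant dw fw'.
have [x [y ez]] := hankel_kernel_pair dw hz.
move: az; rewrite ez mulmxDr -!scalemxAr !mul_veronese => e.
have {}e : x *: f w + y *: f w' = 0.
  by apply: trmx_inj; rewrite linearD !linearZ /= e trmx0.
have y0 : y != 0.
  apply: contraNneq z0 => y0; move: e; rewrite ez y0 !scale0r !addr0 => /eqP.
  rewrite scaler_eq0 (negPf (forms_vec_neq0 ha (det2_neq0l dw))) orbF => /eqP ->.
  by rewrite scale0r.
apply/vlineP; exists (- x / y); apply: (scalerI y0).
rewrite scalerA mulrC divfK // scaleNr; apply/eqP.
by rewrite -addr_eq0 addrC e.
Qed.

End X2Points.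

(** * Ideals with finitely many zeros *)

Section Ideals.
Variable K : closedFieldType.
Local Notation R := {mpoly K[3]}.

Record is_ideal (J : R -> Prop) : Prop := IsIdeal {
  ideal0 : J 0;
  idealD : forall p q, J p -> J q -> J (p + q);
  idealM : forall p q, J q -> J (p * q) }.

Definition zero_of (J : R -> Prop) (c : 'I_3 -> K) := forall p, J p -> p.@[c] = 0.

Definition at_var (j : 'I_3) : {rmorphism {poly K} -> R} :=
  horner_eval ('X_j : R) \o map_poly (@mpolyC 3 K).

Lemma at_var_X j : at_var j 'X = 'X_j.
Proof. by rewrite /= /horner_eval map_polyX hornerX. Qed.

Lemma at_var_C j c : at_var j c%:P = c%:MP.
Proof. by rewrite /= /horner_eval map_polyC hornerC. Qed.

Lemma meval_at_var j D c : (at_var j D).@[c] = D.[c j].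
Proof.
elim/poly_ind: D => [|D b IH]; first by rewrite rmorph0 meval0 horner0.
rewrite rmorphD rmorphM at_var_X at_var_C mevalD mevalM mevalXU mevalC IH.
by rewrite hornerMXaddC.
Qed.

Section Elimination.
Variables (J : R -> Prop) (i j k : 'I_3).
Hypothesis idJ : is_ideal J.
Hypotheses (ij : i != j) (ik : i != k) (jk : j != k).
Hypothesis cover : forall u, [\/ u = i, u = j | u = k].
Hypothesis J_i : J ('X_i - 1).

(** [phi] sends the inner variable to [X_j] and the outer one to [X_k]. Modulo [J], where [X_i] is
    [1], the map [psi] below gives every polynomial a preimage under [phi]. *)
Let phi : {rmorphism {poly {poly K}} -> R} :=
  horner_eval ('X_k : R) \o map_poly (at_var j).

Let phiC D : phi D%:P = at_var j D.
Proof.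
by rewrite -[LHS]/((map_poly (at_var j) D%:P).['X_k]) map_polyC hornerC.
Qed.

Let phiX : phi 'X = 'X_k.
Proof.
by rewrite -[LHS]/((map_poly (at_var j) 'X).['X_k]) map_polyX hornerX.
Qed.

Let psi (p : R) : {poly {poly K}} := mmap (polyC \o polyC)
  (fun u => if u == i then 1 else if u == j then 'X%:P else 'X) p.

Let idealN p : J p -> J (- p).
Proof. by move=> Jp; rewrite -mulN1r; apply: (idealM idJ). Qed.

Let phi_psi p : J (phi (psi p) - p).
Proof.
rewrite /psi; elim/mpoly_alg_ind: p => [c|u|p q IHp IHq|p q IHp IHq].
- rewrite mmapC [phi _](_ : _ = c%:MP) ?subrr; first exact: ideal0.
  exact: etrans (phiC _) (at_var_C _ _).
- rewrite mmapX mmap1U; case: (cover u) => ->.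
  + by rewrite eqxx rmorph1 -opprB; apply: idealN.
  + by rewrite eq_sym (negPf ij) eqxx phiC at_var_X subrr; apply: ideal0.
  + by rewrite eq_sym (negPf ik) eq_sym (negPf jk) phiX subrr; apply: ideal0.
- by rewrite mmapD rmorphD opprD addrACA; apply: (idealD idJ).
- rewrite [mmap _ _ (p * q)]rmorphM rmorphM.
  set x := phi _ in IHp *; set y := phi _ in IHq *.
  have -> : x * y - p * q = y * (x - p) + p * (y - q) by ring.
  by apply: (idealD idJ); apply: (idealM idJ).
Qed.

Let zero_lift l m : (forall G, J (phi G) -> G.[m%:P].[l] = 0) ->
  zero_of J (fun u => if u == i then 1 else if u == j then l else m).
Proof.
move=> h p Jp; rewrite -(h (psi p)); last first.
  have -> : phi (psi p) = (phi (psi p) - p) + p by rewrite subrK.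
  by apply: (idealD idJ).
rewrite -[RHS]/((horner_eval l \o horner_eval m%:P) _) /psi /meval.
symmetry; apply: rmorph_mmap => [c|u] /=; rewrite /horner_eval; first by rewrite !hornerC.
by case: ifP => _; [rewrite -[1]polyC1 !hornerC|case: ifP => _;
  rewrite ?hornerC ?hornerX ?hornerC].
Qed.

Variable rs : seq K.
Hypothesis zeros_J : forall c, zero_of J c -> c j \in rs.

Let zero_coord l m : zero_of J (fun u => if u == i then 1 else if u == j then l else m) ->
  l \in rs.
Proof. by move/zeros_J; rewrite eq_sym (negPf ij) eqxx. Qed.

(* An element of least degree in [X_k] divides, up to its leading coefficient,
   every element, so a positive degree would give infinitely many zeros. *)
Lemma exists_univariate : exists2 D : {poly K}, D != 0 & J (at_var j D).
Proof.
have desc m (d : {poly {poly K}}) : (size d <= m)%N -> d != 0 -> J (phi d) ->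
    exists2 D : {poly K}, D != 0 & J (at_var j D).
  elim: m d => [|m IH] d sz_d d0 Jd;
    first by rewrite leqn0 size_poly_eq0 (negPf d0) in sz_d.
  have [sz1|sz1] := leqP (size d) 1.
    have ed := size1_polyC sz1; exists d`_0; last by rewrite -phiC -ed.
    by apply: contraNneq d0 => e; rewrite ed e polyC0.
  (* A nonzero remainder is again in the ideal and has smaller degree in [X_k]. The division is a
     pseudo-division, which multiplies [g] by a power of the leading coefficient of [d]. *)
  have [[g [Jg nz]]|no] := Classical_Prop.classic
      (exists g, J (phi g) /\ Pdiv.Ring.rmodp g d != 0).
    apply: (IH (Pdiv.Ring.rmodp g d)) => //.
      by rewrite -ltnS (leq_trans _ sz_d) // Pdiv.Ring.ltn_rmodp.
    have e := Pdiv.ComRing.rdivp_eq d g.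
    have -> : Pdiv.Ring.rmodp g d = (lead_coef d ^+ Pdiv.Ring.rscalp g d)%:P * g
        - Pdiv.Ring.rdivp g d * d by rewrite mul_polyC e addrC addKr.
    rewrite rmorphB !rmorphM; apply: (idealD idJ); last apply: idealN;
      exact: (idealM idJ).
  exfalso; have lc0 : lead_coef d != 0 by rewrite lead_coef_eq0.
  have [r def_lc] := closed_field_poly_normal (lead_coef d).
  (* Off the roots of its leading coefficient, [d] keeps its positive degree in [X_k], so it has a
     root [m0] over [l]. The whole ideal vanishes at this point, although [l] is not in [rs]. *)
  have [l] := exists_notin (rs ++ r); rewrite mem_cat negb_or => /andP [/negP lrs lr].
  have lcl : (lead_coef d).[l] != 0.
    rewrite -/(root _ l) def_lc rootZ ?lead_coef_eq0 //.
    by rewrite root_prod_XsubC.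
  have /closed_rootP [m0 rm] : size (map_poly (horner_eval l) d) != 1%N.
    by rewrite size_map_poly_id0 ?gtn_eqF.
  apply/lrs/(zero_coord (m := m0))/zero_lift => g Jg.
  have r0 : Pdiv.Ring.rmodp g d = 0.
    by apply/eqP; apply: contraT => nz; case: no; exists g.
  have := Pdiv.ComRing.rdivp_eq d g; rewrite r0 addr0.
  move/(congr1 (fun G : {poly {poly K}} => G.[m0%:P].[l])); rewrite /= hornerZ !hornerM.
  have -> : d.[m0%:P].[l] = 0.
    rewrite -[LHS]/(horner_eval l _) -horner_map /= [horner_eval l _]hornerC.
    exact/rootP.
  rewrite mulr0 horner_exp => /eqP; rewrite mulf_eq0 expf_eq0 (negPf lcl) andbF /=.
  by move/eqP.
have [[d [d0 Jd]]|no] := Classical_Prop.classic (exists d, d != 0 /\ J (phi d)).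
  exact: (desc (size d) d).
(* If only the zero polynomial in the two chart coordinates lies in the ideal, every point of the
   chart is a zero, whatever [l]. *)
exfalso; have [l /negP lrs] := exists_notin rs.
apply/lrs/(zero_coord (m := 0))/zero_lift => G JG.
have -> : G = 0 by apply/eqP; apply: contraT => nz; case: no; exists G.
by rewrite !horner0.
Qed.

End Elimination.

Definition adjoin (L : R -> Prop) (q : R) (p : R) := exists r, L (p - r * q).

Lemma adjoin_ideal L q : is_ideal L -> is_ideal (adjoin L q).
Proof.
move=> idL; split=> [|p p' [r Lr] [r' Lr']|p p' [r Lr]].
- by exists 0; rewrite mul0r subr0; apply: ideal0.
- exists (r + r'); have -> : p + p' - (r + r') * q = (p - r * q) + (p' - r' * q) by ring.
  exact: (idealD idL).
- exists (p * r); have -> : p * p' - p * r * q = p * (p' - r * q) by ring.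
  exact: (idealM idL).
Qed.

Lemma sub_adjoin (L : R -> Prop) q p : L p -> adjoin L q p.
Proof. by exists 0; rewrite mul0r subr0. Qed.

Lemma adjoin_gen L q : is_ideal L -> adjoin L q q.
Proof. by move=> idL; exists 1; rewrite mul1r subrr; apply: ideal0. Qed.

(** [L] contains a product of factors [X_j - z]. Were [1] in each of the ideals obtained by
    adjoining one factor, the factors could be removed one at a time, leaving [1] in [L]. *)
Lemma exists_proper_adjoin L j D : is_ideal L -> ~ L 1 -> D != 0 -> L (at_var j D) ->
  exists c : K, ~ adjoin L ('X_j - c%:MP) 1.
Proof.
move=> idL L1 D0 LD; have [rs def_D] := closed_field_poly_normal D.
have {LD} : L (\prod_(z <- rs) ('X_j - z%:MP)).
  have lc0 : lead_coef D != 0 by rewrite lead_coef_eq0.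
  have -> : \prod_(z <- rs) ('X_j - z%:MP) = (lead_coef D)^-1%:MP * at_var j D.
    rewrite {2}def_D -mul_polyC rmorphM at_var_C mulrA -mpolyCM mulVf // mpolyC1 mul1r.
    rewrite rmorph_prod; apply: eq_bigr => z _.
    by rewrite rmorphB at_var_X at_var_C.
  exact: (idealM idL).
elim: rs {def_D} => [|c rs IH]; first by rewrite big_nil.
rewrite big_cons => Lp;
  have [[r Lr]|no] := Classical_Prop.classic (adjoin L ('X_j - c%:MP) 1).
  apply: IH; set P := \prod_(z <- rs) _ in Lp *.
  have -> : P = P * (1 - r * ('X_j - c%:MP)) + r * (('X_j - c%:MP) * P) by ring.
  by apply: (idealD idL); apply: (idealM idL).
by exists c.
Qed.

(** Adjoining a suitable [X_j - c_j] for each of the three variables keeps the ideal proper. Modulo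
    these, any [p] in [L] is the constant [p(c)], which must be zero. *)
Lemma weak_nullstellensatz L : is_ideal L -> ~ L 1 ->
  (forall j, exists2 D : {poly K}, D != 0 & L (at_var j D)) ->
  exists c, zero_of L c.
Proof.
move=> idL L1 hD.
have [D0 D00 LD0] := hD o0; have [D1 D10 LD1] := hD o1; have [D2 D20 LD2] := hD o2.
have [c0 h0] := exists_proper_adjoin idL L1 D00 LD0.
set L0 := adjoin L _ in h0; have id0 : is_ideal L0 by apply: adjoin_ideal.
have [c1 h1] := exists_proper_adjoin id0 h0 D10 (sub_adjoin _ LD1).
set M1 := adjoin L0 _ in h1; have id1 : is_ideal M1 by apply: adjoin_ideal.
have [c2 h2] := exists_proper_adjoin id1 h1 D20 (sub_adjoin _ (sub_adjoin _ LD2)).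
set M2 := adjoin M1 _ in h2; have id2 : is_ideal M2 by apply: adjoin_ideal.
pose c (u : 'I_3) := if val u == 0%N then c0 else if val u == 1%N then c1 else c2.
exists c => p Lp; apply/eqP; apply: contraT => nz; case: h2.
have [u ep] := mpoly_subr_meval c p.
have Mp : M2 p by do 3!apply: sub_adjoin.
have gens w : M2 ('X_w - (c w)%:MP).
  case: (ord3P w) => ->; rewrite /c /=; [do 2!apply: sub_adjoin|apply: sub_adjoin|];
    exact: adjoin_gen.
have Mc : M2 (p.@[c])%:MP.
  have -> : (p.@[c])%:MP = p + (-1) * \sum_i u i * ('X_i - (c i)%:MP).
    by rewrite {2}ep mulN1r addrK.
  apply: (idealD id2) => //; apply: (idealM id2).
  by elim/big_ind: _ => [|x y|w _]; [exact: ideal0|exact: (idealD id2)|exact: (idealM id2)].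
by rewrite -mpolyC1 -(mulVf nz) mpolyCM; apply: (idealM id2).
Qed.

Lemma restrict_coef0 c v (p : R) : (restrict c v p)`_0 = p.@[c].
Proof.
rewrite -horner_coef0 horner_restrict.
by apply: meval_eq => u; rewrite mul0r addr0.
Qed.

Lemma restrict_coef1 c v (p : R) u :
  p = (p.@[c])%:MP + \sum_i u i * ('X_i - (c i)%:MP) ->
  (restrict c v p)`_1 = \sum_i (u i).@[c] * v i.
Proof.
move=> {1}->; rewrite /restrict mmapD mmapC coefD coefC add0r.
rewrite raddf_sum /= coef_sum; apply: eq_bigr => i _.
rewrite rmorphM /= mmapB mmapX mmap1U mmapC addrAC subrr add0r -scalerAr coefZ coefMX /=.
by rewrite -[_`_0]/((restrict c v (u i))`_0) restrict_coef0 mulrC.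
Qed.

(* If the differentials at [c] of the elements of [J] span the cotangent space,
   then Cramer's rule shows that [J] contains the maximal ideal of [c] near [c]. *)
Lemma local_maximal_ideal J c (p : 'I_3 -> R) : is_ideal J -> zero_of J c ->
    (forall j, J (p j)) -> (forall j v, (restrict c v (p j))`_1 = v j) ->
  exists2 s : R, s.@[c] != 0 & forall g, g.@[c] = 0 -> J (s * g).
Proof.
move=> idJ zc Jp gp.
have ex_u j : exists u : {ffun 'I_3 -> R}, p j = \sum_k u k * ('X_k - (c k)%:MP)
    /\ forall k, (u k).@[c] = (k == j)%:R.
  have [u eu] := mpoly_subr_meval c (p j); exists [ffun k => u k]; split.
    by rewrite {1}eu (zc _ (Jp j)) mpolyC0 add0r; apply: eq_bigr => k _; rewrite ffunE.
  move=> k; have := gp j (fun l => (l == k)%:R); rewrite (restrict_coef1 _ eu).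
  rewrite (bigD1 k) //= eqxx mulr1 big1 ?addr0 => [|l /negPf ->]; last by rewrite mulr0.
  by rewrite ffunE eq_sym => ->.
have [u0 [e0 g0]] := ex_u o0; have [u1 [e1 g1]] := ex_u o1; have [u2 [e2 g2]] := ex_u o2.
pose u (j : 'I_3) := if val j == 0%N then u0 else if val j == 1%N then u1 else u2.
have eu j : p j = \sum_k u j k * ('X_k - (c k)%:MP) by case: (ord3P j) => ->; rewrite /u /=.
have gu j k : (u j k).@[c] = (k == j)%:R by case: (ord3P j) => ->; rewrite /u /=.
pose U : 'M[R]_3 := \matrix_(j, k) u j k.
(* [U] expresses the [p j] through the [X_k - c_k], and it is the identity at [c]. *)
exists (\det U).
  rewrite -[_.@[c]]/(meval c _) -det_map_mx (_ : map_mx _ U = 1%:M) ?det1 ?oner_eq0 //.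
  by apply/matrixP=> x y; rewrite !mxE /= gu eq_sym.
move=> g gc; have [q ->] := mpoly_subr_meval c g; rewrite gc mpolyC0 add0r mulr_sumr.
elim/big_ind: _ => [|x y|k _]; [exact: ideal0|exact: (idealD idJ)|].
rewrite mulrCA; apply: (idealM idJ).
pose x : 'cV[R]_3 := \col_k ('X_k - (c k)%:MP).
have Ux : U *m x = \col_j p j.
  by apply/colP=> y; rewrite !mxE eu; apply: eq_bigr => l _; rewrite !mxE.
have -> : \det U * ('X_k - (c k)%:MP) = (\adj U *m \col_j p j) k 0.
  by rewrite -Ux mulmxA mul_adj_mx mul_scalar_mx !mxE.
rewrite mxE; elim/big_ind: _ => [|y1 y2|l _]; [exact: ideal0|exact: (idealD idJ)|].
by rewrite [X in _ * X]mxE; apply: (idealM idJ).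
Qed.

(** [W] is a subspace given as a predicate. While a matrix [S] with rows in [W] has rank below 3, a
    nonzero column of its cokernel is killed by [S]; by assumption some [u] in [W] does not kill it,
    and adding [u] raises the rank. *)
Lemma span_of_annihilator (W : 'rV[K]_3 -> Prop) : W 0 ->
    (forall u v, W u -> W v -> W (u + v)) -> (forall k u, W u -> W (k *: u)) ->
    (forall v : 'cV[K]_3, (forall u, W u -> u *m v = 0) -> v = 0) ->
  forall u, W u.
Proof.
move=> W0 WD WZ hW.
have spanS r : (r <= 3)%N -> exists2 S : 'M[K]_3, (r <= \rank S)%N
    & forall u : 'rV[K]_3, (u <= S)%MS -> W u.
  elim: r => [|r IH] le_r3; first by exists 0 => // u; rewrite submx0 => /eqP ->.
  have [S rS hS] := IH (ltnW le_r3).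
  have [lt_r|le_r] := ltnP r (\rank S); first by exists S.
  have /matrix0Pn [i0 [j0 nz]] : cokermx S != 0.
    by rewrite -mxrank_eq0 mxrank_coker subn_eq0 -ltnNge (leq_ltn_trans le_r).
  pose v := col j0 (cokermx S).
  have Sv : S *m v = 0 by rewrite /v colE mulmxA mulmx_coker mul0mx.
  have [u Wu uv] : exists2 u, W u & u *m v != 0.
    apply: Classical_Prop.NNPP => no; case/eqP: nz.
    have v0 : v = 0.
      by apply: hW => u Wu; apply/eqP; apply: contraT => nz; case: no; exists u.
    by have /colP/(_ i0) := v0; rewrite !mxE.
  exists (S + u)%MS.
    apply: leq_ltn_trans rS _; apply: rank_ltmx; rewrite ltmxE addsmxSl addsmx_sub.
    rewrite submx_refl /=; apply: contra uv => /submxP [x ->].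
    by rewrite -mulmxA Sv mulmx0.
  move=> w /sub_addsmxP [[x y] /= ->]; apply: WD; first by apply: hS; rewrite submxMl.
  by rewrite [y]mx11_scalar mul_scalar_mx; apply: WZ.
have [S rS hS] := spanS 3%N (leqnn _).
move=> u; apply: hS; rewrite submx_full // /row_full eqn_leq rank_leq_col.
exact: rS.
Qed.

End Ideals.

Lemma classic_filter (T : eqType) (s : seq T) (A : T -> Prop) :
  exists s' : seq T, uniq s' /\ forall x, x \in s' <-> x \in s /\ A x.
Proof.
elim: s => [|y s [s' [us' s'P]]]; first by exists [::]; split=> // x; split=> // -[].
have [Ay|nAy] := Classical_Prop.classic (A y); last first.
  exists s'; split=> // x; rewrite s'P inE; split=> [[xs Ax]|[/predU1P [->//|xs] Ax]] //.
  by rewrite xs orbT.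
have [ys'|ys'] := boolP (y \in s').
  exists s'; split=> // x; rewrite s'P inE; split=> [[xs Ax]|[/predU1P [->|xs] Ax]] //.
    by rewrite xs orbT.
  exact/s'P.
exists (y :: s'); rewrite /= ys'; split=> // x; rewrite !inE.
split=> [/predU1P [->|/s'P [xs Ax]]|[/predU1P [->|xs] Ax]]; rewrite ?eqxx ?xs ?orbT //.
by apply/orP; right; apply/s'P.
Qed.

(** * The ideals of [X_2] in the charts *)

Section ChartIdeal.
Variables (K : closedFieldType) (n : nat) (a : 'M[K]_(3, n.+1)) (i : 'I_3).
Local Notation R := {mpoly K[3]}.
Local Notation J := (chart_ideal a i).

Lemma chart_ideal_is_ideal : is_ideal J.
Proof.
split=> [|_ _ [c [d ->]] [c' [d' ->]]|p _ [c [d ->]]].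
- by exists (fun=> 0), 0; rewrite big1 ?mul0r ?addr0 // => k _; rewrite mul0r.
- exists (fun k => c k + c' k), (d + d').
  under [in RHS]eq_bigr do rewrite mulrDl.
  by rewrite big_split mulrDl /=; ring.
- exists (fun k => p * c k), (p * d).
  under [in RHS]eq_bigr do rewrite -mulrA.
  by rewrite -mulr_sumr; ring.
Qed.

Lemma chart_ideal_minor k : J (max_minor a k).
Proof.
exists (fun l => (l == k)%:R), 0; rewrite mul0r addr0 (bigD1 k) //= eqxx mul1r.
by rewrite big1 ?addr0 // => l /negPf ->; rewrite mul0r.
Qed.

Lemma chart_ideal_chart : J ('X_i - 1).
Proof.
by exists (fun=> 0), 1; rewrite mul1r big1 ?add0r // => k _; rewrite mul0r.
Qed.

Lemma chart_ideal_sub (Q : R -> Prop) : is_ideal Q ->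
  (forall k, Q (max_minor a k)) -> Q ('X_i - 1) -> forall p, J p -> Q p.
Proof.
move=> idQ hm hi _ [c [d ->]]; apply: (idealD idQ); last exact: (idealM idQ).
by elim/big_ind: _ => [|x y|k _]; [exact: ideal0|exact: (idealD idQ)|exact: (idealM idQ)].
Qed.

Lemma order2_ideal (c v : 'I_3 -> K) : is_ideal (fun p => 'X^2 %| restrict c v p).
Proof.
split=> [|p q hp hq|p q hq]; rewrite /restrict.
- by rewrite mmap0 dvdp0.
- by rewrite mmapD dvdp_add.
- by rewrite rmorphM dvdp_mull.
Qed.

End ChartIdeal.

Section Squarefree.
Variable K : closedFieldType.

Lemma restrict_at_var (c v : 'I_3 -> K) j D :
  restrict c v (at_var K j D) = D \Po ((c j)%:P + v j *: 'X).
Proof.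
rewrite /restrict; elim/poly_ind: D => [|D b IH].
  by rewrite rmorph0 mmap0 comp_poly0.
rewrite rmorphD rmorphM at_var_X at_var_C rmorphD rmorphM /= IH mmapX mmap1U mmapC.
by rewrite comp_poly_MXaddC.
Qed.

Lemma coef1_comp_affine (D : {poly K}) c v :
  (D \Po (c%:P + v *: 'X))`_1 = D^`().[c] * v.
Proof.
have := congr1 (fun p : {poly K} => p`_0) (deriv_comp D (c%:P + v *: 'X)).
rewrite coef_deriv mulr1n => ->.
rewrite -horner_coef0 hornerM horner_comp derivD derivC derivZ derivX.
rewrite !hornerE; exact: mulr1.
Qed.

(** [E] is the squarefree part of [D], and the number of roots of [D] with multiplicity is a
    sufficient exponent. *)
Lemma dvdp_radical (D : {poly K}) : D != 0 -> exists (E : {poly K}) (m : nat),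
  [/\ D %| E ^+ m & forall x, root E x -> E^`().[x] != 0].
Proof.
move=> D0; have [r def_D] := closed_field_poly_normal D.
pose E := \prod_(z <- undup r) ('X - z%:P); exists E, (size r); split.
  rewrite def_D dvdpZl ?lead_coef_eq0 //.
  have key (s : seq K) : {subset s <= undup r} -> \prod_(z <- s) ('X - z%:P) %| E ^+ size s.
    elim: s => [|z s IH] sub; first by rewrite big_nil expr0.
    rewrite big_cons exprS dvdp_mul ?IH //; last by move=> y ys; rewrite sub // inE ys orbT.
    by rewrite dvdp_XsubCl root_prod_XsubC sub ?mem_head.
  by apply: key => z; rewrite mem_undup.
move=> x Ex; have := separable_prod_XsubC (undup r); rewrite undup_uniq unlock.
by move/coprimep_root/(_ Ex).
Qed.

End Squarefree.

(** * Finiteness of [X_2] *)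

Section X2.
Variables (K : closedFieldType) (charK : [pchar K] =i pred0) (n : nat).
Hypothesis n_gt1 : (1 < n)%N.
Variable a : 'M[K]_(3, n.+1).
Hypothesis ha : proper_param a.
Local Notation f := (forms_vec a).
Local Notation df := (forms_diff a).
Implicit Types (x : 'rV[K]_3) (w d : 'rV[K]_2).

Let n_gt0 : (0 < n)%N. Proof. exact: ltnW. Qed.

Lemma degenerate_pair_cases x : x != 0 -> degenerate a x ->
  exists w w', [/\ w != 0, w' != 0, x = pair_form w w' &
    if det2 w w' == 0 then critical a w else f w' \in <[f w]>%VS].
Proof.
move=> x0 dx; have [w [w' [w0 w'0 ex]]] := exists_pair_form x0.
exists w, w'; split=> //; rewrite ex in dx; case: ifP => [|/negbT dw].
  rewrite det2C oppr_eq0 => /(det2_eq0P _ w0)/vlineP [k ew'].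
  apply/(degenerate_double charK n_gt1 a w0).
  move: dx; rewrite ew' pair_formZr => /degenerateZ; apply => //.
  by apply: contraNneq w'0 => k0; rewrite ew' k0 scale0r.
exact/(degenerate_pair n_gt1 ha dw).
Qed.

Lemma fibre_finite_vec (e : 'rV[K]_3) : e != 0 ->
  exists2 s : seq 'rV[K]_2, {in s, forall w, w != 0} &
  forall w, w != 0 -> f w \in <[e]>%VS -> exists2 w', w' \in s & det2 w w' = 0.
Proof.
move=> e0; have [l lP] := exists_lform1 e0.
have [w0 [w1 [u2 [l1 [l2 [l3 [dw hd _]]]]]]] := exists_chart n_gt1 ha lP.
exact: fibre_finite dw hd.
Qed.

(** By generic injectivity, a pair of distinct points with equal images lies over one of finitely
    many points, each with a finite fibre; the double points come from the finitely many critical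
    ones. So all pairs are taken from one finite list [S]. *)
Lemma degenerate_finite : exists T : seq 'rV[K]_3, forall x, x != 0 ->
  degenerate a x -> exists2 t, t \in T & x \in <[t]>%VS.
Proof.
have [E En0 EP] := generically_injective_vec ha.
have [s1 s10 s1P] : exists2 s : seq 'rV[K]_2, {in s, forall w, w != 0} &
    forall e w, e \in E -> w != 0 ->
    f w \in <[e]>%VS -> exists2 w', w' \in s & det2 w w' = 0.
  elim: {EP} E En0 => [|e E IH] En0; first by exists [::].
  have [|s s0 sP] := IH; first by move=> e' e'E; apply: En0; rewrite inE e'E orbT.
  have [s' s'0 s'P] := fibre_finite_vec (En0 e (mem_head _ _)).
  exists (s' ++ s) => [w|e' w]; first by rewrite mem_cat => /orP [/s'0|/s0].
  rewrite inE => /predU1P [->|e'E] w0 fw.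
    by have [w' ws' dw] := s'P w w0 fw; exists w'; rewrite // mem_cat ws'.
  by have [w' ws' dw] := sP e' w e'E w0 fw; exists w'; rewrite // mem_cat ws' orbT.
have [qs qsP] := critical_enum charK n_gt1 ha.
pose S := map (@coords K 1) qs ++ s1.
have S0 : {in S, forall w, w != 0}.
  by move=> w; rewrite mem_cat => /orP [/mapP [Q _ ->]|/s10 //]; rewrite coords_neq0.
have SC w : w != 0 -> critical a w -> exists2 s, s \in S & det2 w s = 0.
  move=> w0 cw; have [c c0 ec] := vpoint_coords w0.
  exists (coords (vpoint w0)); last by rewrite ec /det2 !mxE; ring.
  by rewrite mem_cat map_f //; apply/qsP/critical_vpoint.
have SE e w : e \in E -> w != 0 -> f w \in <[e]>%VS -> exists2 s, s \in S & det2 w s = 0.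
  by move=> eE w0 fw; have [s ss ds] := s1P e w eE w0 fw; exists s;
    rewrite // mem_cat ss orbT.
exists [seq pair_form s s' | s <- S, s' <- S] => x x0 dx.
suff [w [w' [s [s' [-> sS s'S dw dw']]]]] : exists w w' s s',
      [/\ x = pair_form w w', s \in S, s' \in S, det2 w s = 0 & det2 w' s' = 0].
  exists (pair_form s s'); first exact: allpairs_f.
  move/eqP/(det2_eq0P _ (S0 s sS))/vlineP: dw => [k ->].
  move/eqP/(det2_eq0P _ (S0 s' s'S))/vlineP: dw' => [k' ->].
  by rewrite pair_formZl pair_formZr !memvZ // memv_line.
have [w [w' [w0 w'0 ex hc]]] := degenerate_pair_cases x0 dx; exists w, w'.
move: hc; case: ifP => [dw cw|/negbT dw fw'].
  have [s sS ds] := SC w w0 cw; exists s, s; split=> //.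
  move: dw; rewrite det2C oppr_eq0 => /(det2_eq0P _ w0)/vlineP [k ->].
  have -> : det2 (k *: w) s = k * det2 w s by rewrite /det2 !mxE; ring.
  by rewrite ds mulr0.
have [[e eE fe]|no] := Classical_Prop.classic (exists2 e, e \in E & f w \in <[e]>%VS).
  have [s sS ds] := SE e w eE w0 fe.
  have fe' : f w' \in <[e]>%VS by case/vlineP: fw' => k ->; apply: memvZ.
  by have [s' s'S ds'] := SE e w' eE w'0 fe'; exists s, s'.
case/eqP: dw; apply: EP w0 w'0 fw' _ => e eE; apply/negP=> fe; apply: no.
by exists e.
Qed.

Section Chart.
Variable i : 'I_3.
Local Notation J := (chart_ideal a i).

Lemma zero_of_chart_ideal (c : 'I_3 -> K) : zero_of J c <->
  c i = 1 /\ degenerate a (\row_u c u).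
Proof.
have cE p : p.@[c] = p.@[(\row_u c u) 0] by apply: meval_eq => u; rewrite mxE.
split=> [h|[ci /minors_eq0P hm] p].
  split; last by apply/minors_eq0P=> k; rewrite -meval_max_minor -cE;
    apply/h/chart_ideal_minor.
  have /eqP := h _ (chart_ideal_chart a i).
  by rewrite mevalB mevalXU meval1 subr_eq0 => /eqP.
apply: (chart_ideal_sub (Q := fun q => q.@[c] = 0));
  last by rewrite mevalB mevalXU meval1 ci subrr.
  split=> [|p1 p2 h1 h2|p1 p2 h]; first by rewrite meval0.
    by rewrite mevalD h1 h2 addr0.
  by rewrite mevalM h mulr0.
by move=> k; rewrite cE meval_max_minor.
Qed.

Lemma chart_zeros_finite : exists rs : seq K, forall c, zero_of J c -> forall j, c j \in rs.
Proof.
have [T TP] := degenerate_finite.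
exists (flatten [seq [seq t 0 j / t 0 i | j <- enum 'I_3] | t : 'rV[K]_3 <- T]) => c.
move=> /zero_of_chart_ideal [ci dc] j.
have x0 : \row_u c u != 0.
  by apply/eqP=> /rowP/(_ i); rewrite !mxE ci => /eqP; rewrite oner_eq0.
have [t tT /vlineP [k ek]] := TP _ x0 dc.
have ct u : c u = k * t 0 u by have /rowP/(_ u) := ek; rewrite !mxE.
apply/flatten_mapP; exists t => //; apply/mapP; exists j; first by rewrite mem_enum.
have ti : t 0 i != 0.
  by apply: contraNneq (oner_neq0 K) => ti; rewrite -ci ct ti mulr0.
apply: (mulIf ti); rewrite divfK // ct -[RHS]mul1r -ci ct; ring.
Qed.

Lemma chart_univariate j : exists2 D : {poly K}, D != 0 & J (at_var K j D).
Proof.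
have [<-|ij] := eqVneq i j.
  exists ('X - 1%:P); first by rewrite polyXsubC_eq0.
  by rewrite rmorphB at_var_X at_var_C mpolyC1; apply: chart_ideal_chart.
have [k [ik jk cover]] : exists k, [/\ i != k, j != k & forall u, [\/ u = i, u = j | u =
  k]].
  case: (ord3P i) (ord3P j) ij => -> [] -> // _;
  [exists o2|exists o1|exists o2|exists o0|exists o1|exists o0]; split=> // u;
    case: (ord3P u) => ->;
    by [apply: Or31|apply: Or32|apply: Or33].
have [rs rsP] := chart_zeros_finite.
apply: (exists_univariate (chart_ideal_is_ideal a i) ij ik jk cover
  (chart_ideal_chart a i) (rs := rs)).
by move=> c /rsP.
Qed.

End Chart.

End X2.

(** * The two equivalences *)

Section Main.
Variables (K : closedFieldType) (charK : [pchar K] =i pred0) (n : nat).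
Hypothesis n_gt1 : (1 < n)%N.
Variable a : 'M[K]_(3, n.+1).
Hypothesis ha : proper_param a.
Local Notation f := (forms_vec a).
Local Notation df := (forms_diff a).
Implicit Types (x : 'rV[K]_3) (w d : 'rV[K]_2).

Let n_gt0 : (0 < n)%N. Proof. exact: ltnW. Qed.

Let nn0 : n%:R != 0 :> K. Proof. exact: natn_neq0. Qed.

Lemma det2_coords_neq0 (Q Q' : point K 1) : Q <> Q' -> det2 (coords Q) (coords Q') != 0.
Proof. by move=> ne; apply/eqP=> h; apply: ne; apply/point_eq_det2. Qed.

Lemma same_image Q Q' : param a Q = param a Q' -> f (coords Q') \in <[f (coords Q)]>%VS.
Proof. by rewrite /param => ->; apply: memv_line. Qed.

Lemma tangentP (Q : point K 1) v :
  reflect (exists d, v = df (coords Q) d) (v \in projection a (tangent_line n Q)).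
Proof.
have dfE d : df (coords Q) d = d 0 0 *: (veronese_ds n (coords Q) *m a^T)
    + d 0 1 *: (veronese_dt n (coords Q) *m a^T).
  by rewrite /forms_diff mulmxDl !scalemxAl.
rewrite /projection /tangent_line limgD !limg_line !lfunE /=.
apply: (iffP memv_addP) => [[_ /vlineP [k ->] [_ /vlineP [l ->] ->]]|[d ->]].
  by exists (\row_i if i == 0 then k else l); rewrite dfE !mxE.
rewrite dfE; exists (d 0 0 *: (veronese_ds n (coords Q) *m a^T)).
  by rewrite memvZ ?memv_line.
by exists (d 0 1 *: (veronese_dt n (coords Q) *m a^T)); rewrite ?memvZ ?memv_line.
Qed.

(** Up to sign, the equation of the conic is the discriminant of the quadratic form, which for
    [pair_form w w'] is [det2 w w' ^+ 2]. *)
Lemma on_conicP (P : point K 2) w w' : coords P = pair_form w w' ->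
  on_conic P <-> det2 w w' = 0.
Proof.
move=> eP.
have cE (v : 'rV[K]_3) : (conic K).@[v 0] = 4%:R * v 0 o0 * v 0 o2 - v 0 o1 ^+ 2.
  rewrite /conic mevalB expr2 !mevalM !mevalXU mevalMn meval1 -expr2.
  by congr (4%:R * v 0 _ * v 0 _ - v 0 _ ^+ 2); apply: val_inj; rewrite /= inordK.
have cP : (conic K).@[coords P 0] = - det2 w w' ^+ 2.
  by rewrite cE eP /det2 !mxE /=; ring.
split=> [h|d0 v]; last first.
  rewrite line_coords => /vlineP [k ->] _.
  have -> : (conic K).@[(k *: coords P) 0] = k ^+ 2 * (conic K).@[coords P 0].
    by rewrite !cE !mxE; ring.
  by rewrite cP d0 expr0n /= oppr0 mulr0.
have := h (coords P); rewrite line_coords memv_line => /(_ isT (coords_neq0 P)).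
by rewrite cP => /eqP; rewrite oppr_eq0 expf_eq0 /= => /eqP.
Qed.

Lemma supp_X2_vpoint x (x0 : x != 0) : supp_X2 a (vpoint x0) <-> degenerate a x.
Proof.
rewrite (supp_X2P n_gt1 a); have [c c0 ->] := vpoint_coords x0.
exact: degenerateZ.
Qed.

Lemma on_conic_vpoint w w' (x0 : pair_form w w' != 0) :
  on_conic (vpoint x0) <-> det2 w w' = 0.
Proof.
have [c c0 ec] := vpoint_coords x0.
rewrite -pair_formZr in ec; rewrite (on_conicP ec).
have -> : det2 w (c *: w') = c * det2 w w' by rewrite /det2 !mxE; ring.
split=> [/eqP|->]; last by rewrite mulr0.
by rewrite mulf_eq0 (negPf c0) => /eqP.
Qed.

(** Two preimages make the image point singular without being a cusp; so in a cuspidal curve every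
    fibre is a single point. *)
Lemma cuspidal_injective : cuspidal a <-> (forall Q Q', param a Q = param a Q' -> Q = Q').
Proof.
split=> [cusp Q Q' e|inj P [[Q hQ] sP]]; last first.
  split; first by split=> //; exists Q.
  by exists Q; split=> // Q' hQ'; apply: inj; rewrite hQ hQ'.
apply: Classical_Prop.NNPP => ne.
have fQ0 := forms_vec_neq0 ha (coords_neq0 Q).
have hQ : param a Q = vpoint fQ0 by [].
have hQ' : param a Q' = vpoint fQ0 by rewrite -e.
have sP := singular_of_two_preimages charK n_gt1 ha hQ hQ' ne.
have [_ [Q0 [_ u]]] := cusp _ sP.
by apply: ne; rewrite -(u Q hQ) (u Q' hQ').
Qed.

(** A pair of distinct points with the same image is the same thing as a point of [X_2] off the
    conic. *)
Lemma injective_supp_conic : (forall Q Q', param a Q = param a Q' -> Q = Q') <->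
  (forall P, supp_X2 a P -> on_conic P).
Proof.
split=> [inj P|h Q Q' e].
  rewrite (supp_X2P n_gt1 a) => dP.
  have [w [w' [w0 w'0 eP hc]]] := degenerate_pair_cases charK n_gt1 ha (coords_neq0 P) dP.
  apply/(on_conicP eP); apply/eqP; apply: contraT => dw; move: hc; rewrite (negPf dw) => fw.
  have /(vpoint_eq w0 w'0) : vpoint w0 = vpoint w'0.
    apply: inj; rewrite (param_line ha (w := w)) ?memv_line // (param_line ha (w := w'))
      ?memv_line //.
    by apply/esym/(vline_eq fw)/(forms_vec_neq0 ha).
  by move/eqP; rewrite (negPf dw).
apply: Classical_Prop.NNPP => /det2_coords_neq0 dw.
have x0 := pair_form_neq0 (coords_neq0 Q) (coords_neq0 Q').
have /h : supp_X2 a (vpoint x0).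
  by apply/supp_X2_vpoint/(degenerate_pair n_gt1 ha dw); apply: same_image.
by move/on_conic_vpoint/eqP; rewrite (negPf dw).
Qed.

Definition image_point (Q : point K 1) : point K 2 :=
  vpoint (forms_vec_neq0 ha (coords_neq0 Q)).

(** The point of the conic whose quadratic form vanishes doubly at [Q]. *)
Definition double_point (Q : point K 1) : point K 2 :=
  vpoint (pair_form_neq0 (coords_neq0 Q) (coords_neq0 Q)).

Lemma double_point_inj : injective double_point.
Proof.
move=> Q Q' /(congr1 (@line K 2)) /= e.
have : pair_form (coords Q) (coords Q) \in <[pair_form (coords Q') (coords Q')]>%VS.
  by rewrite -e memv_line.
case/vlineP=> k ek; apply/point_eq_det2.
have := quad_pair_form (coords Q) (coords Q) (coords Q').
rewrite ek quadZ quad_pair_form.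
have -> : det2 (coords Q') (coords Q') = 0 by rewrite /det2; ring.
by rewrite mulr0 mulr0 => /esym/eqP; rewrite mulf_eq0 orbb => /eqP.
Qed.

(** Both sets are in bijection with the critical points of the parameterization, by [image_point]
    and by [double_point]. *)
Lemma cuspidal_card : cuspidal a ->
  exists N, has_card (singular a) N /\ has_card (supp_X2 a) N.
Proof.
move/cuspidal_injective => inj.
have [qs0 qs0P] := critical_enum charK n_gt1 ha.
have [qs [uqs qsP]] := classic_filter qs0 (critical_point a).
have {qs0P} qsP Q : Q \in qs <-> critical_point a Q.
  by rewrite qsP; split=> [[]//|cQ]; split=> //; apply: qs0P.
exists (size qs); split; [exists (map image_point qs)|exists (map double_point qs)];
  rewrite size_map map_inj_in_uniq //; try by move=> Q Q' _ _; [apply: double_point_inj].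
- split=> // P; split=> [/mapP [Q /qsP cQ ->]|sP].
    exact: (singular_of_critical charK n_gt1 ha (Q := Q)).
  case: (sP) => [[Q hQ] _]; have -> : P = image_point Q by apply: point_inj; rewrite -hQ.
  apply/map_f/qsP/(critical_of_singular charK n_gt1 ha sP hQ) => Q' hQ'.
  by apply: inj; rewrite hQ hQ'.
- by move=> Q Q' _ _ /(congr1 (@line K 2)) e; apply: inj.
- split=> // P; split=> [/mapP [Q /qsP cQ ->]|].
    by apply/supp_X2_vpoint/(degenerate_double charK n_gt1 a (coords_neq0 Q)).
  move=> /[dup] /(injective_supp_conic.1 inj) cP /(supp_X2P n_gt1 a) dP.
  have [w [w' [w0 w'0 eP hc]]] := degenerate_pair_cases charK n_gt1 ha (coords_neq0 P) dP.
  have dw := (on_conicP eP).1 cP; rewrite dw eqxx in hc.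
  have -> : P = double_point (vpoint w0).
    apply: point_inj; rewrite line_coords /= eP.
    have [c c0 ->] := vpoint_coords w0.
    move/eqP: dw; rewrite det2C oppr_eq0 => /(det2_eq0P _ w0)/vlineP [k ek].
    have k0 : k != 0 by apply: contraNneq w'0 => k0; rewrite ek k0 scale0r.
    apply: vline_eq; last exact: pair_form_neq0.
    rewrite ek pair_formZl !pair_formZr; apply/vlineP; exists (k / (c * c)).
    by rewrite !scalerA divfK // mulf_neq0.
  by apply/map_f/qsP/critical_vpoint.
Qed.

(** * From ordinary singularities to reducedness off the conic *)

Section OnlyOrdinary.
Hypothesis ord : only_ordinary_singularities a.

Lemma ordinary_fibre P : singular a P -> exists qs : seq (point K 1),
  [/\ uniq qs, {in qs, forall Q, param a Q = P}, multiplicity a P (size qs)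
    & {in qs &, forall Q Q', Q != Q' ->
        projection a (tangent_line n Q) <> projection a (tangent_line n Q')}].
Proof.
move/ord=> [m mP [Q [inj hQ hT]]]; exists (map Q (enum 'I_m)); split.
- rewrite map_inj_uniq ?enum_uniq // => i i' e; apply: inj.
  by rewrite e.
- by move=> _ /mapP [i _ ->]; rewrite -projection_veronese hQ.
- by rewrite size_map size_enum_ord.
- move=> _ _ /mapP [i _ ->] /mapP [i' _ ->] ne; apply: hT.
  by apply: contraNneq ne => ->.
Qed.

(** One more preimage would raise the multiplicity above [size qs]. *)
Lemma ordinary_fibre_full (P : point K 2) (qs : seq (point K 1)) : uniq qs -> {in qs,
  forall Q, param a Q = P} ->
  multiplicity a P (size qs) -> forall Q, param a Q = P -> Q \in qs.
Proof.
move=> uqs qsP mP Q hQ; apply: contraT => Qqs.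
have := multiplicity_ge charK n_gt1 ha (qs := Q :: qs) (b := false) (P := P) isT.
rewrite /= Qqs uqs => /(_ _ isT) H.
have := H _ _ _ mP; rewrite addn0 ltnn; apply=> //.
by move=> Q'; rewrite inE => /predU1P [->//|/qsP].
Qed.

(** A critical preimage would raise the multiplicity above the number of preimages. *)
Lemma ordinary_noncritical Q : ~ critical_point a Q.
Proof.
move=> cQ; have hQ : param a Q = image_point Q by [].
have sP := singular_of_critical charK n_gt1 ha hQ cQ.
have [qs [uqs qsP mP _]] := ordinary_fibre sP.
have Qqs := ordinary_fibre_full uqs qsP mP hQ.
have qs0 : (0 < size qs)%N by case: (qs) Qqs.
have : (size qs + true <= size qs)%N.
  by apply: (multiplicity_ge charK n_gt1 ha) qs0 uqs qsP _ mP => _; exists Q.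
by rewrite addn1 ltnn.
Qed.

Lemma noncritical w : w != 0 -> ~ critical a w.
Proof. by move=> w0 /(critical_vpoint a w0); apply: ordinary_noncritical. Qed.

Lemma ordinary_tangents Q Q' : Q <> Q' -> param a Q = param a Q' ->
  projection a (tangent_line n Q) <> projection a (tangent_line n Q').
Proof.
move=> ne e; have hQ : param a Q = image_point Q by [].
have hQ' : param a Q' = image_point Q by rewrite -e.
have sP := singular_of_two_preimages charK n_gt1 ha hQ hQ' ne.
have [qs [uqs qsP mP hT]] := ordinary_fibre sP.
apply: hT; rewrite ?(ordinary_fibre_full uqs qsP mP) //.
exact/eqP.
Qed.

Lemma ordinary_off_conic P : ~ (supp_X2 a P /\ on_conic P).
Proof.
move=> [/(supp_X2P n_gt1 a) dP cP].
have [w [w' [w0 w'0 eP hc]]] := degenerate_pair_cases charK n_gt1 ha (coords_neq0 P) dP.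
move: hc; rewrite ((on_conicP eP).1 cP) eqxx; exact: noncritical.
Qed.

Lemma tangent_scale w k d : k != 0 -> df w d = df (k *: w) (k ^- n.-1 *: d).
Proof.
move=> k0; rewrite forms_diffZl forms_diffZr scalerA divff ?scale1r //.
by rewrite expf_neq0.
Qed.

Lemma tangent_vpoint w (w0 : w != 0) v :
  v \in projection a (tangent_line n (vpoint w0)) <-> exists d, v = df w d.
Proof.
have [c c0 ec] := vpoint_coords w0; split=> [/tangentP [d ->]|[d ->]].
  by exists (c ^+ n.-1 *: d); rewrite ec forms_diffZl forms_diffZr.
by apply/tangentP; rewrite ec; exists (c ^- n.-1 *: d); apply: tangent_scale.
Qed.

(** If exactly one of [A] and [B] is zero, the relation makes [w] or [w'] critical. If neither is,
    it writes [df w w'] as a value of the differential at [w'] and [df w' w] as one at [w], so the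
    two tangent lines coincide. *)
Lemma ordinary_tangent_independent w w' A B : det2 w w' != 0 ->
    f w' \in <[f w]>%VS ->
  A *: df w w' - B *: df w' w \in <[f w]>%VS -> A = 0 /\ B = 0.
Proof.
move=> dw /vlineP [l fw'].
have w0 := det2_neq0l dw; have w'0 := det2_neq0r dw.
have dw' : det2 w' w != 0 by rewrite det2C oppr_eq0.
have l0 : l != 0.
  by apply: contraNneq (forms_vec_neq0 ha w'0) => l0; rewrite fw' l0 scale0r.
have fE : f w = l^-1 *: f w' by rewrite fw' scalerA mulVf // scale1r.
have A0B0 : A = 0 -> A *: df w w' - B *: df w' w \in <[f w]>%VS -> B = 0.
  move=> ->; rewrite scale0r sub0r memvN => h; apply/eqP; apply: contraT => B0.
  case: (noncritical w'0); apply/(criticalP charK n_gt0 ha dw').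
  by move: h; rewrite memvZ_eq // => /vlineP [k ->]; rewrite fE scalerA memvZ ?memv_line.
move=> h; have [A0|A0] := eqVneq A 0; first by split=> //; apply: A0B0 h.
have [B0|B0] := eqVneq B 0.
  case: (noncritical w0); apply/(criticalP charK n_gt0 ha dw).
  by move: h; rewrite B0 scale0r subr0 memvZ_eq.
case/vlineP: h => k ek.
have ne : vpoint w0 <> vpoint w'0 by move/vpoint_eq/eqP; rewrite (negPf dw).
case: (ordinary_tangents ne).
  rewrite (param_line ha (w := w)) ?memv_line // (param_line ha (w := w')) ?memv_line //.
  by apply: vline_eq; rewrite ?(forms_vec_neq0 ha) // fE memvZ ?memv_line.
have eul u : f u = df u (n%:R^-1 *: u).
  by rewrite forms_diffZr forms_diff_self scalerA mulVf // scale1r.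
have dE1 : df w w' = df w' ((k / A / l / n%:R) *: w' + (B / A) *: w).
  apply: (scalerI A0); rewrite forms_diffDr !forms_diffZr forms_diff_self.
  move/eqP: ek; rewrite subr_eq => /eqP ->; rewrite fE scalerDr !scalerA.
  by congr (_ *: _ + _ *: _); field; rewrite ?A0 ?l0 ?nn0.
have dE2 : df w' w = df w ((- k / B / n%:R) *: w + (A / B) *: w').
  apply: (scalerI B0); rewrite forms_diffDr !forms_diffZr forms_diff_self.
  have -> : B *: df w' w = A *: df w w' - k *: f w by rewrite -ek opprB addrC subrK.
  rewrite scalerDr !scalerA addrC -scaleNr.
  by congr (_ *: _ + _ *: _); field; rewrite ?B0 ?nn0.
have sub u u' (u0 : u != 0) (u'0 : u' != 0) (du : det2 u u' != 0) c e :
    f u = c *: f u' -> df u u' = df u' e ->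
    (projection a (tangent_line n (vpoint u0)) <= projection a (tangent_line n (vpoint
      u'0)))%VS.
  move=> fu du'; apply/subvP=> v /tangent_vpoint [d ->]; apply/tangent_vpoint.
  rewrite (det2_basis d du) forms_diffDr !forms_diffZr forms_diff_self fu du' eul.
  by rewrite -!forms_diffZr -forms_diffDr; eexists.
apply/eqP; rewrite eqEsubv; apply/andP; split.
  exact: (sub _ _ _ _ dw _ _ fE dE1).
exact: (sub _ _ _ _ dw' _ _ fw' dE2).
Qed.

(** If [g ^+ e] is in the ideal and [g] is not, the ideal [L] of all [p] with [p * g] in it is
    proper and has a zero [c]. As the differentials at [c] span the cotangent space, some [s]
    nonzero at [c] has [s * g] in the ideal; then [s] is in [L] and should vanish at [c]. *)
Lemma ordinary_reduced : X2_reduced a.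
Proof.
move=> i g e Jge; apply: Classical_Prop.NNPP => nJg.
have idJ := chart_ideal_is_ideal a i.
pose L p := chart_ideal a i (p * g).
have idL : is_ideal L.
  split=> [|p q hp hq|p q hq]; rewrite /L.
  - by rewrite mul0r; apply: ideal0.
  - by rewrite mulrDl; apply: (idealD idJ).
  - by rewrite -mulrA; apply: (idealM idJ).
have subL p : chart_ideal a i p -> L p by move=> Jp; rewrite /L mulrC; apply: (idealM idJ).
have [||c zc] := weak_nullstellensatz idL.
- by rewrite /L mul1r.
- by move=> j; have [D D0 JD] := chart_univariate charK n_gt1 ha i j; exists D => //;
  apply: subL.
have zJ : zero_of (chart_ideal a i) c by move=> p /subL /zc.
have gc : g.@[c] = 0.
  by have := zJ _ Jge; rewrite rmorphXn /= => /eqP; rewrite expf_eq0 => /andP [_ /eqP].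
(* [W] is the space of differentials at [c] of the elements of the chart ideal; a vector [v]
   annihilated by it is a tangent vector of [X_2] at [c]. *)
pose W (u : 'rV[K]_3) := exists2 p, chart_ideal a i p &
  forall v, (restrict c v p)`_1 = \sum_k u 0 k * v k.
have Wfull : forall u, W u.
  apply: span_of_annihilator => [|u v [p Jp pE] [q Jq qE]|k u [p Jp pE]|v hv].
  - exists 0; first exact: ideal0.
    by move=> v; rewrite /restrict mmap0 coef0 big1 // => k _; rewrite mxE mul0r.
  - exists (p + q); first exact: (idealD idJ).
    move=> x; rewrite /restrict mmapD coefD pE qE -big_split /=.
    by apply: eq_bigr => k _; rewrite mxE mulrDl.
  - exists (k%:MP * p); first exact: (idealM idJ).
    move=> x; rewrite /restrict rmorphM /= mmapC coefCM pE mulr_sumr.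
    by apply: eq_bigr => l _; rewrite mxE mulrA.
  pose x : 'rV[K]_3 := \row_u c u; pose vr := fun k => v k 0.
  have hp p : chart_ideal a i p -> (restrict c vr p)`_1 = 0.
    move=> Jp; have [u eu] := mpoly_subr_meval c p.
    have /hv /matrixP/(_ 0 0) : W (\row_k (u k).@[c]).
      exists p => // y; rewrite (restrict_coef1 _ eu).
      by apply: eq_bigr => k _; rewrite mxE.
    rewrite !mxE (restrict_coef1 _ eu) => e0; rewrite -[RHS]e0.
    by apply: eq_bigr => k _; rewrite mxE.
  have vi : v i 0 = 0.
    have := hp _ (chart_ideal_chart a i); rewrite /restrict mmapB mmapX mmap1U rmorph1.
    by rewrite coefB coefD coefC coefZ coefX coef1 /= add0r subr0 mulr1.
  have [ci dx] := (zero_of_chart_ideal a i c).1 zJ.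
  have x0 : x != 0.
    by apply/eqP=> /rowP/(_ i); rewrite !mxE ci => /eqP; rewrite oner_eq0.
  have [w [w' [w0 w'0 ex hc]]] := degenerate_pair_cases charK n_gt1 ha x0 dx.
  have dw : det2 w w' != 0.
    by apply/eqP=> dw; move: hc; rewrite dw eqxx; apply: noncritical.
  move: hc; rewrite (negPf dw) => /[dup] fw /vlineP [l fw'].
  have ord2 k : 'X^2 %| restrict (pair_form w w' 0) (v^T 0) (max_minor a k).
    have -> : restrict (pair_form w w' 0) (v^T 0) (max_minor a k) = restrict c vr
      (max_minor a k).
      by apply: restrict_ext => u; rewrite -?ex !mxE.
    apply/dvdXnP=> [[|[|j]]] // _; last exact/hp/chart_ideal_minor.
    by rewrite restrict_coef0; apply/zJ/chart_ideal_minor.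
  have := (order2_max_minors n_gt1 ha dw fw' v^T).1 ord2.
  case/(ordinary_tangent_independent dw fw) => q1 q2.
  have l0 : l != 0.
    by apply: contraNneq (forms_vec_neq0 ha w'0) => l0; rewrite fw' l0 scale0r.
  have qw : quad v^T w = 0.
    by move/eqP: q1; rewrite mulf_eq0 (negPf l0) => /eqP.
  (* A quadratic form vanishing at both points is a multiple of the point itself; since [v i 0 = 0]
     and [c i = 1], that multiple is zero. *)
  have [k ek] := quad_two_roots dw qw q2.
  have k0 : k = 0.
    have /rowP/(_ i) := ek; rewrite -ex !mxE vi ci mulr1 => <- //.
  by apply: trmx_inj; rewrite ek k0 scale0r trmx0.
have ex_p j : exists p, chart_ideal a i p /\ forall v, (restrict c v p)`_1 = v j.
  have [p Jp pE] := Wfull (delta_mx 0 j); exists p; split=> // v.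
  rewrite pE (bigD1 j) //= mxE !eqxx mul1r big1 ?addr0 // => k /negPf kj.
  by rewrite mxE kj andbF mul0r.
have [p0 [J0 E0]] := ex_p o0; have [p1 [J1 E1]] := ex_p o1; have [p2 [J2 E2]] := ex_p o2.
pose p (j : 'I_3) := if val j == 0%N then p0 else if val j == 1%N then p1 else p2.
have [||s sc sJ] := local_maximal_ideal (p := p) idJ zJ.
- by move=> j; case: (ord3P j) => ->.
- by move=> j; case: (ord3P j) => -> v; rewrite /p /=.
by have /eqP := zc s (sJ g gc); rewrite (negPf sc).
Qed.

End OnlyOrdinary.

(** * From reducedness off the conic to ordinary singularities *)

Section Reduced.
Hypothesis red : X2_reduced a.
Hypothesis off : forall P, ~ (supp_X2 a P /\ on_conic P).

Lemma reduced_noncritical w : w != 0 -> ~ critical a w.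
Proof.
move=> w0 cw; have x0 := pair_form_neq0 w0 w0; apply: (off (P := vpoint x0)); split.
  by apply/supp_X2_vpoint/(degenerate_double charK n_gt1 a w0).
by apply/on_conic_vpoint; rewrite /det2; ring.
Qed.

(** The chart ideal contains a nonzero polynomial in [X_j] alone, hence by reducedness its
    squarefree part [E]. As [c j] is a simple root of [E], vanishing to second order along [v]
    forces [v j = 0]. *)
Lemma reduced_tangent_vector i (c v : 'I_3 -> K) :
  zero_of (chart_ideal a i) c ->
  (forall p, chart_ideal a i p -> 'X^2 %| restrict c v p) -> forall j, v j = 0.
Proof.
move=> zc h j; have [D D0 JD] := chart_univariate charK n_gt1 ha i j.
have [E [m [/dvdpP [q eq_E] sepE]]] := dvdp_radical D0.
have JE : chart_ideal a i (at_var K j E).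
  apply: (red (e := m)); rewrite -rmorphXn eq_E rmorphM.
  exact: (idealM (chart_ideal_is_ideal a i)).
have Ec : root E (c j) by apply/rootP; rewrite -meval_at_var; apply: zc.
have /dvdXnP/(_ 1%N isT) := h _ JE.
rewrite restrict_at_var coef1_comp_affine => /eqP.
by rewrite mulf_eq0 (negPf (sepE _ Ec)) => /eqP.
Qed.

(** If the tangent lines coincide, one constructs a nonzero direction [v], tangent to the chart,
    along which all minors vanish to second order at the point given by the pair; this contradicts
    [reduced_tangent_vector]. *)
Lemma reduced_tangents Q Q' : Q <> Q' -> param a Q = param a Q' ->
  projection a (tangent_line n Q) <> projection a (tangent_line n Q').
Proof.
move=> ne e eT; set w := coords Q.
have w0 : w != 0 := coords_neq0 Q.
have dw1 : det2 w (coords Q') != 0 := det2_coords_neq0 ne.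
have y0 : pair_form w (coords Q') != 0 := pair_form_neq0 w0 (coords_neq0 Q').
have [i yi] : exists i, pair_form w (coords Q') 0 i != 0 by apply/rV0Pn.
set s := pair_form w (coords Q') 0 i in yi.
(* The scaling puts the vector [pair_form w w'] in the chart, with coordinate [i] equal to 1. *)
pose w' := s^-1 *: coords Q'.
have dw : det2 w w' != 0.
  have -> : det2 w w' = s^-1 * det2 w (coords Q') by rewrite /det2 !mxE; ring.
  by rewrite mulf_neq0 ?invr_eq0.
have w'0 := det2_neq0r dw.
have [l fw'] : exists l, f w' = l *: f w.
  by have /vlineP [k ek] := same_image e; exists (s^-1 ^+ n * k);
    rewrite forms_vecZ ek scalerA.
have l0 : l != 0.
  by apply: contraNneq (forms_vec_neq0 ha w'0) => l0; rewrite fw' l0 scale0r.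
pose c := pair_form w w'.
have ci : c 0 i = 1 by rewrite /c pair_formZr mxE mulVf.
have [d ed] : exists d, df w' w = df w d.
  apply/tangentP; rewrite -/w eT; apply/tangentP.
  by exists (s^-1 ^+ n.-1 *: w); rewrite /w' forms_diffZl forms_diffZr.
set x1 := det2 d w' / det2 w w'; set y1 := det2 w d / det2 w w'.
(* With these values the combination in [order2_max_minors] becomes [y1 *: df w w' - df w d], in
   which the component along [w'] cancels and only a multiple of [f w] is left. *)
have [v0 [q1 q2]] := quad_interpolate (y1 / l) 1 dw.
(* Subtracting a multiple of [c] makes coordinate [i] zero, as tangency to the chart requires; the
   values at [w] and [w'] do not change, since the form [c] vanishes there. *)
pose v := v0 - v0 0 i *: c.
have qc1 : quad c w = 0 by rewrite quad_pair_form /det2; ring.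
have qc2 : quad c w' = 0 by rewrite quad_pair_form /det2; ring.
have qE u : quad v u = quad v0 u - v0 0 i * quad c u.
  by rewrite /v -scaleNr quadD quadZ mulNr.
have qv1 : quad v w = y1 / l by rewrite qE qc1 mulr0 subr0.
have qv2 : quad v w' = 1 by rewrite qE qc2 mulr0 subr0.
have vi : v 0 i = 0.
  have -> : v 0 i = v0 0 i - v0 0 i * c 0 i by rewrite !mxE.
  by rewrite ci mulr1 subrr.
have minors k : 'X^2 %| restrict (c 0) (v 0) (max_minor a k).
  move: k; apply: (order2_max_minors n_gt1 ha dw fw' v).2.
  rewrite qv1 qv2 mulrCA divff // mulr1 scale1r ed (det2_basis d dw) -/x1 -/y1.
  rewrite forms_diffDr !forms_diffZr forms_diff_self opprD addrCA subrr addr0.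
  by rewrite memvN !memvZ ?memv_line.
have dc : degenerate a c by apply/(degenerate_pair n_gt1 ha dw);
  rewrite fw' memvZ ?memv_line.
have zc : zero_of (chart_ideal a i) (c 0).
  apply/zero_of_chart_ideal; split=> //.
  by have -> : \row_u c 0 u = c by apply/rowP=> u; rewrite mxE.
have v0E : v = 0.
  apply/rowP=> j; rewrite [RHS]mxE.
  apply: (reduced_tangent_vector zc) j => p.
  apply: (chart_ideal_sub (Q := fun q => 'X^2 %| restrict (c 0) (v 0) q));
    [exact: order2_ideal|exact: minors|].
  have -> : restrict (c 0) (v 0) ('X_i - 1) = (c 0 i)%:P + v 0 i *: 'X - 1.
    by rewrite /restrict mmapB mmapX mmap1U rmorph1.
  by rewrite ci vi scale0r addr0 subrr dvdp0.
move: qv2; rewrite v0E /quad !mxE !mul0r !addr0 => /esym/eqP.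
by rewrite oner_eq0.
Qed.

Lemma veronese_inj (Q Q' : point K 1) : veronese n Q = veronese n Q' -> Q = Q'.
Proof.
move=> e; apply: Classical_Prop.NNPP => /det2_coords_neq0 dw.
have : veronese_vec n (coords Q') \in veronese n Q by rewrite e memv_line.
case/vlineP=> k ek.
have [|_ /eqP] := veronese_indep n_gt1 dw (x := k) (y := -1).
  by rewrite ek linearZ /= scaleN1r subrr.
by rewrite oppr_eq0 oner_eq0.
Qed.

(** The required points are the whole fibre of [P]: without critical preimages its size is the
    multiplicity. *)
Lemma reduced_only_ordinary : only_ordinary_singularities a.
Proof.
move=> P [onP _]; have [qs [uqs qsP]] := fibre_enum n_gt1 ha onP.
have noncrit : {in qs, forall Q, ~ critical_point a Q}.
  by move=> Q _; apply: reduced_noncritical; apply: coords_neq0.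
exists (size qs); first exact: (multiplicity_fibre charK n_gt1 ha).
exists (tnth (in_tuple qs)).
have inj : injective (tnth (in_tuple qs)) by apply/tuple_uniqP.
split=> [i i' /veronese_inj /inj //|i|i i' ne].
  by rewrite projection_veronese; apply/qsP/mem_tnth.
apply: reduced_tangents; first by move/inj/eqP; rewrite (negPf ne).
have onQ j : param a (tnth (in_tuple qs) j) = P by apply/qsP/mem_tnth.
by rewrite !onQ.
Qed.

End Reduced.

End Main.

Theorem proposition3p1 (K : closedFieldType) (charK : [pchar K] =i pred0)
    (n : nat) (hn : (3 <= n)%N) (a : 'M[K]_(3, n.+1)) (ha : proper_param a) :
  [/\ cuspidal a <-> (forall P, supp_X2 a P -> on_conic P),
      only_ordinary_singularities a <->
        X2_reduced a /\ (forall P, ~ (supp_X2 a P /\ on_conic P))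
    & cuspidal a ->
        exists N : nat, has_card (singular a) N /\ has_card (supp_X2 a) N].
Proof.
have n_gt1 : (1 < n)%N by apply: leq_trans hn.
split.
- exact: iff_trans (cuspidal_injective charK n_gt1 ha) (injective_supp_conic charK n_gt1
  ha).
- split=> [ord|[red off]]; last exact: reduced_only_ordinary.
  by split; [exact: ordinary_reduced | exact: ordinary_off_conic].
- exact: cuspidal_card.
Qed.
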